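(* Let $D\subset \mathbb{C}^N$ be a bounded strongly convex domain with smooth boundary. Let $(\phi_t)_{t\ge0}$ be a semigroup of holomorphic self-maps of $D$. Let $t_0>0$ and let $p\in \partial D$ be a regular contact point for $\phi_{t_0}$. Then there exists $T\in [t_0,+\infty]$ such that $p$ is a regular contact point for $\phi_t$ for all $t\in [0,T)$. Moreover, the curve $[0,T)\ni r\mapsto \phi_r(p)\in \partial D$ is continuous.
   Context: $k_D$ denotes the Kobayashi distance of $D$, normalized so that on the unit disc $\mathbb{D}$ it is the Poincaré distance with $k_{\mathbb{D}}(0,\zeta)=\frac12\log\frac{1+|\zeta|}{1-|\zeta|}$. A semigroup of holomorphic self-maps of $D$ is a family $(\phi_t)_{t\ge0}$ of holomorphic maps $\phi_t:D\to D$ with $\phi_0=\mathrm{id}_D$, $\phi_{t+s}=\phi_t\circ\phi_s$ for all $s,t\ge 0$, and such that $t\mapsto\phi_t$ is continuous from $[0,+\infty)$ (Euclidean topology) to the space of holomorphic self-maps of $D$ (topology of uniform convergence on compacta). Fix $z_0\in D$. For $p\in\partial D$ and $M>1$ the $K$-region is $$K_{z_0}(p,M)=\Bigl\{z\in D : \lim_{w\to p}[k_D(z,w)-k_D(z_0,w)]+k_D(z_0,z)<\log M\Bigr\}$$ (the limit is known to exist). A holomorphic $f:D\to D$ has $K$-limit $q$ at $p\in\partial D$, written $f(p)=q$, if $\lim_k f(w_k)=q$ for every sequence $\{w_k\}\subset D$ converging to $p$ with $\{w_k\}\subset K_{z_0}(p,M)$ for some $M>1$. In particular $\phi_r(p)$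 denotes the $K$-limit of $\phi_r$ at $p$. The boundary dilation coefficient $\alpha_p(f)\in(0,+\infty]$ of $f$ at $p$ is defined by $\frac12\log\alpha_p(f)=\liminf_{w\to p}[k_D(z_0,w)-k_D(z_0,f(w))]$. These notions do not depend on $z_0$. A point $p\in\partial D$ is a contact point of $f$ if the $K$-limit $f(p)$ exists and $f(p)\in\partial D$; it is a regular contact point if moreover $\alpha_p(f)<+\infty$. *)

(* Defs.v *)
From HB Require Import structures.
From mathcomp Require Import all_boot all_order all_algebra.
From mathcomp Require Import all_classical all_reals all_analysis.
From mathcomp Require Export complex.

Set Implicit Arguments.
Unset Strict Implicit.
Unset Printing Implicit Defensive.

Import Order.TTheory GRing.Theory Num.Theory.
Import numFieldNormedType.Exports.

Local Open Scope classical_set_scope.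
Local Open Scope ring_scope.

(* [R[i]] packed as a [numClosedFieldType]: the library attaches its normed
   topology to sorts of such structures, not to the bare type [R[i]]. *)
Definition Cplx (R : realType) : numClosedFieldType := R[i].

(* C^N; its norm is the max-norm, with values in [Cplx R]. *)
Notation CN R N := 'rV[Cplx R]_N.

Definition boundary (T : topologicalType) (A : set T) : set T :=
  closure A `\` interior A.

Section smooth_boundary.
Context {R : realType} {N : nat}.
Implicit Types (U D : set (CN R N)) (rho : CN R N -> R) (v z p : CN R N).

(* C^N seen as R^(2N): the variable [t] is real. *)
Definition along_line rho v z : R -> R :=
  fun t => rho (z + (t%:C)%C *: v).

Definition Dreal rho v z : R := 'D_1 (along_line rho v z) 0.

Fixpoint Ck (k : nat) U rho : Prop :=
  (forall z, U z -> {for z, continuous rho}) /\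
  if k is k'.+1 then
    forall v, (forall z, U z -> derivable (along_line rho v z) 0 1) /\
              Ck k' U (Dreal rho v)
  else True.

Definition smooth U rho := forall k, Ck k U rho.

Definition local_defining_function D p U rho : Prop :=
  [/\ open U, U p, smooth U rho,
      forall z, U z -> (D z <-> rho z < 0) &
      forall z, U z -> exists v, Dreal rho v z != 0].

Definition smooth_boundary D : Prop :=
  forall p, boundary D p -> exists U rho, local_defining_function D p U rho.

(* Positivity of the real Hessian on the real tangent space of the boundary;
   it does not depend on the choice of the local defining function. *)
Definition strongly_convex D : Prop :=
  convex_set D /\
  forall p, boundary D p -> exists U rho,
    local_defining_function D p U rho /\
    forall v, v != 0 -> Dreal rho v p = 0 -> 0 < Dreal (Dreal rho v) v p.

Definition domain D : Prop := [/\ open D, connected D & D !=set0].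

End smooth_boundary.

(* Frechet differentiability over the scalar field [Cplx R], hence
   complex-differentiability. *)
Definition holomorphic_on {R : realType} {V W : normedModType (Cplx R)}
    (U : set V) (f : V -> W) : Prop :=
  forall z, U z -> differentiable f z.

Definition self_map {T : Type} (D : set T) (f : T -> T) : Prop :=
  forall z, D z -> D (f z).

Section kobayashi.
Context {R : realType} {N : nat}.
Implicit Types (D : set (CN R N)) (z w : CN R N).

Definition unit_disc : set (Cplx R) := [set a | `|a| < 1].

Definition poincare (a b : Cplx R) : R :=
  let m : R := complex.Re `|(a - b) / (1 - b^* * a)| in
  2^-1 * ln ((1 + m) / (1 - m)).

(* [disc_chain D z w s]: a chain of analytic discs in [D] joins [z] to [w] and
   has total Poincare length [s]. *)
Inductive disc_chain D : CN R N -> CN R N -> R -> Prop :=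
| disc_chain_nil z : D z -> disc_chain D z z 0
| disc_chain_cons (h : Cplx R -> CN R N) (a b : Cplx R) w s :
    holomorphic_on unit_disc h -> (forall c, unit_disc c -> D (h c)) ->
    unit_disc a -> unit_disc b -> disc_chain D (h b) w s ->
    disc_chain D (h a) w (poincare a b + s).

Definition kobayashi D z w : R := inf [set s | disc_chain D z w s].

End kobayashi.

Section boundary_behaviour.
Context {R : realType} {N : nat}.
Implicit Types (D : set (CN R N)) (z p q : CN R N) (f : CN R N -> CN R N).

Definition K_region D z0 p (M : R) : set (CN R N) :=
  [set z | D z /\ exists l : R,
    ((fun w => kobayashi D z w - kobayashi D z0 w) @ within D (nbhs p) --> l)
    /\ l + kobayashi D z0 z < ln M].

Definition is_K_limit D z0 f p q : Prop :=
  forall u : nat -> CN R N, u @ \oo --> p ->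
    (exists M : R, 1 < M /\ forall k, K_region D z0 p M (u k)) ->
    f \o u @ \oo --> q.

(* The value [f(p)] of the K-limit (arbitrary if there is none). *)
Definition K_lim D z0 f p : CN R N := get (is_K_limit D z0 f p).

Definition dilation D z0 f p : \bar R :=
  expeR (2%:E * limf_einf
    (fun w => (kobayashi D z0 w - kobayashi D z0 (f w))%:E)
    (within D (nbhs p))).

Definition contact_point D z0 f p : Prop :=
  [/\ boundary D p, exists q, is_K_limit D z0 f p q &
      boundary D (K_lim D z0 f p)].

Definition regular_contact_point D z0 f p : Prop :=
  contact_point D z0 f p /\ (dilation D z0 f p < +oo)%E.

End boundary_behaviour.

(* Only the values [phi t z] with [0 <= t] and [D z] matter. *)
Definition semigroup {R : realType} {N : nat} (D : set (CN R N))
    (phi : R -> CN R N -> CN R N) : Prop :=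
  [/\ forall t : R, 0 <= t -> self_map D (phi t) /\ holomorphic_on D (phi t),
      forall z, D z -> phi 0 z = z,
      forall s t : R, 0 <= s -> 0 <= t ->
        forall z, D z -> phi (t + s) z = phi t (phi s z) &
      forall t : R, 0 <= t -> forall K : set (CN R N), compact K -> K `<=` D ->
        {uniform K, phi @ within [set s : R | 0 <= s] (nbhs t) --> phi t}].

(* Main.v *)
Require Import Defs.
From mathcomp Require Import all_boot all_order all_algebra.
From mathcomp Require Import all_classical all_reals all_analysis.
From mathcomp Require Import ring lra.
Import Order.TTheory GRing.Theory Num.Theory.
Import numFieldNormedType.Exports.
Local Open Scope classical_set_scope.
Local Open Scope ring_scope.

(** One can take [T = t0].  Write [k] for the Kobayashi distance of [D].

    Since [phi_t0 = phi_(t0 - t) o phi_t] and [k] is contracted by holomorphic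
    maps, [k z0 w - k z0 (phi_t w)] exceeds [k z0 w - k z0 (phi_t0 w)] by at most
    [k z0 (phi_(t0 - t) z0)].  Hence every [phi_t] with [t <= t0] has a finite
    dilation coefficient at [p], with a bound that is locally uniform in [t]
    ([semigroup_dilation]).  It remains to see that a self-map [f] with finite
    dilation at [p] has a K-limit in the boundary, depending continuously on [t].

    This is Julia's argument.  Let [w] tend to [p] with
    [k z0 w - k z0 (f w) <= A]; then [f w] accumulates at some boundary point [q],
    because [k z0] is proper.  If [k z w - k z0 w] tends to [l] at [p], the
    contraction property yields points [y] arbitrarily close to [q] with
    [k (f z) y - k z0 y <= l + 1 + A] ([julia]).  Inside a K-region [l] tends to
    minus infinity as [z] tends to [p].  On the other hand
    [k x' y - k z0 y] is bounded below when [x'] is close to a point [x] of the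
    closure, [y] is close to a boundary point [q], and [x != q]
    ([kobayashi_separation]).  So [f z] can only accumulate at [q]
    ([julia_K_limit]), and the same comparison, with constants uniform in [t],
    shows that [q] moves continuously ([semigroup_K_limit_continuous]).  If no
    sequence inside a K-region tends to [p], every point is vacuously a K-limit of
    every map: [K_lim] is then one and the same point for all [phi_t], and it lies
    in the boundary by the hypothesis on [phi_t0].

    For the separation let [rho] be a defining function near [q].  The complex line
    through [y] in a direction transverse to the boundary contains a disc inside
    [D] that reaches a fixed compact set and whose boundary comes within a multiple
    of [- rho y] of [y]; this gives [k z0 y <= B - 1/2 ln (- rho y)]
    ([kobayashi_upper]).  The real hyperplane that supports [D] at a boundary point
    next to [y] gives a holomorphic map of [D] to a half-plane, whose real part is
    comparable to [- rho y] at [y] and, by strong convexity, bounded away from 0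
    at [x'] ([kobayashi_lower]).  The factor 1/2 is the same on both sides, so the
    logarithms cancel.

    The half-plane estimate needs the Schwarz-Pick lemma for functions that are
    merely complex-differentiable at every point.  It comes from Goursat's theorem,
    stated for Riemann sums along the boundary of squares, so that no integral
    enters: these sums give Cauchy's formula up to a nonzero factor, and Landau's
    trick of applying it to the powers of a function turns the resulting bound
    into the maximum principle. *)

Set Implicit Arguments.
Unset Strict Implicit.
Unset Printing Implicit Defensive.

(** * Real-valued norms on complex normed spaces *)

Section modulus.
Context {R : realType}.
Notation C := (Cplx R).

Definition rc (x : R) : C := (x%:C)%C.
Definition ii : C := ('i)%C.
(** The norms of the normed modules over [Cplx R] take values in [Cplx R]; the real
    number behind them allows real inequalities to be combined freely. *)
Definition rnorm {V : normedModType C} (v : V) : R := complex.Re `|v|.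

Lemma rcD x y : rc (x + y) = rc x + rc y. Proof. exact: rmorphD. Qed.
Lemma rcB x y : rc (x - y) = rc x - rc y. Proof. exact: rmorphB. Qed.
Lemma rcN x : rc (- x) = - rc x. Proof. exact: rmorphN. Qed.
Lemma rcM x y : rc (x * y) = rc x * rc y. Proof. exact: rmorphM. Qed.
Lemma rcV x : rc x^-1 = (rc x)^-1. Proof. exact: fmorphV. Qed.
Lemma rc0 : rc 0 = 0. Proof. by []. Qed.
Lemma rc1 : rc 1 = 1. Proof. by []. Qed.
Lemma rc_nat n : rc n%:R = n%:R. Proof. exact: rmorph_nat. Qed.
Lemma rc_inj : injective rc. Proof. by move=> x y []. Qed.
Lemma rc_eq0 x : (rc x == 0) = (x == 0).
Proof. by rewrite -rc0 (inj_eq rc_inj). Qed.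

Lemma rnormE {V : normedModType C} (v : V) : `|v| = rc (rnorm v).
Proof.
rewrite /rnorm; have: `|v| \is Num.real by [].
by move/complex_realP => [k ->].
Qed.
Lemma rc_le x y : (rc x <= rc y) = (x <= y). Proof. exact: lecR. Qed.
Lemma rc_lt x y : (rc x < rc y) = (x < y). Proof. exact: ltcR. Qed.

Lemma rnorm_ge0 {V : normedModType C} (v : V) : 0 <= rnorm v.
Proof. by rewrite -rc_le -rnormE rc0. Qed.
Lemma rnorm0 {V : normedModType C} : rnorm (0 : V) = 0.
Proof. by apply: rc_inj; rewrite -rnormE normr0. Qed.
Lemma rnorm0_eq0 {V : normedModType C} (v : V) : (rnorm v == 0) = (v == 0).
Proof. by rewrite -rc_eq0 -rnormE normr_eq0. Qed.
Lemma rnorm_gt0 {V : normedModType C} (v : V) : (0 < rnorm v) = (v != 0).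
Proof. by rewrite lt_def rnorm0_eq0 rnorm_ge0 andbT. Qed.
Lemma rnormD {V : normedModType C} (v w : V) : rnorm (v + w) <= rnorm v + rnorm w.
Proof. by rewrite -rc_le rcD -!rnormE ler_normD. Qed.
Lemma rnormN {V : normedModType C} (v : V) : rnorm (- v) = rnorm v.
Proof. by rewrite /rnorm normrN. Qed.
Lemma rnormB {V : normedModType C} (v w : V) : rnorm (v - w) <= rnorm v + rnorm w.
Proof. by rewrite -(rnormN w) rnormD. Qed.
Lemma rnormC {V : normedModType C} (v w : V) : rnorm (v - w) = rnorm (w - v).
Proof. by rewrite -rnormN opprB. Qed.
Lemma rnormZ {V : normedModType C} (a : C) (v : V) : rnorm (a *: v) = rnorm a * rnorm v.
Proof. by apply: rc_inj; rewrite rcM -!rnormE normrZ. Qed.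
Lemma rnormM (z w : C) : rnorm (z * w) = rnorm z * rnorm w.
Proof. by apply: rc_inj; rewrite rcM -!rnormE normrM. Qed.
Lemma rnorm1 : rnorm (1 : C) = 1.
Proof. by apply: rc_inj; rewrite -rnormE normr1. Qed.
Lemma rnormX (z : C) n : rnorm (z ^+ n) = rnorm z ^+ n.
Proof.
by elim: n => [|n IH]; rewrite ?expr0 ?rnorm1// !exprS rnormM IH.
Qed.
Lemma rnormV (z : C) : rnorm z^-1 = (rnorm z)^-1.
Proof. by apply: rc_inj; rewrite rcV -!rnormE normfV. Qed.
Lemma rnorm_sqr (z : C) : rnorm z ^+ 2 = complex.Re z ^+ 2 + complex.Im z ^+ 2.
Proof.
by apply: rc_inj; rewrite expr2 rcM -expr2 -rnormE -add_Re2_Im2.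
Qed.
Lemma rnorm_rc x : rnorm (rc x) = `|x|.
Proof.
apply/eqP; rewrite -(@eqrXn2 _ 2) ?rnorm_ge0 ?normr_ge0 //.
by rewrite rnorm_sqr /= expr0n addr0 real_normK ?num_real.
Qed.
Lemma rnorm_ii : rnorm ii = 1.
Proof.
apply/eqP; rewrite -(@eqrXn2 _ 2) ?rnorm_ge0 //.
by rewrite rnorm_sqr /= expr0n add0r.
Qed.
Lemma Re_le (z : C) : `|complex.Re z| <= rnorm z.
Proof.
rewrite -(@ler_pXn2r _ 2) ?nnegrE ?rnorm_ge0 //.
by rewrite rnorm_sqr real_normK ?num_real // lerDl sqr_ge0.
Qed.
Lemma Im_le (z : C) : `|complex.Im z| <= rnorm z.
Proof.
rewrite -(@ler_pXn2r _ 2) ?nnegrE ?rnorm_ge0 //.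
by rewrite rnorm_sqr real_normK ?num_real // lerDr sqr_ge0.
Qed.
Lemma Re_add (a b : C) : complex.Re (a + b) = complex.Re a + complex.Re b.
Proof. by case: a b => [? ?] [? ?]. Qed.
Lemma Im_add (a b : C) : complex.Im (a + b) = complex.Im a + complex.Im b.
Proof. by case: a b => [? ?] [? ?]. Qed.
Lemma Re_opp (a : C) : complex.Re (- a) = - complex.Re a.
Proof. by case: a. Qed.
Lemma Im_opp (a : C) : complex.Im (- a) = - complex.Im a.
Proof. by case: a. Qed.
Lemma Re_sub (a b : C) : complex.Re (a - b) = complex.Re a - complex.Re b.
Proof. by case: a b => [? ?] [? ?]. Qed.
Lemma Re_ii (a : C) : complex.Re (ii * a) = - complex.Im a.
Proof. by case: a => [a b] /=; rewrite mul0r mul1r sub0r. Qed.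
Lemma Im_ii (a : C) : complex.Im (ii * a) = complex.Re a.
Proof. by case: a => [a b] /=; rewrite mul0r mul1r add0r. Qed.
Lemma Re_rcM x (a : C) : complex.Re (rc x * a) = x * complex.Re a.
Proof. by case: a => [a b] /=; rewrite mul0r subr0. Qed.
Lemma Im_rcM x (a : C) : complex.Im (rc x * a) = x * complex.Im a.
Proof. by case: a => [a b] /=; rewrite mul0r addr0. Qed.
Lemma Re_inv (a : C) : complex.Re a^-1 = complex.Re a / rnorm a ^+ 2.
Proof. by rewrite rnorm_sqr; case: a. Qed.
Lemma Im_inv (a : C) : complex.Im a^-1 = - complex.Im a / rnorm a ^+ 2.
Proof. by rewrite rnorm_sqr; case: a => [a b] /=; rewrite mulNr. Qed.

Definition cj (z : C) : C := conjc z.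

Lemma rnorm_cj (z : C) : rnorm (cj z) = rnorm z.
Proof. by rewrite /rnorm (normcJ z). Qed.
Lemma Re_cj (z : C) : complex.Re (cj z) = complex.Re z. Proof. by case: z. Qed.
Lemma Im_cj (z : C) : complex.Im (cj z) = - complex.Im z. Proof. by case: z. Qed.
Lemma Re_mul (a b : C) :
  complex.Re (a * b) = complex.Re a * complex.Re b - complex.Im a * complex.Im b.
Proof. by case: a b => [? ?] [? ?]. Qed.
Lemma Im_mul (a b : C) :
  complex.Im (a * b) = complex.Re a * complex.Im b + complex.Im a * complex.Re b.
Proof. by case: a b => [? ?] [? ?]. Qed.
Lemma complex_split (z : C) : z = rc (complex.Re z) + ii * rc (complex.Im z).
Proof. exact: complexE. Qed.
Lemma complex_pair x y : (x +i* y)%C = rc x + ii * rc y :> C.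
Proof. exact: complex_split. Qed.
Lemma rnorm_le_ReIm (z : C) : rnorm z <= `|complex.Re z| + `|complex.Im z|.
Proof.
rewrite {1}(complex_split z); apply: le_trans (rnormD _ _) _.
by rewrite rnormM rnorm_ii mul1r !rnorm_rc.
Qed.
Lemma rnorm_sum {V : normedModType C} n (F : 'I_n -> V) :
  rnorm (\sum_(i < n) F i) <= \sum_(i < n) rnorm (F i).
Proof.
elim/big_ind2: _ => [|x1 x2 y1 y2 h1 h2|//]; first by rewrite rnorm0.
exact: le_trans (rnormD _ _) (lerD h1 h2).
Qed.

Lemma rnbhsP {V : normedModType C} (z : V) (A : set V) :
  nbhs z A <-> exists2 e : R, 0 < e & forall w, rnorm (w - z) < e -> A w.
Proof.
split=> [/nbhs_normP [e /= e0 H]|[e e0 H]].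
  have /complex_realP [k ek] : e \is Num.real by rewrite gtr0_real.
  exists k; first by rewrite -rc_lt rc0 /rc -ek.
  move=> w hw; apply: H => /=; rewrite ek -[(k%:C)%C]/(rc k).
  by rewrite distrC rnormE rc_lt.
apply/nbhs_normP; exists (rc e); first by rewrite /= -rc0 rc_lt.
by move=> w /=; rewrite rnormE rc_lt rnormC => /H.
Qed.

Lemma differentiable_rnorm {V W : normedModType C} (f : V -> W) z :
  differentiable f z -> forall e : R, 0 < e -> exists2 d : R, 0 < d &
   forall w, rnorm (w - z) < d ->
     rnorm (f w - f z - 'd f z (w - z)) <= e * rnorm (w - z).
Proof.
move=> df e e0; have /diff_locallyP[_ /eqaddoP h] := df.
have := h (rc e); rewrite -rc0 rc_lt => /(_ e0)/rnbhsP [d d0 H]; exists d => // w hw.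
have /= := H (w - z); rewrite subr0 => /(_ hw).
by rewrite !rnormE -rcM rc_le /= !fctE /= subrK opprD addrA.
Qed.
Lemma continuous_rnorm {V W : normedModType C} (f : V -> W) z :
  {for z, continuous f} -> forall e : R, 0 < e -> exists2 d : R, 0 < d &
   forall w, rnorm (w - z) < d -> rnorm (f w - f z) < e.
Proof.
move=> fz e e0; apply/rnbhsP.
by apply: (fz [set y | rnorm (y - f z) < e]); apply/rnbhsP; exists e.
Qed.
End modulus.

(** * Goursat's theorem for Riemann sums *)

Section goursat.
Context {R : realType}.
Notation C := (Cplx R).

Lemma complex_differentiable_affine (f : C -> C) z : differentiable f z ->
  exists a : C, forall e : R, 0 < e -> exists2 d : R, 0 < d &
   forall w, rnorm (w - z) < d ->
     rnorm (f w - (f z + a * (w - z))) <= e * rnorm (w - z).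
Proof.
move=> df; exists ('d f z 1) => e e0.
have [d d0 H] := differentiable_rnorm df e0; exists d => // w /H.
have -> : 'd f z (w - z) = 'd f z 1 * (w - z).
  by rewrite -[X in 'd f z X]mulr1 -[_ * 1]/(_ *: 1) linearZ /= mulrC.
by rewrite opprD addrA.
Qed.

(** [u] times this mean is the [n]-step Riemann sum of [f] along the segment from [z]
    to [z + u]. *)
Definition edge_mean (f : C -> C) (z u : C) (n : nat) : C :=
  n%:R^-1 * \sum_(j < n) f (z + u * (j%:R / n%:R)).

(** Riemann sum of the contour integral along the boundary of the square with lower
    left corner [z] and side [s].  Opposite sides are sampled at the same
    parameters and subtracted, so that edges shared by adjacent squares cancel
    exactly. *)
Definition boundary_sum (f : C -> C) (z : C) (s : R) (n : nat) : C :=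
  rc s * (edge_mean f z (rc s) n - edge_mean f (z + ii * rc s) (rc s) n) +
  ii * rc s * (edge_mean f (z + rc s) (ii * rc s) n
               - edge_mean f z (ii * rc s) n).

Definition square (z : C) (s : R) : set C :=
  [set w | exists x y, [/\ 0 <= x <= s, 0 <= y <= s & w = z + rc x + ii * rc y]].

Lemma edge_mean3 f z u n :
  edge_mean f z u (3 * n) = 3^-1 * (edge_mean f z (u / 3) n +
    edge_mean f (z + u / 3) (u / 3) n + edge_mean f (z + u / 3 *+ 2) (u / 3) n).
Proof.
case: n => [|n]; first by rewrite /edge_mean muln0 invr0 !mul0r !addr0 mulr0.
have -> : (3 * n.+1 = n.+1 + (n.+1 + n.+1))%N by rewrite !mulSn mul0n addn0.
rewrite /edge_mean !big_split_ord /= -!mulrDr mulrA -invfM.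
have e3 : ((n.+1 + (n.+1 + n.+1))%:R = 3 * n.+1%:R :> C).
  by rewrite !natrD; ring.
have nz : (n.+1%:R : C) != 0 by rewrite pnatr_eq0.
rewrite e3; congr (_ * _); rewrite addrA; move: nz; set N := n.+1%:R => nz.
by congr (_ + _ + _); apply: eq_bigr => j _; congr f; rewrite ?natrD -/N; field.
Qed.

Lemma boundary_sumE f z s n : boundary_sum f z s n =
  rc s / n%:R * \sum_(j < n) ((f (z + rc s * (j%:R / n%:R))
      - f (z + ii * rc s + rc s * (j%:R / n%:R)))
     + ii * (f (z + rc s + ii * rc s * (j%:R / n%:R))
      - f (z + ii * rc s * (j%:R / n%:R)))).
Proof.
rewrite /boundary_sum /edge_mean big_split /= -mulr_sumr !sumrB.
ring.
Qed.

Lemma sample_param n (j : 'I_n) : exists2 t : R, 0 <= t <= 1 & j%:R / n%:R = rc t.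
Proof.
exists (j%:R / n%:R); last by rewrite rcM rcV !rc_nat.
case: n j => [[]//|n j]; rewrite divr_ge0 //= ler_pdivrMr ?ltr0n //.
by rewrite mul1r ler_nat ltnW.
Qed.

(** An affine function contributes 0 to each single term of the sum, so only the
    distance to an affine function matters. *)
Lemma boundary_sum_le f z s n a b (e : R) : 0 <= s -> 0 <= e ->
  (forall w, square z s w -> rnorm (f w - (b + a * w)) <= e) ->
  rnorm (boundary_sum f z s n) <= 4 * e * s.
Proof.
move=> s0 e0 H; rewrite boundary_sumE; case: n => [|n].
  by rewrite big_ord0 mulr0 rnorm0 !mulr_ge0.
rewrite rnormM rnormM rnormV -rc_nat !rnorm_rc ger0_norm // normr_nat.
have -> : 4 * e * s = s / n.+1%:R * (\sum_(j < n.+1) (4 * e)).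
  rewrite sumr_const card_ord -[4 * e *+ _]mulr_natr.
  have : (n.+1%:R : R) != 0 by rewrite pnatr_eq0.
  by move: n.+1%:R => N nz; field.
apply: ler_wpM2l; first by rewrite divr_ge0.
apply: le_trans (rnorm_sum _) _; apply: ler_sum => j _.
rewrite rc_nat; have [t /andP[t0 t1] ->] := sample_param j.
have st0 : 0 <= s * t by rewrite mulr_ge0.
have st1 : s * t <= s by rewrite ler_piMr.
have h1 := H (z + rc s * rc t); have h2 := H (z + ii * rc s + rc s * rc t).
have h3 := H (z + rc s + ii * rc s * rc t); have h4 := H (z + ii * rc s * rc t).
set A := f _ in h1 *; set B := f _ in h2 *.
set D := f _ in h3 *; set E := f _ in h4 *.
have -> : A - B + ii * (D - E) = (A - (b + a * (z + rc s * rc t)))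
   - (B - (b + a * (z + ii * rc s + rc s * rc t)))
   + ii * ((D - (b + a * (z + rc s + ii * rc s * rc t)))
   - (E - (b + a * (z + ii * rc s * rc t)))) by ring.
apply: le_trans (rnormD _ _) _; rewrite rnormM rnorm_ii mul1r.
have -> : 4 * e = (e + e) + (e + e) by ring.
apply: lerD; apply: le_trans (rnormB _ _) _; apply: lerD.
- by apply: h1; exists (s * t), 0; rewrite st0 st1 lexx s0; split => //; rewrite rcM rc0; ring.
- by apply: h2; exists (s * t), s; rewrite st0 st1 lexx s0; split => //; rewrite rcM; ring.
- by apply: h3; exists s, (s * t); rewrite st0 st1 lexx s0; split => //; rewrite rcM; ring.
- by apply: h4; exists 0, (s * t); rewrite st0 st1 lexx s0; split => //; rewrite rcM rc0; ring.
Qed.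

Definition subcorner (z : C) (s : R) (a b : 'I_3) : C :=
  z + rc (s / 3) * a%:R + ii * rc (s / 3) * b%:R.

(** The square is cut into nine; the sums along interior edges cancel. *)
Lemma boundary_sum3 f z s n : boundary_sum f z s (3 * n) =
  \sum_(a < 3) \sum_(b < 3) boundary_sum f (subcorner z s a b) (s / 3) n.
Proof.
set e := rc (s / 3).
have es : rc s = e + e + e by rewrite -!rcD; congr rc; field.
have e3 : rc s / 3 = e by rewrite es; field.
pose P (a b : nat) : C := z + e * a%:R + ii * e * b%:R.
pose h a b := edge_mean f (P a b) e n; pose v a b := edge_mean f (P a b) (ii * e) n.
have hE b : edge_mean f (P 0 b) (rc s) (3 * n) = 3^-1 * (h 0 b + h 1 b + h 2 b).
  rewrite edge_mean3 e3; congr (_ * (_ + _ + _)); congr edge_mean; rewrite /P; ring.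
have vE a : edge_mean f (P a 0) (ii * rc s) (3 * n) = 3^-1 * (v a 0 + v a 1 + v a 2).
  rewrite edge_mean3 -mulrA e3; congr (_ * (_ + _ + _)); congr edge_mean; rewrite /P; ring.
have cellE (a b : 'I_3) : boundary_sum f (subcorner z s a b) (s / 3) n =
    e * (h a b - h a b.+1) + ii * e * (v a.+1 b - v a b).
  rewrite /boundary_sum /subcorner -/e -/(P a b).
  have -> : P a b + ii * e = P a b.+1 by rewrite /P -natr1; ring.
  by have -> : P a b + e = P a.+1 b by rewrite /P -natr1; ring.
under eq_bigr do under eq_bigr do rewrite cellE.
rewrite /boundary_sum.
have -> : z = P 0%N 0%N by rewrite /P; ring.
have -> : P 0%N 0%N + ii * rc s = P 0%N 3%N by rewrite /P es; ring.
have -> : P 0%N 0%N + rc s = P 3%N 0%N by rewrite /P es; ring.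
rewrite !hE !vE es !big_ord_recl !big_ord0 /= /bump /=; field; rewrite ?pnatr_eq0 //.
Qed.

(** The number of sample points runs through powers of 3, to match the repeated
    subdivision of the square into nine. *)
Definition small_boundary (f : C -> C) z s (e : R) : Prop :=
  exists m0, forall m, (m0 <= m)%N -> rnorm (boundary_sum f z s (3 ^ m)) <= e.

Lemma small_boundary3 f z s (d : 'I_3 -> 'I_3 -> R) :
  (forall a b, small_boundary f (subcorner z s a b) (s / 3) (d a b)) ->
  small_boundary f z s (\sum_a \sum_b d a b).
Proof.
move=> H; pose m0 a b := sval (cid (H a b)).
exists (\max_a \max_b m0 a b).+1 => -[//|m]; rewrite ltnS => hm.
rewrite expnS boundary_sum3; apply: le_trans (rnorm_sum _) _.
apply: ler_sum => a _; apply: le_trans (rnorm_sum _) _; apply: ler_sum => b _.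
rewrite /m0 in hm; have := svalP (cid (H a b)); apply.
apply: leq_trans hm; apply: leq_trans (leq_bigmax a).
exact: (leq_bigmax (F := fun b => sval (cid (H a b))) b).
Qed.

Lemma square_subcorner z s a b : 0 <= s ->
  square (subcorner z s a b) (s / 3) `<=` square z s.
Proof.
move=> s0 _ [x [y [/andP[x0 x1] /andP[y0 y1] ->]]].
have h (c : 'I_3) : 0 <= s / 3 * c%:R <= s - s / 3.
  have c2 : c%:R <= 2 :> R by rewrite ler_nat -ltnS ltn_ord.
  have c0 : 0 <= c%:R :> R by [].
  have s3 : 0 <= s / 3 by lra.
  by apply/andP; split; nra.
have /andP[a0 a1] := h a; have /andP[b0 b1] := h b.
exists (s / 3 * a%:R + x), (s / 3 * b%:R + y); split.
- by apply/andP; split; lra.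
- by apply/andP; split; lra.
by rewrite /subcorner !rcD !rcM !rc_nat; ring.
Qed.

Lemma nested_intervals (x s : nat -> R) : (forall k, 0 <= s k) ->
  (forall k, x k <= x k.+1) -> (forall k, x k.+1 + s k.+1 <= x k + s k) ->
  exists X, forall k, x k <= X <= x k + s k.
Proof.
move=> s0 xi xs.
have mon k l : (k <= l)%N -> x k <= x l /\ x l + s l <= x k + s k.
  move=> /subnK <-; elim: (l - k)%N => [|d [h1 h2]]; first by rewrite add0n.
  by rewrite addSn; split; [apply: le_trans h1 _|apply: le_trans h2].
have ub k : ubound (range x) (x k + s k).
  move=> _ [l _ <-]; have [kl|lk] := leqP k l.
    by apply: le_trans (proj2 (mon _ _ kl)); rewrite lerDl.
  by apply: le_trans (proj1 (mon _ _ (ltnW lk))) _; rewrite lerDl.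
have ne : range x !=set0 by exists (x 0%N), 0%N.
exists (sup (range x)) => k; apply/andP; split.
  by apply: sup_upper_bound; [split=> //; exists (x 0%N + s 0%N)|exists k].
exact: ge_sup.
Qed.

Lemma geometric_small (a q d : R) : 0 <= q < 1 -> 0 < d -> exists k, a * q ^+ k < d.
Proof.
move=> /andP[q0 q1] d0.
have q1' : `|q| < 1 by rewrite ger0_norm.
have /cvgrPdist_lt /(_ d d0) [k _ /(_ k (leqnn k))] := cvg_geometric a q1'.
rewrite /= sub0r normrN => h; exists k; exact: le_lt_trans (ler_norm _) h.
Qed.

Lemma square_dist z s w w' : square z s w -> square z s w' -> rnorm (w - w') <= 2 * s.
Proof.
move=> [x [y [/andP[x0 x1] /andP[y0 y1] ->]]] [x' [y' [/andP[x0' x1'] /andP[y0' y1'] ->]]].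
have -> : z + rc x + ii * rc y - (z + rc x' + ii * rc y') =
  rc (x - x') + ii * rc (y - y') by rewrite !rcB; ring.
apply: le_trans (rnormD _ _) _; rewrite rnormM rnorm_ii mul1r !rnorm_rc.
have hx : `|x - x'| <= s by rewrite ler_norml; apply/andP; split; lra.
have hy : `|y - y'| <= s by rewrite ler_norml; apply/andP; split; lra.
lra.
Qed.

(** Goursat's subdivision: if the sums did not tend to 0, one of the nine subsquares
    would be bad with a ninth of the defect, and so on; the nested bad squares
    shrink to a point at which the function is not differentiable. *)
Theorem goursat f z s : 0 <= s -> (forall w, square z s w -> differentiable f w) ->
  forall e, 0 < e -> small_boundary f z s e.
Proof.
move=> s0 df e e0; apply: contrapT => nsmall.
pose Bad (x : C * R) (k : R) := ~ small_boundary f x.1 x.2 k.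
have step (x : C * R) k : exists x' : C * R, Bad x k ->
    [/\ Bad x' (k / 9), x'.2 = x.2 / 3 & exists a b, x'.1 = subcorner x.1 x.2 a b].
  have [bad|nbad] := pselect (Bad x k); last by exists x.
  suff [a [b H]] : exists a b, Bad (subcorner x.1 x.2 a b, x.2 / 3) (k / 9).
    by exists (subcorner x.1 x.2 a b, x.2 / 3) => _; split=> //; exists a, b.
  apply: contrapT => H; apply: bad.
  have -> : k = \sum_(a < 3) \sum_(b < 3) (k / 9).
    by rewrite !big_ord_recl !big_ord0; field.
  apply: small_boundary3 => a b; apply: contrapT => H'.
  by apply: H; exists a, b.
have [g gP] := choice (fun x : (C * R) * R => step x.1 x.2).
pose sq := fix F k := if k is k'.+1 then g (F k', e / 9 ^+ k') else (z, s).
have sqP k : Bad (sq k) (e / 9 ^+ k).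
  elim: k => [|k IH]; first by rewrite expr0 divr1.
  have [h _ _] := gP (_, _) IH; rewrite /= exprS invfM [9^-1 * _]mulrC mulrA; exact: h.
have sq2 k : (sq k).2 = s / 3 ^+ k.
  elim: k => [|k IH]; first by rewrite expr0 divr1.
  by have [_ h _] := gP (_, _) (sqP k); rewrite /= h IH exprS invfM [3^-1 * _]mulrC mulrA.
have sq1 k : exists a b, (sq k.+1).1 = subcorner (sq k).1 (s / 3 ^+ k) a b.
  by have [_ _ [a [b h]]] := gP (_, _) (sqP k); exists a, b; rewrite /= h sq2.
pose t k := s / 3 ^+ k.
have t0 k : 0 <= t k by rewrite divr_ge0 // exprn_ge0.
have tS k : t k.+1 = t k / 3 by rewrite /t exprS; field; rewrite expf_neq0.
have reS k (c : 'I_3) : 0 <= t k / 3 * c%:R /\ t k / 3 * c%:R + t k / 3 <= t k.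
  have c2 : c%:R <= 2 :> R by rewrite ler_nat -ltnS ltn_ord.
  have c0 : 0 <= c%:R :> R by [].
  have s3 := t0 k.
  by split; nra.
have Rerc (x : R) n : complex.Re (rc x * n%:R) = x * n%:R.
  by rewrite -rc_nat -rcM.
have Imrc (x : R) n : complex.Im (rc x * n%:R) = 0.
  by rewrite -rc_nat -rcM.
have sqRe k : exists a b : 'I_3, complex.Re (sq k.+1).1 = complex.Re (sq k).1 + t k / 3 * a%:R
    /\ complex.Im (sq k.+1).1 = complex.Im (sq k).1 + t k / 3 * b%:R.
  have [a [b ->]] := sq1 k; exists a, b; rewrite /subcorner -mulrA.
  by rewrite !Re_add !Im_add Re_ii Im_ii !Rerc !Imrc oppr0 !addr0.
have [||X hX] := @nested_intervals (fun k => complex.Re (sq k).1) t t0.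
- by move=> k; have [a [b [-> _]]] := sqRe k; rewrite lerDl; have [] := reS k a.
- by move=> k; have [a [b [-> _]]] := sqRe k; rewrite tS -addrA lerD2l; have [] := reS k a.
have [||Y hY] := @nested_intervals (fun k => complex.Im (sq k).1) t t0.
- by move=> k; have [a [b [_ ->]]] := sqRe k; rewrite lerDl; have [] := reS k b.
- by move=> k; have [a [b [_ ->]]] := sqRe k; rewrite tS -addrA lerD2l; have [] := reS k b.
pose w := rc X + ii * rc Y.
have wsq k : square (sq k).1 (t k) w.
  exists (X - complex.Re (sq k).1), (Y - complex.Im (sq k).1).
  have /andP[] := hX k; have /andP[] := hY k => *; split.
  - by apply/andP; split; lra.
  - by apply/andP; split; lra.
  rewrite /w !rcB; move: (complex_split (sq k).1).
  by move: (rc _) (rc (complex.Im _)) => p q ->; ring.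
have wsq0 : square z s w by have := wsq 0%N; rewrite /t expr0 divr1.
have [a /(_ (e / (8 * (s ^+ 2 + 1))))[|d d0 H]] := complex_differentiable_affine (df _ wsq0).
  by rewrite divr_gt0 // mulr_gt0 // ltr_wpDl // sqr_ge0.
have [k hk] : exists k, 2 * t k < d.
  have [|k hk] := @geometric_small (2 * s) 3^-1 d _ d0; first by apply/andP; split; lra.
  by exists k; rewrite /t -exprVn mulrA.
apply: (sqP k); rewrite sq2 -/(t k); exists 0%N => m _.
(* the error of the affine approximation on the [k]-th square, of diameter
   at most [2 * t k] *)
pose E := e / (8 * (s ^+ 2 + 1)) * (2 * t k).
have E0 : 0 <= E.
  by rewrite !mulr_ge0 ?t0 ?invr_ge0 // ?mulr_ge0 // ?ltW // ltr_wpDl // sqr_ge0.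
have := @boundary_sum_le f (sq k).1 (t k) (3 ^ m) a (f w - a * w) E (t0 k) E0.
have -> : 4 * E * t k = e / 9 ^+ k * (s ^+ 2 / (s ^+ 2 + 1)).
  have -> : (9 : R) = 3 ^+ 2 by ring.
  have s21 : s ^+ 2 + 1 != 0 by rewrite gt_eqF // ltr_wpDl // sqr_ge0.
  rewrite /E /t -exprM mulnC exprM; field.
  by rewrite s21 expf_neq0.
move=> h; apply: (le_trans (h _)).
  move=> u hu; have hd := square_dist hu (wsq k).
  have := H _ (le_lt_trans hd hk).
  have -> : f u - (f w + a * (u - w)) = f u - (f w - a * w + a * u) by ring.
  move/le_trans; apply; apply: ler_wpM2l => //.
  by rewrite ltW // divr_gt0 // mulr_gt0 // ltr_wpDl // sqr_ge0.
rewrite ler_piMr //; first by rewrite divr_ge0 ?exprn_ge0 // ltW.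
have s20 := sqr_ge0 s.
by rewrite ler_pdivrMr; lra.
Qed.
End goursat.

(** * The maximum principle on a square *)

Section local_maximum.
Context {R : realType}.
Notation C := (Cplx R).

(** Squares are now described from their centre [c]; [h] is half the side. *)
Definition gridpt (c : C) (x y : R) : C := c + rc x + ii * rc y.
Definition corner (c : C) (h : R) : C := gridpt c (- h) (- h).

Lemma gridpt_eq c x y : gridpt c x y = c -> x = 0 /\ y = 0.
Proof.
move=> h; have : rc x + ii * rc y = 0.
  by apply: (addrI c); rewrite addr0 addrA.
by rewrite -complex_pair => -[].
Qed.

Lemma square_corner c h w : square (corner c h) (2 * h) w ->
  exists x y, [/\ `|x| <= h, `|y| <= h & w = gridpt c x y].
Proof.
move=> [x [y [/andP[x0 x1] /andP[y0 y1] ->]]].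
exists (x - h), (y - h); rewrite !ler_norml; split.
- by apply/andP; split; lra.
- by apply/andP; split; lra.
by rewrite /corner /gridpt !rcB !rcN; ring.
Qed.

Lemma boundary_sum_corner (f : C -> C) (c : C) h n : boundary_sum f (corner c h) (2 * h) n =
  rc (2 * h) / n%:R * \sum_(j < n)
    ((f (gridpt c (2 * h * (j%:R / n%:R) - h) (- h))
      - f (gridpt c (2 * h * (j%:R / n%:R) - h) h))
     + ii * (f (gridpt c h (2 * h * (j%:R / n%:R) - h))
      - f (gridpt c (- h) (2 * h * (j%:R / n%:R) - h)))).
Proof.
rewrite boundary_sumE; congr (_ * _); apply: eq_bigr => j _.
have tE : j%:R / n%:R = rc (j%:R / n%:R) :> C.
  by rewrite rcM rcV !rc_nat.
rewrite tE; move: (j%:R / n%:R) => t.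
by congr (_ - f _ + _ * (f _ - f _)); [congr f|..];
  rewrite /corner /gridpt !rcB !rcM !rcN ?rc_nat; ring.
Qed.

Lemma sample_abs (h : R) n (j : 'I_n) : 0 <= h -> `|2 * h * (j%:R / n%:R) - h| <= h.
Proof.
move=> h0; have [t /andP[t0 t1]] := @sample_param R _ j.
have -> : j%:R / n%:R = rc (j%:R / n%:R) :> C by rewrite rcM rcV !rc_nat.
by move=> /rc_inj ->; rewrite ler_norml; apply/andP; split; nra.
Qed.

Lemma boundary_sum_bound (f : C -> C) (c : C) h n (M : R) : 0 <= h -> 0 <= M ->
  (forall x y, `|x| <= h -> `|y| <= h -> `|x| = h \/ `|y| = h ->
     rnorm (f (gridpt c x y)) <= M) ->
  rnorm (boundary_sum f (corner c h) (2 * h) n) <= 8 * M * h.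
Proof.
move=> h0 M0 H; rewrite boundary_sum_corner; case: n => [|n].
  by rewrite big_ord0 mulr0 rnorm0 !mulr_ge0.
rewrite rnormM rnormM rnormV -rc_nat !rnorm_rc ger0_norm ?mulr_ge0 // normr_nat.
have -> : 8 * M * h = 2 * h / n.+1%:R * (\sum_(j < n.+1) (4 * M)).
  rewrite sumr_const card_ord -[4 * M *+ _]mulr_natr.
  have : (n.+1%:R : R) != 0 by rewrite pnatr_eq0.
  by move: n.+1%:R => N nz; field.
apply: ler_wpM2l; first by rewrite divr_ge0 ?mulr_ge0.
apply: le_trans (rnorm_sum _) _; apply: ler_sum => j _.
have := sample_abs j h0; set t := _ - h => ht.
have hh : `|h| = h by rewrite ger0_norm.
have hN : `|- h| = h by rewrite normrN.
apply: le_trans (rnormD _ _) _; rewrite rnormM rnorm_ii mul1r.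
have -> : 4 * M = (M + M) + (M + M) by ring.
apply: lerD; apply: le_trans (rnormB _ _) _; apply: lerD; apply: H => //;
  rewrite ?hh ?hN //; by [left|right].
Qed.

Lemma boundary_sum_linear (f g k : C -> C) (a z : C) s n : (forall w, f w = g w + a * k w) ->
  boundary_sum f z s n = boundary_sum g z s n + a * boundary_sum k z s n.
Proof.
move=> H; have e x u : edge_mean f x u n = edge_mean g x u n + a * edge_mean k x u n.
  rewrite /edge_mean mulrCA -mulrDr; congr (_ * _); rewrite mulr_sumr -big_split.
  by apply: eq_bigr => j _; rewrite H.
by rewrite /boundary_sum !e; ring.
Qed.

(** This is the lower bound that a nonzero winding number gives: each of the four
    sides contributes at least 1 to the imaginary part. *)
Lemma boundary_sum_kernel (c : C) h n : 0 < h -> (0 < n)%N ->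
  4 <= rnorm (boundary_sum (fun w : C => (w - c)^-1) (corner c h) (2 * h) n).
Proof.
move=> h0; case: n => // n _; apply: le_trans (le_trans _ (ler_norm _)) (Im_le _).
rewrite boundary_sum_corner -rc_nat -rcV -rcM Im_rcM.
have n0 : (n.+1%:R : R) != 0 by rewrite pnatr_eq0.
have -> : 4 = 2 * h / n.+1%:R * (\sum_(j < n.+1) (2 / h)).
  rewrite sumr_const card_ord -[2 / h *+ _]mulr_natr.
  have h1 : h != 0 by rewrite gt_eqF.
  by move: n.+1%:R n0 => N nz; field; rewrite ?nz ?h1.
rewrite (big_morph (@complex.Im R) (id1 := 0) (op1 := +%R) Im_add) //.
apply: ler_wpM2l; first by rewrite divr_ge0 ?mulr_ge0 // ltW.
apply: ler_sum => j _.
have := sample_abs j (ltW h0); set t := _ - h => ht.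
have tt : t ^+ 2 <= h ^+ 2 by rewrite -real_normK ?num_real // ler_pXn2r ?nnegrE // ltW.
rewrite Im_add Im_ii Im_add Re_add Im_opp Re_opp !Im_inv !Re_inv !rnorm_sqr.
have pE x y : gridpt c x y - c = (x +i* y)%C by rewrite complex_pair /gridpt; ring.
rewrite !pE /= sqrrN opprK.
have -> : h / (t ^+ 2 + h ^+ 2) - - h / (t ^+ 2 + h ^+ 2) +
  (h / (h ^+ 2 + t ^+ 2) - - h / (h ^+ 2 + t ^+ 2)) = 4 * h / (h ^+ 2 + t ^+ 2).
  rewrite [t ^+ 2 + _]addrC; move: (_^-1) => k; ring.
have t0 := sqr_ge0 t.
have hh : 0 < h ^+ 2 by rewrite exprn_gt0.
rewrite ler_pdivlMr ?ltr_wpDr // mulrAC ler_pdivrMr //.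
by rewrite expr2 in hh tt *; nra.
Qed.

(** Outside the central ninth Goursat's theorem applies, so that the boundary sum
    of the big square is, up to an arbitrarily small error, that of the central
    one. *)
Lemma small_boundary_hole (f : C -> C) (c : C) (h e e' : R) : 0 < h -> e < e' ->
  (forall x y, `|x| <= h -> `|y| <= h -> gridpt c x y != c ->
     differentiable f (gridpt c x y)) ->
  small_boundary f (corner c (h / 3)) (2 * (h / 3)) e ->
  small_boundary f (corner c h) (2 * h) e'.
Proof.
move=> h0 ee df He.
pose d (a b : 'I_3) := if (val a == 1%N) && (val b == 1%N) then e else (e' - e) / 8.
have -> : e' = \sum_a \sum_b d a b.
  by rewrite !big_ord_recl !big_ord0 /d /=; field.
apply: small_boundary3 => a b; rewrite /d.
have -> : 2 * h / 3 = 2 * (h / 3) by field.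
case: ifPn => [/andP[/eqP a1 /eqP b1]|nab].
  rewrite (_ : subcorner _ _ a b = corner c (h / 3)) //.
  rewrite /subcorner /corner /gridpt a1 b1 !rcN.
  have -> : rc (2 * h / 3) = rc (h / 3) + rc (h / 3) :> C by rewrite -rcD; congr rc; field.
  have -> : rc h = rc (h / 3) + rc (h / 3) + rc (h / 3) :> C by rewrite -!rcD; congr rc; field.
  by ring.
apply: goursat; first by lra.
  move=> w hw.
  have := @square_subcorner _ (corner c h) (2 * h) a b; rewrite (_ : 2 * h / 3 = 2 * (h / 3)); last by field.
  move=> /(_ _ w hw)/square_corner [|x [y [hx hy ew]]]; first by lra.
  rewrite ew; apply: df => //; rewrite -ew; apply/eqP => wc.
  move: hw => [x' [y' [/andP[x0 x1] /andP[y0 y1]]]].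
  rewrite wc /subcorner => ec.
  have : gridpt c (- h + 2 * h / 3 * a%:R + x') (- h + 2 * h / 3 * b%:R + y') = c.
    rewrite {2}ec /corner /gridpt !rcD !rcN (_ : 2 * h / 3 = 2 * (h / 3)); last by field.
    by rewrite !(rcM _ _%:R) !rc_nat; ring.
  case/gridpt_eq => ex ey.
  have : (a < 3)%N := ltn_ord a; have : (b < 3)%N := ltn_ord b.
  have key (j : nat) (t : R) : (j < 3)%N -> 0 <= t <= 2 * (h / 3) -> - h + 2 * h / 3 * j%:R + t = 0 -> j = 1%N.
    by case: j => [|[|[|//]]] // _ /andP[t0 t1] ?; exfalso; lra.
  move=> hb ha; move/negP: nab; apply; apply/andP; split; apply/eqP.
    by apply: (key a x') => //; rewrite x0.
  by apply: (key b y') => //; rewrite y0.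
by lra.
Qed.

(** Shrinking the hole, the boundary sum is at most 8 times the supremum of
    [|f w| |w - c|] over a small square, hence tends to 0. *)
Lemma small_boundary_puncture (f : C -> C) (c : C) (h : R) : 0 < h ->
  (forall x y, `|x| <= h -> `|y| <= h -> gridpt c x y != c ->
     differentiable f (gridpt c x y)) ->
  (forall e, 0 < e -> exists2 d, 0 < d & forall w, rnorm (w - c) < d ->
     rnorm (f w) * rnorm (w - c) <= e) ->
  forall e, 0 < e -> small_boundary f (corner c h) (2 * h) e.
Proof.
move=> h0 df hc e e0.
have [d d0 H] := hc (e / 16) (divr_gt0 e0 (ltr0n _ 16)).
have [|k hk] := @geometric_small R (2 * h) 3^-1 d _ d0; first by apply/andP; split; lra.
have : exists2 e1, e1 < e & small_boundary f (corner c (h / 3 ^+ k)) (2 * (h / 3 ^+ k)) e1.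
  exists (e / 2); first by lra.
  exists 0%N => m _; set t := h / 3 ^+ k.
  have t0 : 0 < t by rewrite divr_gt0 // exprn_gt0.
  have -> : e / 2 = 8 * (e / 16 / t) * t by have tn : t != 0 by [rewrite gt_eqF]; field.
  apply: boundary_sum_bound; [exact: ltW|by rewrite !divr_ge0 ?ltW|].
  move=> x y hx hy hxy; set w := gridpt c x y.
  have wE : w - c = (x +i* y)%C by rewrite /w /gridpt complex_pair; ring.
  have w1 : t <= rnorm (w - c).
    by rewrite wE; case: hxy => <-; [exact: (Re_le (x +i* y)%C)|exact: (Im_le (x +i* y)%C)].
  have w2 : rnorm (w - c) < d.
    rewrite wE; apply: le_lt_trans (rnorm_le_ReIm _) _ => /=.
    have : `|x| + `|y| <= t + t by exact: lerD.
    move/le_lt_trans; apply; apply: le_lt_trans hk.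
    by rewrite exprVn -mulrA -/t mulrDl mul1r.
  rewrite ler_pdivlMr //; apply: le_trans (H w w2).
  by apply: ler_wpM2l => //; exact: rnorm_ge0.
elim: k {hk} => [|k IH] [e1 e1e He]; first by
  move: He; rewrite expr0 divr1 => -[m0 Hm]; exists m0 => m /Hm /le_trans; apply; exact: ltW.
apply: IH; exists ((e1 + e) / 2); first by lra.
have t0 : 0 < h / 3 ^+ k by rewrite divr_gt0 // exprn_gt0.
apply: (@small_boundary_hole _ _ _ e1) => //; first by lra.
  have th : h / 3 ^+ k <= h.
    by rewrite ler_pdivrMr ?exprn_gt0 //; apply: ler_peMr; [exact: ltW|apply: exprn_ege1; rewrite ler1n].
  by move=> x y hx hy; apply: df; exact: le_trans th.
by rewrite -mulrA -invfM -exprSr.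
Qed.

Lemma differentiable_power (f : C -> C) n z :
  differentiable f z -> differentiable (fun w => f w ^+ n) z.
Proof.
move=> df; elim: n => [|n IH].
  rewrite (_ : (fun w => f w ^+ 0) = cst 1); first exact: differentiable_cst.
  by apply/funext => w; rewrite expr0.
rewrite (_ : (fun w => f w ^+ n.+1) = f * (fun w => f w ^+ n)); first exact: differentiableM.
by apply/funext => w; rewrite exprS.
Qed.

(** Cauchy's formula up to a constant: the difference quotient of [f] at [c] has
    vanishing boundary sums, so [f c] times the sum of the Cauchy kernel is the sum
    of [f w / (w - c)].  Continuity at [c] is what the quotient [f z / z] of the
    Schwarz lemma has at 0. *)
Lemma centre_bound (f : C -> C) (c : C) (h M : R) : 0 < h -> 0 <= M ->
  (forall x y, `|x| <= h -> `|y| <= h -> gridpt c x y != c ->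
     differentiable f (gridpt c x y)) ->
  (forall e, 0 < e -> exists2 d, 0 < d & forall w, rnorm (w - c) < d ->
     rnorm (f w - f c) <= e) ->
  (forall x y, `|x| <= h -> `|y| <= h -> `|x| = h \/ `|y| = h ->
     rnorm (f (gridpt c x y)) <= M) ->
  rnorm (f c) <= 2 * M.
Proof.
move=> h0 M0 df fc fM.
have dI (w : C) : w != c -> differentiable (fun w : C => (w - c)^-1) w.
  move=> wc; apply: differentiableV; last by rewrite subr_eq0.
  by apply: differentiableB => //; exact: differentiable_cst.
have small e : 0 < e -> small_boundary (fun w => (f w - f c) * (w - c)^-1) (corner c h) (2 * h) e.
  pose g w := (f w - f c) * (w - c)^-1; rewrite -/g.
  move=> e0; apply: (@small_boundary_puncture g c h h0 _ _ e e0).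
    move=> x y hx hy nz; apply: differentiableM; last exact: dI.
    by apply: differentiableB; [exact: df|exact: differentiable_cst].
  move=> e' e'0; have [d d0 H] := fc _ e'0; exists d => // w hw; rewrite rnormM rnormV.
  have [->|wc] := eqVneq w c; first by rewrite (subrr c) rnorm0 mulr0 ltW.
  rewrite mulfVK; first exact: H.
  by rewrite rnorm0_eq0 subr_eq0.
apply/ler_addgt0Pr => e e0.
have [m0 /(_ _ (leqnn m0)) Hm] := small (4 * e) (mulr_gt0 (ltr0n _ 4) e0).
set n := (3 ^ m0)%N in Hm.
have n0 : (0 < n)%N by rewrite expn_gt0.
have lin := @boundary_sum_linear (fun w => f w * (w - c)^-1)
  (fun w => (f w - f c) * (w - c)^-1) (fun w => (w - c)^-1) (f c) (corner c h) (2 * h) n.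
have kern := @boundary_sum_kernel c h n h0 n0.
have up : rnorm (boundary_sum (fun w => f w * (w - c)^-1) (corner c h) (2 * h) n) <= 8 * M.
  have -> : 8 * M = 8 * (M / h) * h by have hn : h != 0 by [rewrite gt_eqF]; field.
  apply: boundary_sum_bound; [exact: ltW|by rewrite divr_ge0 // ltW|].
  move=> x y hx hy hxy; rewrite rnormM rnormV; set w := gridpt c x y.
  have wE : w - c = (x +i* y)%C by rewrite /w /gridpt complex_pair; ring.
  have w1 : h <= rnorm (w - c).
    by rewrite wE; case: hxy => <-; [exact: (Re_le (x +i* y)%C)|exact: (Im_le (x +i* y)%C)].
  apply: ler_pM; rewrite ?rnorm_ge0 ?invr_ge0 ?rnorm_ge0 //; first exact: fM.
  by rewrite lef_pV2 // ?posrE // (lt_le_trans h0).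
have : rnorm (f c) * 4 <= 8 * M + 4 * e.
  apply: (@le_trans _ _ (rnorm (f c * boundary_sum (fun w => (w - c)^-1) (corner c h) (2 * h) n))).
    by rewrite rnormM; apply: ler_wpM2l => //; exact: rnorm_ge0.
  have -> : f c * boundary_sum (fun w => (w - c)^-1) (corner c h) (2 * h) n =
    boundary_sum (fun w => f w * (w - c)^-1) (corner c h) (2 * h) n
    - boundary_sum (fun w => (f w - f c) * (w - c)^-1) (corner c h) (2 * h) n.
    by rewrite lin; [ring|move=> w; ring].
  by apply: le_trans (rnormB _ _) _; apply: lerD.
lra.
Qed.

(** Landau's trick: [centre_bound] for all powers of [f] gives
    [|f c| ^ n <= 2 M ^ n] for every [n]. *)
Theorem local_maximum_principle (f : C -> C) (c : C) (h M : R) : 0 < h -> 0 <= M ->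
  (forall x y, `|x| <= h -> `|y| <= h -> gridpt c x y != c ->
     differentiable f (gridpt c x y)) ->
  {for c, continuous f} ->
  (forall x y, `|x| <= h -> `|y| <= h -> `|x| = h \/ `|y| = h ->
     rnorm (f (gridpt c x y)) <= M) ->
  rnorm (f c) <= M.
Proof.
move=> h0 M0 df fc fM; rewrite leNgt; apply/negP => Mf.
have f0 : 0 < rnorm (f c) by exact: le_lt_trans Mf.
have key n : rnorm (f c) ^+ n <= 2 * M ^+ n.
  have [->|n0] := posnP n; first by rewrite !expr0 mulr1 ler1n.
  rewrite -rnormX; pose g w := f w ^+ n; rewrite -/(g c).
  apply: (@centre_bound g c h (M ^+ n) h0).
  - by rewrite exprn_ge0.
  - move=> x y hx hy nz; have dfw := df x y hx hy nz.
    exact: differentiable_power.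
  - move=> e e0; have : {for c, continuous g}.
      by apply: (@continuous_comp _ _ _ f (fun w => w ^+ n)); [exact: fc|apply: differentiable_continuous; exact: (@differentiable_power id)].
    by move=> /continuous_rnorm /(_ e e0)[d d0 H]; exists d => // w /H /ltW.
  - move=> x y hx hy hxy; rewrite /g rnormX.
    by rewrite ler_pXn2r ?nnegrE ?rnorm_ge0 // fM.
have [|k hk] := @geometric_small R 2 (M / rnorm (f c)) 1 _ ltr01; last first.
  move: (key k); rewrite leNgt => /negP; apply; move: hk.
  by rewrite expr_div_n mulrA ltr_pdivrMr ?mul1r // exprn_gt0.
by rewrite divr_ge0 ?ltr_pdivrMr ?mul1r // ltW.
Qed.
End local_maximum.

(** * Compactness in complex coordinate spaces *)

Section compactness.
Context {R : realType}.
Notation C := (Cplx R).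

Lemma rnorm_dist {V : normedModType C} (v w : V) : `|rnorm v - rnorm w| <= rnorm (v - w).
Proof.
have h (a b : V) : rnorm a - rnorm b <= rnorm (a - b).
  by rewrite lerBlDr; apply: le_trans (rnormD _ _); rewrite subrK.
by rewrite ler_norml lerNl opprB h rnormC h.
Qed.

Lemma rnorm_continuous {V : normedModType C} : continuous (@rnorm R V).
Proof.
move=> v; apply/cvgrPdist_lt => e e0; apply/rnbhsP; exists e => // w hw.
by apply: le_lt_trans (rnorm_dist _ _) _; rewrite rnormC.
Qed.

Lemma compact_rectangle (M : R) :
  compact [set z : C | `|complex.Re z| <= M /\ `|complex.Im z| <= M].
Proof.
have cont : continuous (fun p : R * R => rc p.1 + ii * rc p.2 : C).
  move=> p A /rnbhsP [e e0 HA].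
  have e2 : 0 < e / 2 by rewrite divr_gt0.
  exists (ball p.1 (e / 2), ball p.2 (e / 2)); first by split; exact: nbhsx_ballx.
  move=> [x y] [/= hx hy]; apply: HA.
  have -> : rc x + ii * rc y - (rc p.1 + ii * rc p.2) =
    rc (x - p.1) + ii * rc (y - p.2) by rewrite !rcB; ring.
  apply: le_lt_trans (rnormD _ _) _; rewrite rnormM rnorm_ii mul1r !rnorm_rc.
  by rewrite (splitr e); apply: ltrD; rewrite distrC.
have := compact_setX (@segment_compact R (- M) M) (@segment_compact R (- M) M).
move=> /(@continuous_compact _ _ (fun p : R * R => rc p.1 + ii * rc p.2 : C)).
move=> /(_ (continuous_subspaceT cont)); rewrite (_ : _ @` _ = [set z : C | `|complex.Re z| <= M /\ `|complex.Im z| <= M]) //.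
apply/seteqP; split => [_ [[x y] [hx hy] <-]|z [hx hy]].
  by move: hx hy; rewrite /mkset -[(x, y).1]/x -[(x, y).2]/y -complex_pair /= !in_itv /= !ler_norml.
exists (complex.Re z, complex.Im z); last by rewrite /= -complex_split.
by rewrite /= !in_itv /= -!ler_norml.
Qed.

Lemma compact_disc (r : R) : compact [set z : C | rnorm z <= r].
Proof.
apply: (@subclosed_compact _ _ _ _ (@compact_rectangle r)); last first.
  by move=> z /= hz; split; apply: le_trans hz; [exact: Re_le|exact: Im_le].
rewrite (_ : [set _ | _] = rnorm @^-1` [set x | x <= r]) //.
by apply: closed_comp; [move=> ? _; exact: rnorm_continuous|exact: closed_le].
Qed.

(** The norm of [CN R N] is the maximum of the moduli of the coordinates. *)
Lemma coord_rnorm N (v : CN R N) j : rnorm (v 0 j) <= rnorm v.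
Proof.
rewrite -rc_le -!rnormE; have -> : `|v| = mx_norm v by [].
rewrite mx_normE.
change ((`|v 0 j|%:nng)%:num <= (\big[Order.max/0%:nng]_i `|v i.1 i.2|%:nng)%:num).
rewrite num_le; exact: (@le_bigmax _ _ _ _ (fun i => `|v i.1 i.2|%:nng) (0, j)).
Qed.

Lemma complex_bounded_closed_compact N (A : set (CN R N)) (M : R) : closed A ->
  (forall v, A v -> rnorm v <= M) -> compact A.
Proof.
move=> cA AM.
apply: (@subclosed_compact _ _ _ cA (rV_compact (fun _ => @compact_disc M))).
by move=> v /AM hv i; exact: le_trans (coord_rnorm v i) hv.
Qed.

End compactness.
(** * The Schwarz lemma and Harnack's inequality *)

Section schwarz.
Context {R : realType}.
Notation C := (Cplx R).

Lemma near_differentiable (f g : C -> C) z : (\near z, f z = g z) ->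
  differentiable f z -> differentiable g z.
Proof.
move=> fg /derivable1_diffP df; apply/derivable1_diffP.
exact: near_eq_derivable fg df.
Qed.

Lemma rnorm_half (p : C) : rnorm p <= (rnorm p ^+ 2 + 1) / 2.
Proof. by have := sqr_ge0 (rnorm p - 1); rewrite expr2 => h; rewrite expr2; lra. Qed.

Lemma Re_gridpt (c : C) x y : complex.Re (gridpt c x y) = complex.Re c + x.
Proof. by rewrite /gridpt !Re_add Re_ii /= oppr0 addr0. Qed.
Lemma Im_gridpt (c : C) x y : complex.Im (gridpt c x y) = complex.Im c + y.
Proof. by rewrite /gridpt !Im_add Im_ii /= addr0. Qed.

Lemma differentiable_affine (a b : C) z : differentiable (fun w : C => a + b * w) z.
Proof.
apply: differentiableD; first exact: differentiable_cst.
by apply: differentiableM => //; exact: differentiable_cst.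
Qed.

(** The strictly subharmonic factor [1 + eps |w|^2] makes the maximum strict: divided
    by its value at [z1], it dominates the modulus of a linear holomorphic function
    [P] that agrees with it to first order there, and the product of [phi] and [P]
    violates the maximum principle on a small square round [z1]. *)
Lemma no_interior_maximum (phi : C -> C) (z1 : C) (r eps : R) :
  0 < eps <= 1 / 4 -> r <= 1 -> rnorm z1 < r -> phi z1 != 0 ->
  (forall w, rnorm w < r -> w != 0 -> differentiable phi w) ->
  {for z1, continuous phi} ->
  ~ (forall w, rnorm w <= r ->
     rnorm (phi w) * (1 + eps * rnorm w ^+ 2) <= rnorm (phi z1) * (1 + eps * rnorm z1 ^+ 2)).
Proof.
move=> /andP[e0 e4] r1 z1r nz dphi cphi Hmax.
set F := rnorm (phi z1) in Hmax.
have F0 : 0 < F by rewrite rnorm_gt0.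
have n0 := rnorm_ge0 z1.
have [h [h0 hr hz]] : exists h, [/\ 0 < h, rnorm z1 + 2 * h < r & z1 != 0 -> 2 * h < rnorm z1].
  have [->|z10] := eqVneq z1 0.
    exists (r / 3); rewrite rnorm0; have : 0 < r by exact: le_lt_trans z1r.
    by move=> r0; split; lra.
  have p0 : 0 < rnorm z1 by rewrite rnorm_gt0.
  by exists (Num.min (r - rnorm z1) (rnorm z1) / 3); split; rewrite /Num.min; case: ifP => ?; lra.
pose q := 1 + eps * rnorm z1 ^+ 2.
have q1 : 1 <= q by rewrite lerDl mulr_ge0 ?sqr_ge0 // ltW.
(* [1 + eps |w|^2 = q (1 + Re mu + eps |w - z1|^2 / q)] for [mu = lam (w - z1)],
   whereas [|1 + mu| <= 1 + Re mu + |mu|^2 / 2] by [rnorm_half] *)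
pose lam : C := rc (2 * eps / q) * cj z1.
pose P (w : C) := 1 + lam * (w - z1).
pose M := F * (1 - eps * h ^+ 2 / (2 * (1 + eps))).
have ee : 0 < eps * h ^+ 2 / (2 * (1 + eps)).
  by rewrite divr_gt0 // ?mulr_gt0 ?exprn_gt0 //; lra.
have e1 : eps * h ^+ 2 / (2 * (1 + eps)) <= 1.
  rewrite ler_pdivrMr; last by lra.
  have h1 : h <= 1 by lra.
  have hh : h ^+ 2 <= 1 by rewrite expr_le1 // ltW.
  by rewrite mul1r; nra.
have : F <= M.
  pose g w := phi w * P w; rewrite /F.
  have -> : phi z1 = g z1 by rewrite /g /P subrr mulr0 addr0 mulr1.
  have dP w : differentiable P w.
    rewrite (_ : P = fun w => (1 - lam * z1) + lam * w); first exact: differentiable_affine.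
    by apply/funext => u; rewrite /P; ring.
  have inr x y : `|x| <= h -> `|y| <= h -> rnorm (gridpt z1 x y) < r /\ (z1 != 0 -> gridpt z1 x y != 0).
    move=> hx hy; have hd : rnorm (rc x + ii * rc y) <= 2 * h.
      apply: le_trans (rnormD _ _) _; rewrite rnormM rnorm_ii mul1r !rnorm_rc; lra.
    rewrite /gridpt -addrA; split; first by apply: le_lt_trans (rnormD _ _) _; lra.
    move=> /hz hz'; apply/eqP => /addr0_eq e; move: hz'.
    by rewrite -rnormN e => /lt_le_trans /(_ hd); rewrite ltxx.
  apply: (@local_maximum_principle R g z1 h M h0).
  - by apply: mulr_ge0; [exact: ltW|rewrite subr_ge0].
  - move=> x y hx hy nw; have [wr wz] := inr x y hx hy.
    apply: (@differentiableM _ _ phi P); [apply: dphi => //|exact: dP].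
    have [z0|/wz //] := eqVneq z1 0; by rewrite -z0.
  - exact: (cvgM cphi (differentiable_continuous (dP z1))).
  move=> x y hx hy hxy; have [wr _] := inr x y hx hy; set w := gridpt z1 x y in wr *.
  have wE : w - z1 = (x +i* y)%C by rewrite /w /gridpt complex_pair; ring.
  set T := 1 + eps * rnorm w ^+ 2.
  have d2 : h ^+ 2 <= x ^+ 2 + y ^+ 2.
    case: hxy => <-; rewrite real_normK ?num_real ?lerDl ?lerDr ?sqr_ge0 //.
  have T0 : 0 < T by rewrite ltr_wpDr // mulr_ge0 ?sqr_ge0 // ltW.
  have T1 : T <= 1 + eps.
    rewrite lerD2l ger_pMr // expr_le1 ?rnorm_ge0 //; lra.
  have hT := Hmax w (ltW wr); rewrite -/T -/q in hT.
  have Pq : rnorm (P w) * q <= T - eps * h ^+ 2 / 2.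
    have q0 : 0 < q by lra.
    have qn : q != 0 by rewrite gt_eqF.
    rewrite -ler_pdivlMr //; apply: le_trans (rnorm_half _) _.
    pose t := 2 * eps / q.
    have tq : t * q = 2 * eps by rewrite /t mulfVK.
    have lamR : complex.Re lam = t * complex.Re z1 by rewrite /lam Re_rcM Re_cj.
    have lamI : complex.Im lam = - t * complex.Im z1 by rewrite /lam Im_rcM Im_cj mulrN mulNr.
    rewrite rnorm_sqr /P wE Re_add Im_add Re_mul Im_mul lamR lamI /=.
    rewrite /T /w rnorm_sqr Re_gridpt Im_gridpt.
    have qE : q = 1 + eps * (complex.Re z1 ^+ 2 + complex.Im z1 ^+ 2) by rewrite /q rnorm_sqr.
    have ab1 : complex.Re z1 ^+ 2 + complex.Im z1 ^+ 2 <= 1.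
      by rewrite -rnorm_sqr expr_le1 //; lra.
    move: (complex.Re z1) (complex.Im z1) qE ab1 => a b qE ab1.
    rewrite ler_pdivlMr //.
    set A := a ^+ 2 + b ^+ 2 in qE ab1; set D := x ^+ 2 + y ^+ 2 in d2.
    have A0 : 0 <= A by rewrite addr_ge0 ?sqr_ge0.
    have D0 : 0 <= D by rewrite addr_ge0 ?sqr_ge0.
    have t0 : 0 <= t by rewrite divr_ge0 ?ltW // mulr_gt0.
    have t2 : t <= 2 * eps by rewrite -tq ler_peMr.
    have -> : ((1 + (t * a * x - - t * b * y)) ^+ 2 + (0 + (t * a * y + - t * b * x)) ^+ 2 + 1) / 2 * q
      = q + (t * q) * (a * x + b * y) + t * (t * q) * A * D / 2.
      by rewrite /A /D; field.
    have -> : 1 + eps * ((a + x) ^+ 2 + (b + y) ^+ 2) = q + 2 * eps * (a * x + b * y) + eps * D.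
      by rewrite qE /A /D; ring.
    rewrite tq.
    have eA : eps * A <= 1 / 4 by nra.
    have tA : t * (eps * A) <= 2 * eps * (1 / 4) by apply: ler_pM => //; rewrite mulr_ge0 // ltW.
    have tAD : t * (eps * A) * D <= 2 * eps * (1 / 4) * D by apply: ler_wpM2r.
    have -> : t * (2 * eps) * A * D / 2 = t * (eps * A) * D by field.
    have dd : eps * h ^+ 2 <= eps * D by apply: ler_wpM2l => //; exact: ltW.
    lra.
  rewrite /g rnormM.
  have q0 : 0 < q by lra.
  have h1 : rnorm (phi w) * T * (rnorm (P w) * q) <= F * q * (T - eps * h ^+ 2 / 2).
    by apply: ler_pM; rewrite ?mulr_ge0 ?rnorm_ge0 // ltW.
  have Tn : T != 0 by rewrite gt_eqF.
  have : rnorm (phi w) * rnorm (P w) <= F * (1 - eps * h ^+ 2 / 2 / T).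
    rewrite -(@ler_pM2r _ (T * q)) ?mulr_gt0 //.
    have -> : F * (1 - eps * h ^+ 2 / 2 / T) * (T * q) = F * q * (T - eps * h ^+ 2 / 2) by field.
    by apply: le_trans h1; rewrite le_eqVlt; apply/orP; left; apply/eqP; ring.
  move/le_trans; apply; rewrite /M; apply: ler_wpM2l; first exact: ltW.
  rewrite lerD2l lerN2 invfM mulrA; apply: ler_wpM2l.
    by rewrite divr_ge0 // mulr_ge0 ?sqr_ge0 // ltW.
  by rewrite lef_pV2 ?posrE //; lra.
rewrite leNgt => /negP; apply; rewrite /M.
by rewrite -[ltRHS]mulr1 ltr_pM2l // ltrBlDr ltrDl.
Qed.
End schwarz.

Section schwarz_pick.
Context {R : realType}.
Notation C := (Cplx R).

(** The quotient [f z / z], extended by the derivative at 0, is continuous at 0 and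
    differentiable elsewhere.  The maximum of its modulus times [1 + eps |z|^2] on a
    disc of radius [r] lies on the circle, where it is at most [(1 + eps) / r]; then
    [eps] tends to 0 and [r] to 1. *)
Theorem schwarz_lemma (f : C -> C) :
  (forall z, rnorm z < 1 -> differentiable f z) ->
  (forall z, rnorm z < 1 -> rnorm (f z) <= 1) -> f 0 = 0 ->
  forall z, rnorm z < 1 -> rnorm (f z) <= rnorm z.
Proof.
move=> df f1 f0 z z1.
have [->|zn0] := eqVneq z 0; first by rewrite f0.
have n00 : rnorm (0 : C) < 1 by rewrite rnorm0.
have [a Ha] := complex_differentiable_affine (df 0 n00).
pose phi (w : C) : C := if w == 0 then a else f w / w.
have dphi w : rnorm w < 1 -> w != 0 -> differentiable phi w.
  move=> w1 w0; apply: (@near_differentiable R (fun u => f u * u^-1)).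
    apply/rnbhsP; exists (rnorm w); first by rewrite rnorm_gt0.
    move=> u hu; rewrite /phi; case: eqVneq => // u0.
    by move: hu; rewrite u0 sub0r rnormN ltxx.
  apply: (@differentiableM _ _ f); first exact: df.
  by apply: differentiableV.
have phi0 : {for 0, continuous phi}.
  move=> A /rnbhsP [e e0 HA].
  have [d d0 H] := Ha (e / 2) (divr_gt0 e0 (ltr0n _ 2)).
  apply/rnbhsP; exists d => // w hw; apply: HA; rewrite /phi eqxx.
  case: eqVneq => [_|w0]; first by rewrite subrr rnorm0.
  have := H w hw; rewrite f0 add0r subr0.
  have -> : f w - a * w = (f w / w - a) * w by field.
  rewrite rnormM ler_pM2r ?rnorm_gt0 // => /le_lt_trans; apply; lra.
have cphi w : rnorm w < 1 -> {for w, continuous phi}.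
  move=> w1; have [->//|w0] := eqVneq w 0.
  exact: differentiable_continuous (dphi _ w1 w0).
have phi_le (r eps : R) : 0 < eps <= 1 / 4 -> rnorm z <= r -> r < 1 -> rnorm (phi z) * r <= 1 + eps.
  move=> he zr r1; have /andP[e0 e4] := he.
  have r0 : 0 < r by apply: lt_le_trans zr; rewrite rnorm_gt0.
  have [z2] : exists2 c : C, c \in [set w : C | rnorm w <= r] & forall t, t \in [set w : C | rnorm w <= r] ->
    rnorm (phi t) * (1 + eps * rnorm t ^+ 2) <= rnorm (phi c) * (1 + eps * rnorm c ^+ 2).
    apply: (@compact_EVT_max _ R (fun w => rnorm (phi w) * (1 + eps * rnorm w ^+ 2))).
    - by exists z.
    - exact: compact_disc.
    rewrite continuous_subspace_in => w; rewrite inE => hw.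
    apply: continuous_subspaceT_for => //.
    have cw : rnorm (phi w') @[w' --> w] --> rnorm (phi w).
      by apply: (@continuous_comp _ _ _ phi rnorm); [apply: cphi; exact: le_lt_trans r1|exact: rnorm_continuous].
    have cw' : rnorm w' @[w' --> w] --> rnorm w by exact: rnorm_continuous.
    have cw2 : rnorm w' ^+ 2 @[w' --> w] --> rnorm w ^+ 2 by exact: (cvgM cw' cw').
    have cc (k : R) : k @[_ --> nbhs (w : C)] --> k by exact: (cvg_cst k).
    exact: (cvgM cw (cvgD (cc 1) (cvgM (cc eps) cw2))).
  rewrite inE /= => z2r Hmax.
  have Hz := Hmax z; rewrite inE /= in Hz; have {}Hz := Hz zr.
  have l1 : rnorm (phi z) <= rnorm (phi z) * (1 + eps * rnorm z ^+ 2).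
    by rewrite ler_peMr ?rnorm_ge0 // lerDl mulr_ge0 ?sqr_ge0 // ltW.
  apply: (@le_trans _ _ (rnorm (phi z2) * (1 + eps * rnorm z2 ^+ 2) * r)).
    by rewrite ler_pM2r //; exact: le_trans Hz.
  have [->|nz] := eqVneq (phi z2) 0; first by rewrite rnorm0 !mul0r; lra.
  have [z2lt|z2ge] := ltP (rnorm z2) r.
    have dphir w : rnorm w < r -> w != 0 -> differentiable phi w.
      by move=> wr; apply: dphi; exact: lt_trans r1.
    have Hm w : rnorm w <= r -> rnorm (phi w) * (1 + eps * rnorm w ^+ 2) <=
      rnorm (phi z2) * (1 + eps * rnorm z2 ^+ 2) by move=> wr; apply: Hmax; rewrite inE.
    by have := no_interior_maximum he (ltW r1) z2lt nz dphir (cphi _ (lt_trans z2lt r1)) Hm.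
  have z2E : rnorm z2 = r by apply/eqP; rewrite eq_le z2r.
  have z20 : z2 != 0 by rewrite -rnorm_gt0 z2E.
  rewrite /phi (negbTE z20) rnormM rnormV z2E.
  have -> : rnorm (f z2) / r * (1 + eps * r ^+ 2) * r = rnorm (f z2) * (1 + eps * r ^+ 2).
    by have rn : r != 0 by [rewrite gt_eqF]; field.
  rewrite -[leRHS]mul1r; apply: ler_pM; rewrite ?rnorm_ge0 //.
  - by rewrite addr_ge0 // mulr_ge0 ?sqr_ge0 // ltW.
  - by apply: f1; rewrite z2E.
  by rewrite lerD2l ger_pMr // expr_le1 // ?(ltW r1) ?(ltW r0).
have phi1 : rnorm (phi z) <= 1.
  have key (r : R) : rnorm z <= r -> r < 1 -> rnorm (phi z) * r <= 1.
    move=> zr r1; apply/ler_addgt0Pr => e e0.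
    apply: (@le_trans _ _ (1 + Num.min e (1 / 4))).
      by apply: phi_le => //; rewrite lt_min e0 ge_min lexx orbT andbT; lra.
    by rewrite lerD2l ge_min lexx.
  rewrite leNgt; apply/negP => p1.
  set p := rnorm (phi z) in p1 key.
  have p0 : 0 < p by lra.
  have pV : p^-1 < 1 by rewrite invf_lt1.
  have /key : rnorm z <= (1 + Num.max (rnorm z) p^-1) / 2.
    by rewrite /Num.max; case: ifP => ?; lra.
  have h : (1 + Num.max (rnorm z) p^-1) / 2 < 1.
    by rewrite /Num.max; case: ifP => ?; lra.
  move=> /(_ h); rewrite leNgt => /negP; apply.
  have : p^-1 < (1 + Num.max (rnorm z) p^-1) / 2.
    have : p^-1 <= Num.max (rnorm z) p^-1 by rewrite le_max lexx orbT.
    lra.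
  by rewrite -(ltr_pM2l p0) mulfV ?gt_eqF.
move: phi1; rewrite /phi (negbTE zn0) rnormM rnormV.
by rewrite ler_pdivrMr ?rnorm_gt0 // mul1r.
Qed.

(** The involution of the unit disc that exchanges [0] and [a]. *)
Definition moebius (a z : C) : C := (a - z) / (1 - cj a * z).

Lemma rnorm_lt_sqr (z w : C) : rnorm z ^+ 2 < rnorm w ^+ 2 -> rnorm z < rnorm w.
Proof. by rewrite ltr_pXn2r ?nnegrE ?rnorm_ge0. Qed.

Lemma moebius_lt (a z : C) : rnorm a < 1 -> rnorm z < 1 -> rnorm (a - z) < rnorm (1 - cj a * z).
Proof.
move=> a1 z1; apply: rnorm_lt_sqr; rewrite -subr_gt0.
have -> : rnorm (1 - cj a * z) ^+ 2 - rnorm (a - z) ^+ 2 =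
   (1 - rnorm a ^+ 2) * (1 - rnorm z ^+ 2).
  by rewrite !rnorm_sqr; case: a {a1} => [a b]; case: z {z1} => [x y] /=; ring.
by apply: mulr_gt0; rewrite subr_gt0 expr_lt1 ?rnorm_ge0.
Qed.

(** The Schwarz lemma for [g] composed with the automorphism exchanging [0] and [a],
    followed by the Cayley transform that sends [g a] to [0].  As a bound for the
    logarithm of [Re g a / Re g b] this is exactly twice the Poincare distance. *)
Theorem halfplane_harnack (g : C -> C) (a b : C) :
  (forall z, rnorm z < 1 -> differentiable g z) ->
  (forall z, rnorm z < 1 -> 0 < complex.Re (g z)) ->
  rnorm a < 1 -> rnorm b < 1 ->
  complex.Re (g a) * (1 - rnorm (moebius a b)) <=
  complex.Re (g b) * (1 + rnorm (moebius a b)).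
Proof.
move=> dg g0 a1 b1; set m := rnorm _.
have den z : rnorm z < 1 -> 1 - cj a * z != 0.
  by move=> z1; rewrite -rnorm_gt0; apply: le_lt_trans (moebius_lt a1 z1); exact: rnorm_ge0.
have mlt z : rnorm z < 1 -> rnorm (moebius a z) < 1.
  move=> z1; rewrite /moebius rnormM rnormV ltr_pdivrMr ?rnorm_gt0 ?den //.
  by rewrite mul1r moebius_lt.
have dm z : rnorm z < 1 -> differentiable (moebius a) z.
  move=> z1; apply: (@differentiableM _ _ (fun z => a - z) (fun z => (1 - cj a * z)^-1)).
    by apply: differentiableB => //; exact: differentiable_cst.
  apply: differentiableV; last exact: den.
  rewrite (_ : (fun z => _) = fun z => 1 + (- cj a) * z); first exact: differentiable_affine.
  by apply/funext => w; ring.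
have m0 : moebius a 0 = a by rewrite /moebius mulr0 !subr0 divr1.
have mb : moebius a (moebius a b) = b.
  have h1 := den _ b1; have h2 := den _ (mlt _ b1).
  apply: (mulIf h2); rewrite {1}/moebius mulfVK //.
  rewrite /moebius; field.
  exact: h1.
pose G z := g (moebius a z).
have G0 z : rnorm z < 1 -> 0 < complex.Re (G z) by move=> z1; apply: g0; exact: mlt.
have den2 z : rnorm z < 1 -> rnorm (G z - g a) < rnorm (G z + cj (g a)).
  move=> z1; apply: rnorm_lt_sqr; rewrite -subr_gt0.
  have := G0 z z1; have := g0 a a1; rewrite !rnorm_sqr !Re_add !Im_add Re_opp Im_opp Re_cj Im_cj.
  by nra.
pose f z := (G z - g a) * (G z + cj (g a))^-1.
have fm : rnorm (f (moebius a b)) <= m.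
  apply: schwarz_lemma; last exact: mlt.
  - move=> z z1; have dG : differentiable G z.
      apply: (@differentiable_comp _ _ _ _ (moebius a) g); first exact: dm.
      by apply: dg; exact: mlt.
    apply: (@differentiableM _ _ (fun z => G z - g a)).
      by apply: differentiableB => //; exact: differentiable_cst.
    apply: (@differentiableV _ _ (fun z => G z + cj (g a))).
      by apply: differentiableD => //; exact: differentiable_cst.
    by rewrite -rnorm_gt0; apply: le_lt_trans (den2 _ z1); exact: rnorm_ge0.
  - move=> z z1; rewrite /f rnormM rnormV ler_pdivrMr.
      by rewrite mul1r ltW // den2.
    by apply: le_lt_trans (den2 _ z1); exact: rnorm_ge0.
  by rewrite /f /G m0 subrr mul0r.
have m1 : m < 1 by exact: mlt.
have m00 : 0 <= m by exact: rnorm_ge0.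
clearbody m.
move: fm; rewrite /f rnormM rnormV ler_pdivrMr; last first.
  by apply: le_lt_trans (den2 _ (mlt _ b1)); exact: rnorm_ge0.
rewrite /G mb; have ga := g0 a a1; have gb := g0 b b1.
rewrite -(@ler_pXn2r _ 2) ?nnegrE ?rnorm_ge0 ?mulr_ge0 ?rnorm_ge0 //.
rewrite exprMn !rnorm_sqr !Re_add !Im_add Re_opp Im_opp Re_cj Im_cj => h.
move: (complex.Re (g a)) (complex.Re (g b)) (complex.Im (g b) - complex.Im (g a)) ga gb h => x u v x0 u0 h.
have mm : m ^+ 2 <= 1 by rewrite expr_le1 // ltW.
have h2 : (u - x) ^+ 2 <= (m * (u + x)) ^+ 2.
  have : m ^+ 2 * v ^+ 2 <= v ^+ 2 by rewrite ler_piMl // sqr_ge0.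
  by move: h; rewrite exprMn mulrDr => h h'; lra.
have : `|u - x| <= `|m * (u + x)|.
  by rewrite -(@ler_pXn2r _ 2) ?nnegrE // !real_normK ?num_real.
rewrite (ger0_norm (_ : 0 <= m * (u + x))); last by rewrite mulr_ge0 // addr_ge0 // ltW.
rewrite ler_norml => /andP[h3 h4]; lra.
Qed.
End schwarz_pick.

(** * The Kobayashi distance of a convex domain *)

Section kobayashi_distance.
Context {R : realType} {N : nat}.
Notation C := (Cplx R).
Notation V := (CN R N).

Lemma unit_discE (a : C) : unit_disc a <-> rnorm a < 1.
Proof. by rewrite /unit_disc /= rnormE -rc1 rc_lt. Qed.

Lemma poincareE (a b : C) :
  poincare a b = 2^-1 * ln ((1 + rnorm (moebius a b)) / (1 - rnorm (moebius a b))).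
Proof.
rewrite /poincare -/(rnorm _).
suff -> : rnorm ((a - b) / (1 - b^* * a)) = rnorm (moebius a b) by [].
rewrite /moebius !rnormM !rnormV; congr (_ / _).
rewrite -rnorm_cj; congr rnorm.
have -> : b^* = cj b by [].
rewrite /cj rmorphB rmorphM rmorph1 /= conjcK mulrC //.
Qed.

Lemma moebius_lt1 (a b : C) : unit_disc a -> unit_disc b -> rnorm (moebius a b) < 1.
Proof.
move=> /unit_discE a1 /unit_discE b1; have h := moebius_lt a1 b1.
have h0 : 0 < rnorm (1 - cj a * b) by apply: le_lt_trans h; exact: rnorm_ge0.
by rewrite /moebius rnormM rnormV ltr_pdivrMr // mul1r.
Qed.

Lemma poincare_ge0 (a b : C) : unit_disc a -> unit_disc b -> 0 <= poincare a b.
Proof.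
move=> ha hb; have h := moebius_lt1 ha hb; have h0 := rnorm_ge0 (moebius a b).
rewrite poincareE mulr_ge0 // ln_ge0 // ler_pdivlMr; lra.
Qed.

Lemma chain_ge0 (D : set V) x y s : disc_chain D x y s -> 0 <= s.
Proof.
elim=> // h a b w s' _ _ ha hb _ s0; exact: addr_ge0 (poincare_ge0 ha hb) s0.
Qed.

Lemma chain_cat (D : set V) x y z s t :
  disc_chain D x y s -> disc_chain D y z t -> disc_chain D x z (s + t).
Proof.
elim=> [w _|h a b w s' dh hD ha hb _ IH] yz; first by rewrite add0r.
by rewrite -addrA; apply: disc_chain_cons => //; exact: IH.
Qed.

Lemma chain_disc (D : set V) (h : C -> V) (a b : C) x y z s :
  holomorphic_on (@unit_disc R) h -> (forall c, unit_disc c -> D (h c)) ->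
  unit_disc a -> unit_disc b -> h a = x -> h b = y -> disc_chain D y z s ->
  disc_chain D x z (poincare a b + s).
Proof. by move=> dh hD ha hb <- <-; exact: disc_chain_cons. Qed.

Lemma chain_map (D : set V) (f : V -> V) x y s : self_map D f -> holomorphic_on D f ->
  disc_chain D x y s -> disc_chain D (f x) (f y) s.
Proof.
move=> fD df; elim=> [w Dw|h a b w s' dh hD ha hb _ IH].
  by apply: disc_chain_nil; exact: fD.
apply: (@disc_chain_cons R N D (f \o h) a b) => //.
  move=> c hc; apply: differentiable_comp; first exact: dh.
  by apply: df; exact: hD.
by move=> c hc; apply: fD; exact: hD.
Qed.

(** The infimum defining [kobayashi] is meaningful only when a chain exists; for
    points of a convex open set this is [convex_joined]. *)
Definition joined (D : set V) x y := exists s, disc_chain D x y s.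

Lemma kobayashi_le (D : set V) x y s : disc_chain D x y s -> kobayashi D x y <= s.
Proof.
by move=> h; apply: ge_inf => //; exists 0 => t; exact: chain_ge0.
Qed.

Lemma kobayashi_ge (D : set V) x y B : joined D x y ->
  (forall s, disc_chain D x y s -> B <= s) -> B <= kobayashi D x y.
Proof. by move=> j h; apply: lb_le_inf. Qed.

Lemma kobayashi_triangle (D : set V) x y z : joined D x y -> joined D y z ->
  kobayashi D x z <= kobayashi D x y + kobayashi D y z.
Proof.
move=> jxy jyz; rewrite -lerBlDl; apply: kobayashi_ge => // t yz.
rewrite lerBlDr -lerBlDl; apply: kobayashi_ge => // s xy.
by rewrite lerBlDl addrC; apply: kobayashi_le; exact: chain_cat xy yz.
Qed.

Lemma kobayashi_contraction (D : set V) (f : V -> V) x y : self_map D f ->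
  holomorphic_on D f -> joined D x y -> kobayashi D (f x) (f y) <= kobayashi D x y.
Proof.
by move=> fD df j; apply: kobayashi_ge => // s xy; apply: kobayashi_le; exact: chain_map.
Qed.

(** Harnack's inequality, summed along a chain of discs. *)
Lemma kobayashi_halfplane (D : set V) (g : V -> C) x y : joined D x y -> D x -> D y ->
  (forall z, D z -> differentiable g z) -> (forall z, D z -> 0 < complex.Re (g z)) ->
  2^-1 * (ln (complex.Re (g x)) - ln (complex.Re (g y))) <= kobayashi D x y.
Proof.
move=> j Dx Dy dg g0; apply: kobayashi_ge => // s xy.
elim: xy {j} Dx Dy => [w Dw _ _|h a b w s' dh hD ha hb _ IH Dx Dy]; first by rewrite subrr mulr0.
have hDa := hD a ha; have hDb := hD b hb.
have m1 := moebius_lt1 ha hb; have m0 := rnorm_ge0 (moebius a b).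
have /halfplane_harnack -/(_ a b) H : forall z : C, rnorm z < 1 -> differentiable (g \o h) z.
  move=> z /unit_discE hz; apply: differentiable_comp; first exact: dh.
  by apply: dg; exact: hD.
have {}H := H _ (proj1 (unit_discE a) ha) (proj1 (unit_discE b) hb).
have {}H : complex.Re (g (h a)) * (1 - rnorm (moebius a b)) <=
   complex.Re (g (h b)) * (1 + rnorm (moebius a b)).
  by apply: H => z /unit_discE hz; apply: g0; exact: hD.
have ga := g0 _ hDa; have gb := g0 _ hDb.
have key : ln (complex.Re (g (h a))) - ln (complex.Re (g (h b))) <=
   ln ((1 + rnorm (moebius a b)) / (1 - rnorm (moebius a b))).
  rewrite -ln_div ?posrE //; rewrite ler_ln ?posrE ?divr_gt0 //; [|lra|lra].
  rewrite ler_pdivrMr // mulrAC ler_pdivlMr; last by lra.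
  by rewrite [X in _ <= X]mulrC.
have := IH hDb Dy; rewrite poincareE; lra.
Qed.

Lemma convexP (D : set V) x y (t : R) : convex_set D -> D x -> D y -> 0 <= t <= 1 ->
  D (rc t *: x + rc (1 - t) *: y).
Proof.
move=> cD Dx Dy /andP[t0 t1].
have h0 : 0 <= rc t by rewrite -rc0 rc_le.
have h1 : rc t <= 1 by rewrite -rc1 rc_le.
have /set_mem := cD x y (Itv01 h0 h1) (mem_set Dx) (mem_set Dy).
by rewrite rcB rc1.
Qed.

Lemma convex_tube (D : set V) x y e (t : R) u : convex_set D -> 0 <= t <= 1 ->
  (forall v, rnorm (v - x) < e -> D v) -> (forall v, rnorm (v - y) < e -> D v) ->
  rnorm (u - (x + rc t *: (y - x))) < e -> D u.
Proof.
move=> cD t01 Dx Dy hu; set d := u - _ in hu.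
have -> : u = rc t *: (y + d) + rc (1 - t) *: (x + d).
  by apply/rowP => i; rewrite /d !mxE rcB rc1; ring.
by apply: convexP => //; [apply: Dy|apply: Dx]; rewrite addrC addKr.
Qed.

Lemma disc0 : unit_disc (0 : C).
Proof. by apply/unit_discE; rewrite rnorm0. Qed.

Lemma disc_half : unit_disc (rc (1 / 2) : C).
Proof. by apply/unit_discE; rewrite rnorm_rc ger0_norm; lra. Qed.

Definition half_step : R := poincare 0 (rc (1 / 2)).

Lemma differentiable_line (x v : V) (c : C) :
  differentiable (fun c : C => x + c *: v) c.
Proof.
apply: differentiableD; first exact: differentiable_cst.
exact: differentiableZl.
Qed.

(** A segment whose [e]-neighbourhood lies in [D] is covered by [n] affine discs, each
    traversed from its centre to half of its radius. *)
Lemma chain_segment (D : set V) x y e n : convex_set D ->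
  (forall v, rnorm (v - x) < e -> D v) -> (forall v, rnorm (v - y) < e -> D v) ->
  0 < e -> (0 < n)%N -> 2 * rnorm (y - x) <= n%:R * e ->
  disc_chain D x y (n%:R * half_step).
Proof.
move=> cD Dx Dy e0 n0 hn.
have n0' : 0 < n%:R :> R by rewrite ltr0n.
pose z k := x + rc (k%:R / n%:R) *: (y - x).
suff H k : (k <= n)%N -> disc_chain D (z (n - k)%N) y (k%:R * half_step).
  by have := H n (leqnn n); rewrite /z subnn mul0r rc0 scale0r addr0.
elim: k => [|k IH] kn.
  rewrite subn0 mul0r /z divff ?gt_eqF // rc1 scale1r subrKC.
  by apply: disc_chain_nil; apply: Dy; rewrite subrr rnorm0.
rewrite -natr1 mulrDl mul1r addrC.
have kn' := ltnW kn.
set j := (n - k.+1)%N; have jE : (n - k = j.+1)%N by rewrite subnSK.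
apply: (@chain_disc D (fun c => z j + c *: (rc (2 / n%:R) *: (y - x))) 0 (rc (1 / 2)) _ (z j.+1)).
- by move=> c _; exact: differentiable_line.
- move=> c /unit_discE c1; apply: (@convex_tube D x y e (j%:R / n%:R)) => //.
    rewrite divr_ge0 //= ler_pdivrMr // mul1r ler_nat; exact: leq_subr.
  rewrite -/(z j) addrC addKr rnormZ rnormZ rnorm_rc ger0_norm ?divr_ge0 //.
  have h : 2 / n%:R * rnorm (y - x) <= e by rewrite mulrAC ler_pdivrMr // [e * _]mulrC.
  have [->|nz] := eqVneq (rnorm (y - x)) 0; first by rewrite !mulr0.
  apply: lt_le_trans h; rewrite gtr_pMl // mulr_gt0 ?divr_gt0 //.
  by rewrite lt_def nz rnorm_ge0.
- exact: disc0.
- exact: disc_half.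
- by rewrite scale0r addr0.
- rewrite /z -addrA scalerA -scalerDl -rcM -rcD; congr (_ + rc _ *: _).
  by rewrite -natr1; have nn : n%:R != 0 :> R by [rewrite gt_eqF]; field.
by rewrite -jE; exact: IH.
Qed.

(** For [z] close to [y] the number of discs needed in [chain_segment] is bounded. *)
Lemma kobayashi_locally_bounded (D : set V) x y : open D -> convex_set D -> D x -> D y ->
  exists e B : R, 0 < e /\ forall z, rnorm (z - y) < e ->
    [/\ D z, joined D x z & kobayashi D x z <= B].
Proof.
move=> oD cD Dx Dy.
have [e1 e10 H1] := proj1 (rnbhsP x D) (open_nbhs_nbhs (conj oD Dx)).
have [e2 e20 H2] := proj1 (rnbhsP y D) (open_nbhs_nbhs (conj oD Dy)).
pose e := Num.min e1 (e2 / 2).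
have e0 : 0 < e by rewrite lt_min e10 divr_gt0.
have ee2 : e <= e2 / 2 by rewrite ge_min lexx orbT.
pose n := (Num.truncn (2 * (rnorm (y - x) + e) / e)).+1.
have hn : 2 * (rnorm (y - x) + e) <= n%:R * e.
  by rewrite -ler_pdivrMr // ltW // truncnS_gt.
exists e, (n%:R * half_step); split => // z hz.
have ch : disc_chain D x z (n%:R * half_step).
  apply: (@chain_segment D x z e n) => //.
  - by move=> v hv; apply: H1; apply: lt_le_trans hv _; rewrite ge_min lexx.
  - move=> v hv; apply: H2; rewrite -(subrK z v) -addrA.
    apply: le_lt_trans (rnormD _ _) _; lra.
  apply: le_trans hn; rewrite ler_pM2l //.
  rewrite -(subrK y z) -addrA; apply: le_trans (rnormD _ _) _; lra.
split; [|by exists (n%:R * half_step)|exact: kobayashi_le].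
by apply: H2; lra.
Qed.

Lemma convex_joined (D : set V) x y : open D -> convex_set D -> D x -> D y -> joined D x y.
Proof.
move=> oD cD Dx Dy; have [e [B [e0 H]]] := kobayashi_locally_bounded oD cD Dx Dy.
by have [] := H y; rewrite ?subrr ?rnorm0.
Qed.
End kobayashi_distance.

(** * Differential calculus along real lines *)

Section smooth_calculus.
Context {R : realType} {N : nat}.
Notation C := (Cplx R).
Notation V := (CN R N).
Implicit Types (U : set V) (rho : V -> R) (z v w : V).

Lemma smooth_continuous U rho z : smooth U rho -> U z -> {for z, continuous rho}.
Proof. by move=> /(_ 0%N) [h _]; exact: h. Qed.

Lemma smooth_derivable U rho v z : smooth U rho -> U z ->
  derivable (along_line rho v z) 0 1.
Proof. by move=> /(_ 1%N) [_ /(_ v)[h _]]; exact: h. Qed.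
Arguments smooth_derivable {U rho} v {z}.

Lemma smooth_Dreal U rho v : smooth U rho -> smooth U (Dreal rho v).
Proof. by move=> h k; have /= [_ /(_ v)[_]] := h k.+1. Qed.
Arguments smooth_Dreal {U rho} v.

Lemma continuous_real rho z : {for z, continuous rho} -> forall e : R, 0 < e ->
  exists2 d : R, 0 < d & forall w, rnorm (w - z) < d -> `|rho w - rho z| < e.
Proof.
move=> /cvgrPdist_lt h e /h /rnbhsP [d d0 H]; exists d => // w /H.
by rewrite distrC.
Qed.

Lemma line_shift z v (s t : R) : z + rc s *: v + rc t *: v = z + rc (s + t) *: v.
Proof. by rewrite -addrA -scalerDl -rcD. Qed.

Lemma line0 z v : z + rc 0 *: v = z.
Proof. by rewrite rc0 scale0r addr0. Qed.

Lemma line_is_derive U rho v z (t : R) : smooth U rho -> U (z + rc t *: v) ->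
  is_derive t 1 (fun s => rho (z + rc s *: v)) (Dreal rho v (z + rc t *: v)).
Proof.
move=> sm Uz; have d := smooth_derivable v sm Uz.
have e : (fun h : R => h^-1 *: (rho (z + rc (h *: 1 + t) *: v) - rho (z + rc t *: v))) =
    (fun h : R => h^-1 *: ((along_line rho v (z + rc t *: v) \o shift 0) (h *: 1)
      - along_line rho v (z + rc t *: v) 0)).
  apply/funext => h; rewrite /along_line [(_ \o _) _]/= -/(rc _) -/(rc 0) line0.
  by rewrite line_shift addr0 [t + _]addrC.
split; first by rewrite /derivable /= e; exact: d.
by rewrite /derive /= e.
Qed.

Lemma line_mvt U rho v z (t : R) : smooth U rho -> 0 < t ->
  (forall s, 0 <= s <= t -> U (z + rc s *: v)) ->
  exists2 c, 0 < c < t & rho (z + rc t *: v) - rho z = t * Dreal rho v (z + rc c *: v).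
Proof.
move=> sm t0 HU.
have [||c hc] := @MVT R (fun s => rho (z + rc s *: v))
    (fun s => Dreal rho v (z + rc s *: v)) 0 t t0.
- move=> s; rewrite in_itv /= => /andP[s0 st].
  by apply: line_is_derive sm _; apply: HU; rewrite !ltW.
- apply: derivable_within_continuous => s; rewrite in_itv /= => hs.
  by have := line_is_derive sm (HU s hs) => -[].
rewrite line0 subr0 => ->; exists c; last by rewrite mulrC.
by move: hc; rewrite in_itv.
Qed.

Lemma line_mvt_abs U rho v z (t : R) : smooth U rho ->
  (forall s, `|s| <= `|t| -> U (z + rc s *: v)) ->
  exists2 c, `|c| <= `|t| & rho (z + rc t *: v) - rho z = t * Dreal rho v (z + rc c *: v).
Proof.
move=> sm HU; have [t0|t0|->] := ltgtP t 0; last first.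
- by exists 0; rewrite ?normr0 // line0 subrr mul0r.
- have [|c /andP[c0 ct] e] := line_mvt sm t0 (z := z) (v := v).
    by move=> s /andP[s0 st]; apply: HU; rewrite !ger0_norm // ltW.
  by exists c => //; rewrite !ger0_norm // ltW.
have t0' : 0 < - t by rewrite oppr_gt0.
have [|c /andP[c0 ct] e] := line_mvt sm t0' (z := z + rc t *: v) (v := v).
  move=> s /andP[s0 st]; rewrite line_shift; apply: HU.
  by rewrite (ltr0_norm t0) ler_norml; apply/andP; split; lra.
have tc : `|t + c| <= `|t|.
  by clear e; rewrite (ltr0_norm t0) ler_norml; apply/andP; split; lra.
exists (t + c); first exact: tc.
have e1 : z + rc t *: v + rc (- t) *: v = z by rewrite line_shift subrr line0.
rewrite e1 line_shift in e; move: e.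
move: (rho z) (rho (z + rc t *: v)) (Dreal rho v (z + rc (t + c) *: v)) => a b d.
by rewrite mulNr => e; rewrite -opprB e opprK.
Qed.

(** Stated as an expansion with remainder so that mean value estimates apply. *)
Lemma Dreal_unique rho v z (L : R) :
  (forall e : R, 0 < e -> exists2 d : R, 0 < d & forall t, t != 0 -> `|t| < d ->
     `|rho (z + rc t *: v) - rho z - t * L| <= e * `|t|) -> Dreal rho v z = L.
Proof.
move=> H; rewrite /Dreal /derive; apply/cvg_lim => //.
apply/cvgrPdist_le => e e0; have [d d0 Hd] := H e e0.
exists d => //= t; rewrite /ball_ /= sub0r normrN => td t0.
have -> : along_line rho v z (t%:A + 0) = rho (z + rc t *: v).
  by rewrite /along_line addr0 -[t%:A]/(t * 1) mulr1.
have -> : along_line rho v z 0 = rho z by rewrite /along_line -/(rc 0) line0.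
have -> : L - t^-1 *: (rho (z + rc t *: v) - rho z) =
  - ((rho (z + rc t *: v) - rho z - t * L) / t).
  by rewrite -[_ *: _]/(_ * _); field.
by rewrite normrN normf_div ler_pdivrMr ?normr_gt0 // Hd.
Qed.

Lemma small_shift (q a b : V) (d x y : R) w : rnorm (w - q) < d / 2 ->
  `|x| * rnorm a + `|y| * rnorm b < d / 2 -> rnorm (w + rc x *: a + rc y *: b - q) < d.
Proof.
move=> hw h; have -> : w + rc x *: a + rc y *: b - q = (w - q) + (rc x *: a + rc y *: b).
  by apply/rowP => i; rewrite !mxE; ring.
apply: le_lt_trans (rnormD _ _) _.
have : rnorm (rc x *: a + rc y *: b) < d / 2.
  by apply: le_lt_trans (rnormD _ _) _; rewrite !rnormZ !rnorm_rc.
lra.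
Qed.

Lemma open_ball U z : open U -> U z -> exists2 d : R, 0 < d &
  forall w, rnorm (w - z) < d -> U w.
Proof. by move=> oU Uz; apply/rnbhsP; exact: open_nbhs_nbhs. Qed.

(** Directional derivatives that are continuous in the point are linear in the
    direction: one moves along [u], then along [v], and applies the mean value
    theorem twice. *)
Lemma Dreal_linear U rho u v z (a b : R) : open U -> smooth U rho -> U z ->
  Dreal rho (rc a *: u + rc b *: v) z = a * Dreal rho u z + b * Dreal rho v z.
Proof.
move=> oU sm Uz; apply: Dreal_unique => e e0.
pose k := `|a| + `|b| + 1.
have k0 : 0 < k by rewrite ltr_wpDl // addr_ge0.
have ek : 0 < e / k by rewrite divr_gt0.
have [d1 d10 H1] := continuous_real (smooth_continuous (smooth_Dreal u sm) Uz) ek.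
have [d2 d20 H2] := continuous_real (smooth_continuous (smooth_Dreal v sm) Uz) ek.
have [d3 d30 H3] := open_ball oU Uz.
pose d := Num.min d1 (Num.min d2 d3).
have d0 : 0 < d by rewrite !lt_min d10 d20 d30.
pose m := `|a| * rnorm u + `|b| * rnorm v + 1.
have m0 : 0 < m by rewrite ltr_wpDl // addr_ge0 // mulr_ge0 // rnorm_ge0.
exists (d / 2 / m); first by rewrite !divr_gt0.
move=> t t0 td.
have near x y : `|x| <= `|t * a| -> `|y| <= `|t * b| ->
    rnorm (z + rc x *: u + rc y *: v - z) < d.
  move=> hx hy; apply: small_shift; first by rewrite subrr rnorm0 divr_gt0.
  move: td; rewrite ltr_pdivlMr //; apply: le_lt_trans.
  rewrite !normrM in hx hy; rewrite /m mulrDr mulr1 mulrDr !mulrA.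
  have := ler_wpM2r (rnorm_ge0 u) hx; have := ler_wpM2r (rnorm_ge0 v) hy.
  have := normr_ge0 t; lra.
have dd1 x : x < d -> x < d1 by move/lt_le_trans; apply; rewrite ge_min lexx.
have dd2 x : x < d -> x < d2 by move/lt_le_trans; apply; rewrite !ge_min lexx orbT.
have dd3 x : x < d -> x < d3 by move/lt_le_trans; apply; rewrite !ge_min lexx !orbT.
have [|c1 hc1 e1] := @line_mvt_abs U rho u z (t * a) sm.
  move=> s hs; apply: H3; apply: dd3.
  by have := near s 0 hs; rewrite normr0 line0; apply.
have [|c2 hc2 e2] := @line_mvt_abs U rho v (z + rc (t * a) *: u) (t * b) sm.
  by move=> s hs; apply: H3; apply: dd3; exact: near.
have h1 : `|Dreal rho u (z + rc c1 *: u) - Dreal rho u z| < e / k.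
  apply: H1; apply: dd1; have := near c1 0 hc1.
  by rewrite normr0 line0; apply.
have h2 : `|Dreal rho v (z + rc (t * a) *: u + rc c2 *: v) - Dreal rho v z| < e / k.
  by apply: H2; apply: dd2; exact: near.
have -> : z + rc t *: (rc a *: u + rc b *: v) = z + rc (t * a) *: u + rc (t * b) *: v.
  by rewrite scalerDr !scalerA -!rcM addrA.
set P := rho _; set P1 := rho (z + rc (t * a) *: u) in e1 e2.
set A1 := Dreal rho u (z + _) in e1 h1; set B1 := Dreal rho v (z + _ + _) in e2 h2.
have -> : P - rho z - t * (a * Dreal rho u z + b * Dreal rho v z) =
  t * (a * (A1 - Dreal rho u z) + b * (B1 - Dreal rho v z)).
  have -> : P - rho z = (P - P1) + (P1 - rho z) by ring.
  by rewrite e1 e2; ring.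
rewrite normrM mulrC; apply: ler_wpM2r => //.
apply: le_trans (ler_normD _ _) _; rewrite !normrM.
have ha := ler_wpM2l (normr_ge0 a) (ltW h1); have hb := ler_wpM2l (normr_ge0 b) (ltW h2).
apply: (@le_trans _ _ ((`|a| + `|b|) * (e / k))); first by rewrite mulrDl lerD.
rewrite mulrA ler_pdivrMr // mulrC; apply: ler_wpM2l; first exact: ltW.
by rewrite /k lerDl.
Qed.

Definition unit_vec (j : 'I_N) : V := delta_mx 0 j.

(** The complex covector whose real part is the differential of [rho]: it makes the
    supporting real functional the real part of a complex-linear one. *)
Definition gradient rho z (j : 'I_N) : C :=
  rc (Dreal rho (unit_vec j) z) - ii * rc (Dreal rho (ii *: unit_vec j) z).

Definition covector (c : 'I_N -> C) v : C := \sum_(j < N) v 0 j * c j.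

Lemma Dreal_sum U rho z n (F : 'I_n -> V) : open U -> smooth U rho -> U z ->
  Dreal rho (\sum_(j < n) F j) z = \sum_(j < n) Dreal rho (F j) z.
Proof.
move=> oU sm Uz; elim: n F => [|n IH] F.
  rewrite !big_ord0; have := Dreal_linear 0 0 0 0 oU sm Uz.
  by rewrite !mul0r addr0 !scaler0 addr0.
rewrite !big_ord_recr /= -IH; have := Dreal_linear (\sum_(i < n) F (widen_ord (leqnSn n) i)) (F ord_max) 1 1 oU sm Uz.
by rewrite rc1 !scale1r !mul1r.
Qed.

Lemma Dreal_covector U rho v z : open U -> smooth U rho -> U z ->
  Dreal rho v z = complex.Re (covector (gradient rho z) v).
Proof.
move=> oU sm Uz; rewrite {1}(row_sum_delta v) (Dreal_sum _ oU sm Uz).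
rewrite /covector (big_morph (@complex.Re R) (id1 := 0) (op1 := +%R) Re_add) //.
apply: eq_bigr => j _; rewrite Re_mul /gradient.
have -> : v 0 j *: delta_mx 0 j = rc (complex.Re (v 0 j)) *: unit_vec j
    + rc (complex.Im (v 0 j)) *: (ii *: unit_vec j).
  by rewrite scalerA [_ * ii]mulrC -scalerDl -complex_split.
rewrite (Dreal_linear (unit_vec j) (ii *: unit_vec j) _ _ oU sm Uz).
move: (Dreal rho (unit_vec j) z) (Dreal rho (ii *: unit_vec j) z) => a b.
by rewrite Re_sub Im_add Im_opp Re_ii Im_ii /=; ring.
Qed.

Lemma covectorZ c (a : C) v : covector c (a *: v) = a * covector c v.
Proof. by rewrite /covector mulr_sumr; apply: eq_bigr => j _; rewrite mxE mulrA. Qed.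

Lemma covectorD c v w : covector c (v + w) = covector c v + covector c w.
Proof. by rewrite /covector -big_split; apply: eq_bigr => j _; rewrite mxE mulrDl. Qed.

Lemma covectorN c v : covector c (- v) = - covector c v.
Proof. by rewrite -scaleN1r covectorZ mulN1r. Qed.

Lemma covectorB c v w : covector c (v - w) = covector c v - covector c w.
Proof. by rewrite covectorD covectorN. Qed.

Lemma differentiable_covector c v : differentiable (covector c) v.
Proof.
rewrite (_ : covector c = \sum_(j < N) (fun u : V => u 0 j * c j)).
  apply: (@differentiable_sum _ _ _ N (fun j (u : V) => u 0 j * c j)) => j.
  apply: differentiableM; last exact: differentiable_cst.
  exact: differentiable_coord.
by apply/funext => u; rewrite fct_sumE.
Qed.

Lemma rnorm_pair_le2 (a b : R) : `|a| <= 1 -> `|b| <= 1 ->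
  rnorm (rc a - ii * rc b) <= 2.
Proof.
move=> ha hb; apply: le_trans (rnormB _ _) _.
by rewrite rnormM rnorm_ii mul1r !rnorm_rc; apply: lerD.
Qed.

Lemma Dreal_bound U rho z : open U -> smooth U rho -> U z ->
  exists d K : R, [/\ 0 < d, 0 < K & forall w v, rnorm (w - z) < d ->
    U w /\ `|Dreal rho v w| <= K * rnorm v].
Proof.
move=> oU sm Uz.
have [d1 d10 H1] := open_ball oU Uz.
have H j : \forall w \near z, rnorm (gradient rho w j) <= rnorm (gradient rho z j) + 2.
  have [da da0 Ha] := continuous_real (smooth_continuous (smooth_Dreal (unit_vec j) sm) Uz) ltr01.
  have [db db0 Hb] := continuous_real (smooth_continuous (smooth_Dreal (ii *: unit_vec j) sm) Uz) ltr01.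
  apply/rnbhsP; exists (Num.min da db); first by rewrite lt_min da0.
  move=> w; rewrite lt_min => /andP[/Ha/ltW ha /Hb/ltW hb].
  rewrite -lerBlDl; apply: le_trans (le_trans (ler_norm _) (rnorm_dist _ _)) _.
  have -> : gradient rho w j - gradient rho z j =
    rc (Dreal rho (unit_vec j) w - Dreal rho (unit_vec j) z)
    - ii * rc (Dreal rho (ii *: unit_vec j) w - Dreal rho (ii *: unit_vec j) z).
    rewrite /gradient; move: (Dreal rho (unit_vec j) w) (Dreal rho (unit_vec j) z).
    move: (Dreal rho _ w) (Dreal rho _ z) => a b c d.
    by rewrite !rcB; ring.
  have le2 := rnorm_pair_le2 ha hb; exact: le2.
have [d2 d20 H2] := proj1 (rnbhsP _ _) (filter_forall (nbhs_filter z) H).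
pose K := \sum_(j < N) (rnorm (gradient rho z j) + 2) + 1.
exists (Num.min d1 d2), K; split.
- by rewrite lt_min d10.
- by rewrite ltr_wpDl // sumr_ge0 // => j _; rewrite addr_ge0 // rnorm_ge0.
move=> w v; rewrite lt_min => /andP[/H1 Uw /H2 hw]; split; first exact: Uw.
rewrite (Dreal_covector v oU sm Uw); apply: le_trans (Re_le _) _.
apply: le_trans (rnorm_sum _) _; rewrite /K mulrDl mul1r mulr_suml.
apply: ler_wpDr; first exact: rnorm_ge0.
apply: ler_sum => j _; rewrite rnormM mulrC; apply: ler_pM; rewrite ?rnorm_ge0 //.
exact: coord_rnorm.
Qed.

Lemma Dreal_continuous U rho z v : open U -> smooth U rho -> U z ->
  forall e : R, 0 < e -> exists2 d : R, 0 < d & forall w u,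
    rnorm (w - z) < d -> rnorm (u - v) < d ->
    U w /\ `|Dreal rho u w - Dreal rho v z| < e.
Proof.
move=> oU sm Uz e e0; have [d1 [K [d10 K0 H1]]] := Dreal_bound oU sm Uz.
have e2 : 0 < e / 2 by rewrite divr_gt0.
have [d2 d20 H2] := continuous_real (smooth_continuous (smooth_Dreal v sm) Uz) e2.
have eK : 0 < e / 2 / K by rewrite divr_gt0.
exists (Num.min d1 (Num.min d2 (e / 2 / K))); first by rewrite !lt_min d10 d20.
move=> w u; rewrite !lt_min => /and3P[hw1 /H2 hw2 _] /and3P[_ _ hu].
have [Uw hb] := H1 w (u - v) hw1; split; first exact: Uw.
have lin := Dreal_linear (u - v) v 1 1 oU sm Uw.
rewrite rc1 !scale1r !mul1r subrK in lin.
rewrite lin -addrA; apply: le_lt_trans (ler_normD _ _) _.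
move: hu; rewrite ltr_pdivlMr // mulrC => hu.
rewrite (splitr e); apply: ltrD; first exact: le_lt_trans hu.
exact: hw2.
Qed.

(** Three further mean value steps bound the increments of the first derivatives in
    the directions [v] and [i v] by second derivatives, which are locally
    bounded. *)
Lemma second_order_bound U rho z v : open U -> smooth U rho -> U z ->
  exists d K : R, [/\ 0 < d, 0 < K & forall w (x y : R),
    rnorm (w - z) < d -> `|x| <= d -> `|y| <= d ->
    U (w + rc x *: v + rc y *: (ii *: v)) /\ (rho (w + rc x *: v + rc y *: (ii *: v)) <= rho w + x * Dreal rho v w
       + y * Dreal rho (ii *: v) w + K * (x ^+ 2 + y ^+ 2))%R].
Proof.
move=> oU sm Uz; set v' := ii *: v.
have [d1 d10 H1] := open_ball oU Uz.
have smv := smooth_Dreal v sm; have smv' := smooth_Dreal v' sm.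
have bnd a f : smooth U f -> exists d K : R, [/\ 0 < d, 0 < K &
    forall w, rnorm (w - z) < d -> `|Dreal f a w| <= K].
  move=> sf; have [d [K [d0 K0 H]]] := Dreal_bound oU sf Uz.
  exists d, (K * (rnorm a + 1)); split; [exact: d0|by rewrite mulr_gt0 // ltr_wpDl // rnorm_ge0|].
  move=> w hw; have [_ /le_trans] := H w a hw; apply; apply: ler_wpM2l; first exact: ltW.
  by rewrite lerDl.
have [d2 [K2 [d20 K20 H2]]] := bnd v _ smv.
have [d3 [K3 [d30 K30 H3]]] := bnd v _ smv'.
have [d4 [K4 [d40 K40 H4]]] := bnd v' _ smv'.
pose K := K2 + K3 + K4.
pose d' := Num.min (Num.min d1 d2) (Num.min d3 d4).
have d'0 : 0 < d' by rewrite !lt_min d10 d20 d30 d40.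
pose m := 2 + rnorm v + rnorm v'.
have m2 : 2 <= m by rewrite /m -addrA lerDl addr_ge0 // rnorm_ge0.
have m0 : 0 < m by lra.
exists (d' / 2 / m), (2 * K); split; [by rewrite !divr_gt0|by rewrite mulr_gt0 // !addr_gt0|].
move=> w x y hw hx hy.
have dm : d' / 2 / m <= d' / 2.
  by rewrite ler_pdivrMr // ler_peMr //; lra.
have near s t : `|s| <= `|x| -> `|t| <= `|y| ->
    rnorm (w + rc s *: v + rc t *: v' - z) < d'.
  move=> hs ht; apply: small_shift; first exact: lt_le_trans hw dm.
  have h1 : `|s| * rnorm v <= d' / 2 / m * rnorm v.
    by apply: ler_wpM2r; [exact: rnorm_ge0|exact: le_trans hs hx].
  have h2 : `|t| * rnorm v' <= d' / 2 / m * rnorm v'.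
    by apply: ler_wpM2r; [exact: rnorm_ge0|exact: le_trans ht hy].
  have : d' / 2 / m * m = d' / 2 by rewrite mulfVK // gt_eqF.
  have p : 0 < d' / 2 / m by rewrite !divr_gt0.
  rewrite {2}/m !mulrDr => h3; lra.
have near1 s : `|s| <= `|x| -> rnorm (w + rc s *: v - z) < d'.
  by move=> hs; have := near s 0 hs; rewrite normr0 line0; apply.
have n1 a : a < d' -> a < d1 by move/lt_le_trans; apply; rewrite !ge_min lexx.
have n2 a : a < d' -> a < d2 by move/lt_le_trans; apply; rewrite !ge_min lexx !orbT.
have n3 a : a < d' -> a < d3 by move/lt_le_trans; apply; rewrite !ge_min lexx !orbT.
have n4 a : a < d' -> a < d4 by move/lt_le_trans; apply; rewrite !ge_min lexx !orbT.
have [|c1 hc1 e1] := @line_mvt_abs U rho v w x sm.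
  by move=> s /near1/n1/H1.
have [|c2 hc2 e2] := @line_mvt_abs U rho v' (w + rc x *: v) y sm.
  by move=> s /(near x _ (lexx _))/n1/H1.
have [|c3 hc3 e3] := @line_mvt_abs U (Dreal rho v) v w c1 smv.
  by move=> s hs; apply: H1; apply: n1; apply: near1; exact: le_trans hs hc1.
have [|c4 hc4 e4] := @line_mvt_abs U (Dreal rho v') v w x smv'.
  by move=> s /near1/n1/H1.
have [|c5 hc5 e5] := @line_mvt_abs U (Dreal rho v') v' (w + rc x *: v) c2 smv'.
  move=> s hs; apply: H1; apply: n1; apply: near; first exact: lexx.
  exact: le_trans hs hc2.
have b3 : `|Dreal (Dreal rho v) v (w + rc c3 *: v)| <= K2.
  by apply: H2; apply: n2; apply: near1; exact: le_trans hc3 hc1.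
have b4 : `|Dreal (Dreal rho v') v (w + rc c4 *: v)| <= K3.
  by apply: H3; apply: n3; exact: near1.
have b5 : `|Dreal (Dreal rho v') v' (w + rc x *: v + rc c5 *: v')| <= K4.
  apply: H4; apply: n4; apply: near; first exact: lexx.
  exact: le_trans hc5 hc2.
split; first by apply: H1; apply: n1; apply: near; exact: lexx.
move: e1 e2 e3 e4 e5 b3 b4 b5.
move: (Dreal (Dreal rho v) v _) (Dreal (Dreal rho v') v _) (Dreal (Dreal rho v') v' _) => s3 s4 s5.
move: (Dreal rho v (w + _)) (Dreal rho v' (w + _ + rc c2 *: _)) (Dreal rho v' (w + _)) => D1 D3 D2.
move: (Dreal rho v w) (Dreal rho v' w) => A B.
move: (rho (w + rc x *: v + _)) (rho (w + _)) (rho w) => p2 p1 p0.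
clear -hc1 hc2 K20 K30 K40; rewrite -/K.
move=> e1 e2 e3 e4 e5 b3 b4 b5.
have prod (a b c a' c' : R) : `|b| <= a' -> `|c| <= c' -> a * b * c <= `|a| * a' * c'.
  move=> hb hc; apply: le_trans (ler_norm _) _; rewrite !normrM.
  by apply: ler_pM; rewrite ?mulr_ge0 //; apply: ler_pM.
have sq (a : R) : `|a| * `|a| = a ^+ 2 by rewrite -normrM ger0_norm // -expr2 sqr_ge0.
have h3 := prod x c1 s3 _ _ hc1 b3; have h5 := prod y c2 s5 _ _ hc2 b5.
have h4 := prod y x s4 _ _ (lexx _) b4.
rewrite sq in h3; rewrite sq in h5.
have xy : `|y| * `|x| <= x ^+ 2 + y ^+ 2.
  have := sqr_ge0 (`|x| - `|y|); rewrite sqrrB -!sq.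
  have := mulr_ge0 (normr_ge0 x) (normr_ge0 y); nra.
have h4' : `|y| * `|x| * K3 <= (x ^+ 2 + y ^+ 2) * K3 by apply: ler_wpM2r => //; exact: ltW.
have x0 := sqr_ge0 x; have y0 := sqr_ge0 y.
have t1 : 0 <= x ^+ 2 * (K3 + K4 + K4 + K2) by rewrite mulr_ge0 // !addr_ge0 // ltW.
have t2 : 0 <= y ^+ 2 * (K3 + K2 + K2 + K4) by rewrite mulr_ge0 // !addr_ge0 // ltW.
have -> : p2 = p0 + x * A + y * B + (x * c1 * s3 + y * x * s4 + y * c2 * s5).
  have -> : p2 = p0 + (p1 - p0) + (p2 - p1) by ring.
  have eD1 : D1 = A + c1 * s3 by rewrite -e3; ring.
  have eD3 : D3 = B + x * s4 + c2 * s5 by rewrite -e4 -e5; ring.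
  by rewrite e1 e2 eD1 eD3; ring.
rewrite lerD2l /K; move: h3 h4 h5 h4' t1 t2.
move: (x * c1 * s3) (y * x * s4) (y * c2 * s5) (`|y| * `|x| * K3) => u1 u2 u3 u4.
move: (x ^+ 2) (y ^+ 2) => X Y *; lra.
Qed.

End smooth_calculus.

(** * Supporting hyperplanes of a strongly convex domain *)

Section boundary_geometry.
Context {R : realType} {N : nat}.
Notation C := (Cplx R).
Notation V := (CN R N).
Implicit Types (U D : set V) (rho : V -> R) (z v w q x : V).

Lemma closure_rnorm D x : closure D x <-> forall e : R, 0 < e -> exists2 d, D d & rnorm (d - x) < e.
Proof.
split=> [h e e0|h B /rnbhsP[e e0 HB]].
  have [|d [Dd]] := h [set d | rnorm (d - x) < e]; first by apply/rnbhsP; exists e.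
  by exists d.
by have [d Dd hd] := h e e0; exists d; split => //; exact: HB.
Qed.

Lemma boundary_open D q : open D -> boundary D q -> closure D q /\ ~ D q.
Proof.
move=> oD [cq nq]; split => // Dq; apply: nq.
exact: (open_nbhs_nbhs (conj oD Dq)).
Qed.

(** [L] is the derivative at an intermediate point. *)
Lemma first_order U rho z u : open U -> smooth U rho -> U z ->
  forall e : R, 0 < e -> exists2 d : R, 0 < d & forall t : R, 0 < t < d ->
    U (z + rc t *: u) /\ exists2 L : R, `|L - Dreal rho u z| < e & rho (z + rc t *: u) = rho z + t * L.
Proof.
move=> oU sm Uz e e0; have [d1 d10 H1] := Dreal_continuous u oU sm Uz e0.
have m0 : 0 < rnorm u + 1 by rewrite ltr_wpDl // rnorm_ge0.
exists (d1 / (rnorm u + 1)); first by rewrite divr_gt0.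
move=> t /andP[t0 td].
have near s : 0 <= s <= t -> rnorm (z + rc s *: u - z) < d1.
  move=> /andP[s0 st]; rewrite addrC addKr rnormZ rnorm_rc ger0_norm //.
  move: td; rewrite ltr_pdivlMr //; apply: le_lt_trans.
  apply: ler_pM => //; first exact: rnorm_ge0.
  by rewrite lerDl.
have uu : rnorm (u - u) < d1 by rewrite subrr rnorm0.
have Us s : 0 <= s <= t -> U (z + rc s *: u).
  by move=> /near hs; have [h _] := H1 _ u hs uu; exact: h.
split; first by apply: Us; rewrite (ltW t0) lexx.
have [c /andP[c0 ct] e1] := line_mvt sm t0 Us.
exists (Dreal rho u (z + rc c *: u)).
  have hc : 0 <= c <= t by rewrite !ltW.
  by have [_ h] := H1 _ u (near c hc) uu; exact: h.
by rewrite -e1 subrKC.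
Qed.

Section defining_function.
Variables (D U : set V) (rho : V -> R) (q0 : V).
Hypotheses (oD : open D) (cD : convex_set D) (ldf : local_defining_function D q0 U rho).

Let oU : open U. Proof. by case: ldf. Qed.
Let sm : smooth U rho. Proof. by case: ldf. Qed.
Let DU z : U z -> (D z <-> rho z < 0). Proof. by case: ldf => _ _ _ h _; exact: h. Qed.

Lemma closure_defining z : closure D z -> U z -> rho z <= 0.
Proof.
move=> /closure_rnorm cz Uz; rewrite leNgt; apply/negP => rz.
have [d1 d10 H1] := continuous_real (smooth_continuous sm Uz) rz.
have [d2 d20 H2] := open_ball oU Uz.
have [|d Dd] := cz (Num.min d1 d2); first by rewrite lt_min d10.
rewrite lt_min => /andP[/H1 h1 /H2 Ud].
have := proj1 (DU Ud) Dd; move: h1; rewrite ltr_norml => /andP[h1 _].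
by move: h1; move: (rho d) (rho z) => a b *; lra.
Qed.

Lemma boundary_defining z : boundary D z -> U z -> rho z = 0.
Proof.
move=> bz Uz; have [cz nz] := boundary_open oD bz.
apply/eqP; rewrite eq_le (closure_defining cz Uz) leNgt; apply/negP => h.
by apply: nz; apply/(DU Uz).
Qed.

Lemma DrealN z u : U z -> Dreal rho (- u) z = - Dreal rho u z.
Proof.
move=> Uz; have h := Dreal_linear u 0 (-1) 0 oU sm Uz.
by rewrite mul0r addr0 mulN1r rcN rc1 scaleN1r rc0 scale0r addr0 in h.
Qed.

Lemma DrealZ z u (a : R) : U z -> Dreal rho (rc a *: u) z = a * Dreal rho u z.
Proof.
move=> Uz; have h := Dreal_linear u 0 a 0 oU sm Uz.
by rewrite mul0r addr0 rc0 scale0r addr0 in h.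
Qed.

Lemma transverse_direction z : U z -> exists v, 0 < Dreal rho v z.
Proof.
move=> Uz; have [_ _ _ _ /(_ z Uz)[v hv]] := ldf.
case: (ltgtP (Dreal rho v z) 0) hv => // h _; last by exists v.
by exists (- v); rewrite DrealN // oppr_gt0.
Qed.

(** The point is a convex combination of a point of [D] near [x] and of a point
    near [z], hence in [D]. *)
Lemma convex_closure_open (x z : V) (t : R) : closure D x -> D z -> 0 < t <= 1 ->
  D (x + rc t *: (z - x)).
Proof.
move=> /closure_rnorm cx Dz /andP[t0 t1].
have [e e0 He] := open_ball oD Dz.
have [d Dd hd] := cx (e * t) (mulr_gt0 e0 t0).
have -> : x + rc t *: (z - x) =
   rc t *: (z + rc ((1 - t) / t) *: (x - d)) + rc (1 - t) *: d.
  have TK : rc t * rc ((1 - t) / t) = 1 - rc t :> C.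
    by rewrite -rcM mulrCA divff ?gt_eqF // mulr1 rcB rc1.
  rewrite rcB rc1 [in RHS]scalerDr scalerA TK; move: (rc t) => T.
  by apply/rowP => i; rewrite !mxE; ring.
apply: convexP => //; last by rewrite ltW.
apply: He; rewrite addrC addKr rnormZ rnorm_rc rnormC.
have h0 : 0 <= (1 - t) / t by rewrite divr_ge0 ?subr_ge0 // ltW.
rewrite ger0_norm // mulrAC ltr_pdivrMr //; apply: le_lt_trans hd.
by rewrite -[leRHS]mul1r; apply: ler_wpM2r; [exact: rnorm_ge0|lra].
Qed.

Lemma convex_closure (x z : V) (t : R) : closure D x -> closure D z -> 0 <= t <= 1 ->
  closure D (x + rc t *: (z - x)).
Proof.
move=> /closure_rnorm cx /closure_rnorm cz t01; apply/closure_rnorm => e e0.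
have [a Da ha] := cx e e0; have [b Db hb] := cz e e0.
exists (rc t *: b + rc (1 - t) *: a); first exact: convexP.
have -> : rc t *: b + rc (1 - t) *: a - (x + rc t *: (z - x)) =
   rc t *: (b - z) + rc (1 - t) *: (a - x).
  rewrite rcB rc1 !scalerBr !scalerBl !scale1r; move: (rc t *: b) (rc t *: a) (rc t *: x) (rc t *: z).
  by move=> b' a' x' z'; apply/rowP => i; rewrite !mxE; ring.
apply: le_lt_trans (rnormD _ _) _; rewrite !rnormZ !rnorm_rc.
move: t01 => /andP[t0 t1]; rewrite !ger0_norm ?subr_ge0 //.
have m0 := rnorm_ge0 (b - z); have n0 := rnorm_ge0 (a - x).
move: ha hb m0 n0; move: (rnorm (b - z)) (rnorm (a - x)) => m n hn hm m0 n0.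
have [->|tn] := eqVneq t 0; first by rewrite mul0r add0r subr0 mul1r.
have tp : 0 < t by rewrite lt_def tn.
have h1 : t * m < t * e by rewrite ltr_pM2l.
have h2 : (1 - t) * n <= (1 - t) * e by apply: ler_wpM2l; lra.
lra.
Qed.

(** The segment from [q] to [z] lies in [D], so the derivative along it is at most 0
    at [q]; strictness holds because [z] may be moved inside the open set [D] in
    a direction along which the derivative is positive. *)
Lemma support_lt0 z q : closure D q -> U q -> rho q = 0 -> D z -> Dreal rho (z - q) q < 0.
Proof.
move=> cq Uq rq; have weak y : D y -> Dreal rho (y - q) q <= 0.
  move=> Dy; rewrite leNgt; apply/negP => L0.
  have [d d0 H] := first_order (y - q) oU sm Uq L0.
  pose t := Num.min (d / 2) 1.
  have t0 : 0 < t by rewrite lt_min divr_gt0 //=.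
  have td : t < d by apply: (@le_lt_trans _ _ (d / 2)); [rewrite ge_min lexx|lra].
  have t1 : t <= 1 by rewrite ge_min lexx orbT.
  have [|Ut [L hL e]] := H t; first by rewrite t0.
  have Dt : D (q + rc t *: (y - q)) by apply: convex_closure_open => //; rewrite t0.
  have := proj1 (DU Ut) Dt; rewrite e rq add0r => h.
  have L1 : 0 < L.
    by move: hL; rewrite ltr_norml => /andP[]; move: (Dreal _ _ _) => a *; lra.
  by have := mulr_gt0 t0 L1; rewrite ltNge (ltW h).
move=> Dz; have [v hv] := transverse_direction Uq.
have [e e0 He] := open_ball oD Dz.
have m0 : 0 < rnorm v + 1 by rewrite ltr_wpDl // rnorm_ge0.
pose t := e / (rnorm v + 1) / 2.
have t0 : 0 < t by rewrite !divr_gt0.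
have Dz' : D (z + rc t *: v).
  apply: He; rewrite addrC addKr rnormZ rnorm_rc ger0_norm ?ltW //.
  apply: (@le_lt_trans _ _ (t * (rnorm v + 1))).
    by apply: ler_wpM2l; [exact: ltW|rewrite lerDl].
  have -> : t * (rnorm v + 1) = e / 2 by rewrite /t mulrAC mulfVK // gt_eqF.
  by rewrite ltr_pdivrMr // ltr_pMr // ltr1n.
have := weak _ Dz'; have h := Dreal_linear (z - q) v 1 t oU sm Uq.
rewrite rc1 scale1r mul1r addrAC in h; rewrite h.
by move=> hh; apply: lt_le_trans hh; rewrite ltrDl; exact: mulr_gt0.
Qed.

(** If the derivative in the direction of [x] vanished, the positive Hessian would
    make [rho] positive near [q] on the segment from [q] to [x], which lies in the
    closure of [D]. *)
Lemma strict_support q x : boundary D q -> U q ->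
  (forall v, v != 0 -> Dreal rho v q = 0 -> 0 < Dreal (Dreal rho v) v q) ->
  closure D x -> x != q -> Dreal rho (x - q) q < 0.
Proof.
move=> bq Uq hess cx xq; have [cq _] := boundary_open oD bq.
have rq := boundary_defining bq Uq.
rewrite ltNge; apply/negP => L0.
have L1 : Dreal rho (x - q) q = 0.
  apply/eqP; rewrite eq_le L0 andbT leNgt; apply/negP => L1.
  have [d d0 H] := Dreal_continuous (x - q) oU sm Uq L1.
  have [y Dy hy] := proj1 (closure_rnorm D x) cx d d0.
  have [||_ h] := H q (y - q); first by rewrite subrr rnorm0.
    have -> : y - q - (x - q) = y - x by rewrite opprB addrA subrK.
    exact: hy.
  have := support_lt0 cq Uq rq Dy.
  by move: h; rewrite ltr_norml => /andP[h _]; move: h; move: (Dreal _ _ _) (Dreal _ _ _) => a b *; lra.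
have u0 : x - q != 0 by rewrite subr_eq0.
have H0 := hess _ u0 L1.
have [d d0 H] := first_order (x - q) oU (smooth_Dreal (x - q) sm) Uq H0.
have [d' d'0 H'] := first_order (x - q) oU sm Uq ltr01.
pose t := Num.min (Num.min (d / 2) (d' / 2)) 1.
have t0 : 0 < t by rewrite !lt_min !divr_gt0 //=.
have td : t < d by apply: (@le_lt_trans _ _ (d / 2)); [rewrite !ge_min lexx|lra].
have td' : t < d' by apply: (@le_lt_trans _ _ (d' / 2)); [rewrite !ge_min lexx !orbT|lra].
have t1 : t <= 1 by rewrite ge_min lexx orbT.
have Us s : 0 <= s <= t -> U (q + rc s *: (x - q)).
  move=> /andP[s0 st]; have [->|sn] := eqVneq s 0; first by rewrite line0.
  have [|h _] := H' s; last exact: h.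
  by rewrite lt_def sn s0 /=; apply: le_lt_trans td'.
have [c /andP[c0 ct] e] := line_mvt sm t0 Us.
have ct' : c <= t := ltW ct.
have [|_ [M hM eM]] := H c; first by rewrite c0 /=; exact: le_lt_trans td.
have Mp : 0 < M by move: hM; rewrite ltr_norml => /andP[]; move: (Dreal _ _ _) => a *; lra.
have cc : closure D (q + rc t *: (x - q)) by apply: convex_closure => //; rewrite ltW.
have tt : 0 <= t <= t by rewrite ltW //=.
have := closure_defining cc (Us t tt).
rewrite eM L1 add0r rq subr0 in e; rewrite e leNgt => /negP; apply.
by rewrite !mulr_gt0.
Qed.

End defining_function.
End boundary_geometry.

(** * Lower bounds near the boundary *)

Section boundary_estimates.
Context {R : realType} {N : nat}.
Notation C := (Cplx R).
Notation V := (CN R N).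
Implicit Types (U D : set V) (rho : V -> R) (z v w q x : V).

Lemma ln_mono (a b : R) : 0 < a -> a <= b -> ln a <= ln b.
Proof. by move=> a0 ab; rewrite ler_ln ?posrE //; exact: lt_le_trans ab. Qed.

Lemma ln_mono_mul (a b : R) : 0 < a -> 0 < b -> a <= 3 * b -> ln a <= ln 3 + ln b.
Proof. by move=> a0 b0 ab; rewrite -lnM ?posrE //; exact: ln_mono. Qed.

Lemma half_log_bound (p1 p2 p3 p4 p5 : R) : p1 <= p4 -> p5 <= p2 + p3 ->
  2^-1 * (p1 - p2) - 2^-1 * p3 <= 2^-1 * (p4 - p5).
Proof. by move=> h1 h2; lra. Qed.

Lemma half_log_ge (a b B : R) : b <= a - 2 * B -> B <= 2^-1 * (a - b).
Proof. by move=> h; lra. Qed.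

Section defining_function.
Variables (D U : set V) (rho : V -> R) (q0 : V).
Hypotheses (oD : open D) (cD : convex_set D) (ldf : local_defining_function D q0 U rho).

Let oU : open U. Proof. by case: ldf. Qed.
Let sm : smooth U rho. Proof. by case: ldf. Qed.
Let DU z : U z -> (D z <-> rho z < 0). Proof. by case: ldf => _ _ _ h _; exact: h. Qed.

(** Moving backwards along a transverse direction leads into [D]. *)
Lemma zero_closure z : U z -> rho z = 0 -> closure D z.
Proof.
move=> Uz rz; have [v hv] := transverse_direction ldf Uz.
have [d d0 H] := first_order (- v) oU sm Uz hv.
apply/closure_rnorm => e e0.
have m0 : 0 < rnorm v + 1 by rewrite ltr_wpDl // rnorm_ge0.
pose t := Num.min (d / 2) (e / (rnorm v + 1)).
have t0 : 0 < t by rewrite lt_min !divr_gt0.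
have td : t < d by apply: (@le_lt_trans _ _ (d / 2)); [rewrite ge_min lexx|lra].
have te : t <= e / (rnorm v + 1) by rewrite ge_min lexx orbT.
have [|Ut [L hL eL]] := H t; first by rewrite t0.
exists (z + rc t *: - v).
  apply/(DU Ut); rewrite eL rz add0r pmulr_rlt0 //.
  rewrite (DrealN ldf v Uz) opprK in hL.
  by move: hL hv; rewrite ltr_norml => /andP[_]; move: (Dreal _ _ _) => a *; lra.
rewrite addrC addKr rnormZ rnorm_rc rnormN ger0_norm ?ltW //.
move: te; rewrite ler_pdivlMr // => te; apply: lt_le_trans te.
by rewrite ltr_pM2l // ltrDl.
Qed.

(** The supporting functional is the real part of a holomorphic map of [D] to the
    right half-plane. *)
Lemma kobayashi_support q x w : closure D q -> U q -> rho q = 0 -> D x -> D w ->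
  2^-1 * (ln (- Dreal rho (x - q) q) - ln (- Dreal rho (w - q) q)) <= kobayashi D x w.
Proof.
move=> cq Uq rq Dx Dw; pose c := gradient rho q.
pose g z : C := - (covector c z - covector c q).
have gE z : complex.Re (g z) = - Dreal rho (z - q) q.
  by rewrite /g Re_opp -covectorB (Dreal_covector _ oU sm Uq).
have dg z : D z -> differentiable g z.
  move=> _; apply: differentiableN; apply: differentiableB; last exact: differentiable_cst.
  exact: differentiable_covector.
have g0 z : D z -> 0 < complex.Re (g z).
  by move=> Dz; rewrite gE oppr_gt0; exact: (support_lt0 oD cD ldf).
have h := kobayashi_halfplane (convex_joined oD cD Dx Dw) Dx Dw dg g0.
rewrite (gE x) (gE w) in h; exact: h.
Qed.

(** From [w] one moves in a transverse direction [v] until [rho] vanishes.  The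
    derivative along [v] stays between [a / 2] and [3 a / 2], where [a] is its value
    at [q]; the length of the way is thus at most [2 |rho w| / a], and the constant
    3 is the quotient of the two bounds. *)
Lemma exit_point q e : U q -> rho q = 0 -> 0 < e ->
  exists2 d : R, 0 < d & forall w, D w -> rnorm (w - q) < d ->
    U w /\ exists q', [/\ U q', rho q' = 0, rnorm (q' - q) < e,
      0 < - Dreal rho (w - q') q' & - Dreal rho (w - q') q' <= 3 * - rho w].
Proof.
move=> Uq rq e0; have [v hv] := transverse_direction ldf Uq.
set a := Dreal rho v q in hv.
have a2 : 0 < a / 2 by rewrite divr_gt0.
have [d1 d10 H1] := Dreal_continuous v oU sm Uq a2.
have vv : rnorm (v - v) < d1 by rewrite subrr rnorm0.
pose e1 := Num.min e d1.
have e10 : 0 < e1 by rewrite lt_min e0.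
have m0 : 0 < rnorm v + 1 by rewrite ltr_wpDl // rnorm_ge0.
have eta0 : 0 < e1 / 2 * (a / 2) / (rnorm v + 1) by rewrite !divr_gt0 // mulr_gt0 // divr_gt0.
have [d2 d20 H2] := continuous_real (smooth_continuous sm Uq) eta0.
exists (Num.min (e1 / 2) d2); first by rewrite lt_min d20 divr_gt0.
move=> w Dw; rewrite lt_min => /andP[hw /H2]; rewrite rq subr0 => hr.
have e1d : e1 <= d1 by rewrite ge_min lexx orbT.
have e1e : e1 <= e by rewrite ge_min lexx.
have Uw : U w.
  have h : rnorm (w - q) < d1 by apply: lt_le_trans hw _; lra.
  by have [hU _] := H1 w v h vv.
split; first exact: Uw.
have rw := proj1 (DU Uw) Dw.
rewrite (ltr0_norm rw) in hr.
pose s1 := - rho w / (a / 2).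
have s10 : 0 < s1 by rewrite divr_gt0 // oppr_gt0.
have s1v : s1 * (rnorm v + 1) < e1 / 2.
  by rewrite /s1 mulrAC ltr_pdivrMr // -ltr_pdivlMr.
have near s : 0 <= s <= s1 -> rnorm (w + rc s *: v - q) < e1.
  move=> /andP[s0 ss]; rewrite addrAC; apply: le_lt_trans (rnormD _ _) _.
  rewrite rnormZ rnorm_rc ger0_norm // (splitr e1); apply: ltrD => //.
  apply: le_lt_trans s1v; apply: ler_pM => //; first exact: rnorm_ge0.
  by rewrite lerDl.
have Us s : 0 <= s <= s1 -> U (w + rc s *: v).
  by move=> /near h; have [hU _] := H1 _ v (lt_le_trans h e1d) vv.
have Ds s : 0 <= s <= s1 -> a / 2 < Dreal rho v (w + rc s *: v) < a * (3 / 2).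
  move=> /near h; have [_] := H1 _ v (lt_le_trans h e1d) vv.
  rewrite -/a ltr_norml; move: (Dreal rho v (w + _)) => b /andP[? ?].
  by apply/andP; split; lra.
have top : 0 <= rho (w + rc s1 *: v).
  have [c /andP[c0 cs] /eqP] := line_mvt sm s10 Us.
  rewrite subr_eq => /eqP ->.
  have hc : 0 <= c <= s1 by rewrite !ltW.
  have /andP[h _] := Ds c hc.
  have : s1 * (a / 2) < s1 * Dreal rho v (w + rc c *: v) by rewrite ltr_pM2l.
  rewrite {1}/s1 mulfVK ?gt_eqF // => h1.
  by rewrite addrC -lerBlDl sub0r ltW.
(* [rho] is negative at time 0 and nonnegative at time [s1] *)
have [||c] := @IVT R (fun s => rho (w + rc s *: v)) 0 s1 0 (ltW s10).
- apply: derivable_within_continuous => s; rewrite in_itv /= => hs.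
  by have := line_is_derive sm (Us s hs) => -[].
- by rewrite line0 ge_min le_max (ltW rw) top orbT.
rewrite in_itv /= => /andP[c0 cs] rc0'.
have cp : 0 < c.
  by rewrite lt_def c0 andbT; apply/eqP => c00; move: rc0'; rewrite c00 line0 => h; rewrite h ltxx in rw.
have hc : 0 <= c <= s1 by rewrite c0.
have Uq' := Us c hc.
have dE : - Dreal rho (w - (w + rc c *: v)) (w + rc c *: v) = c * Dreal rho v (w + rc c *: v).
  have -> : w - (w + rc c *: v) = - (rc c *: v) by rewrite opprD addrA subrr add0r.
  by rewrite (DrealN ldf _ Uq') opprK (DrealZ ldf _ _ Uq').
exists (w + rc c *: v); split.
- exact: Uq'.
- exact: rc0'.
- exact: lt_le_trans (near c hc) e1e.
- rewrite dE; apply: mulr_gt0 => //; have /andP[h _] := Ds c hc; exact: lt_trans h.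
rewrite dE; have /andP[h1 h2] := Ds c hc.
have -> : 3 * - rho w = s1 * (a * (3 / 2)).
  by rewrite /s1; have an : a != 0 by [rewrite gt_eqF]; field.
apply: ler_pM => //; last exact: ltW.
by apply: ltW; apply: lt_trans h1.
Qed.

(** [kobayashi_support] at the exit point of [w]: the support function there is at
    most [3 |rho w|] at [w], and bounded below near [x] by strict support at
    [q]. *)
Lemma kobayashi_lower q x : boundary D q -> U q ->
  (forall v, v != 0 -> Dreal rho v q = 0 -> 0 < Dreal (Dreal rho v) v q) ->
  closure D x -> x != q -> exists d B : R, 0 < d /\ forall x' w, D x' -> D w ->
    rnorm (x' - x) < d -> rnorm (w - q) < d ->
    B - 2^-1 * ln (- rho w) <= kobayashi D x' w.
Proof.
move=> bq Uq hess cx xq; have rq := boundary_defining oD ldf bq Uq.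
have L0 := strict_support oD cD ldf bq Uq hess cx xq.
set L := Dreal rho (x - q) q in L0.
have c0 : 0 < - L / 2 by rewrite divr_gt0 // oppr_gt0.
have [d1 d10 H1] := Dreal_continuous (x - q) oU sm Uq c0.
have d12 : 0 < d1 / 2 by rewrite divr_gt0.
have [d2 d20 H2] := exit_point Uq rq d12.
exists (Num.min (d1 / 2) d2), (2^-1 * (ln (- L / 2) - ln 3)); split; first by rewrite lt_min d12.
move=> x' w Dx' Dw; rewrite !lt_min => /andP[hx _] /andP[_ hw].
have [Uw [q' [Uq' rq' hq' k1 k2]]] := H2 w Dw hw.
have rw := proj1 (DU Uw) Dw.
have := kobayashi_support (zero_closure Uq' rq') Uq' rq' Dx' Dw.
apply: le_trans.
have g1 : - L / 2 <= - Dreal rho (x' - q') q'.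
  have h1 : rnorm (q' - q) < d1 by lra.
  have h2 : rnorm (x' - q' - (x - q)) < d1.
    have -> : x' - q' - (x - q) = (x' - x) - (q' - q) by rewrite !opprD !opprK addrACA.
    by apply: le_lt_trans (rnormB _ _) _; lra.
  have [_] := H1 _ _ h1 h2; rewrite -/L ltr_norml => /andP[_].
  by move: (Dreal _ _ _) => b ?; lra.
have l1 := ln_mono c0 g1.
have rw' : 0 < - rho w by rewrite oppr_gt0.
have l2 := ln_mono_mul k1 rw' k2.
have h := half_log_bound l1 l2; exact: h.
Qed.

(** The supporting functional at [q] tends to 0 there. *)
Lemma kobayashi_proper q z0 : boundary D q -> U q -> D z0 ->
  forall B : R, exists2 d : R, 0 < d & forall z, D z -> rnorm (z - q) < d -> B <= kobayashi D z0 z.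
Proof.
move=> bq Uq Dz0 B; have rq := boundary_defining oD ldf bq Uq.
have [cq _] := boundary_open oD bq.
have [d1 [K [d10 K0 H1]]] := Dreal_bound oU sm Uq.
have [d d0 H] : exists2 d : R, 0 < d & forall z, rnorm (z - q) < d ->
   - Dreal rho (z - q) q <= expR (ln (- Dreal rho (z0 - q) q) - 2 * B).
  set E := expR _; have E0 : 0 < E by exact: expR_gt0.
  exists (E / K); first by rewrite divr_gt0.
  move=> z; rewrite ltr_pdivlMr // mulrC => hz.
  have qq : rnorm (q - q) < d1 by rewrite subrr rnorm0.
  have [_ h] := H1 q (z - q) qq; apply: le_trans (ltW hz).
  by apply: le_trans h; rewrite -normrN ler_norm.
exists d => // z Dz /H hz.
have := kobayashi_support cq Uq rq Dz0 Dz; apply: le_trans.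
have gz : 0 < - Dreal rho (z - q) q by rewrite oppr_gt0; exact: (support_lt0 oD cD ldf).
have h := ln_mono gz hz; rewrite expRK in h.
have h' := half_log_ge h; exact: h'.
Qed.

End defining_function.
End boundary_estimates.

(** * Upper bounds near the boundary *)

Section upper_bound.
Context {R : realType} {N : nat}.
Notation C := (Cplx R).
Notation V := (CN R N).
Implicit Types (U D : set V) (rho : V -> R) (z v w q x : V).

(** [A] and [B] are the derivatives of [rho] in the directions [v] and [i v], and
    [- h] is its value.  The disc is centred at [- r (A + i B)] and its squared
    radius exceeds that of the disc through the origin by [2 r h].  On it the linear
    part, computed by completing the square, outweighs the quadratic error as soon
    as [2 r K <= 1]. *)
Lemma inscribed_disc_lt (r A B K h c1 c2 : R) : 0 < r -> 2 * r * K <= 1 ->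
  c1 ^+ 2 + c2 ^+ 2 < r ^+ 2 * (A ^+ 2 + B ^+ 2) + 2 * r * h ->
  - h + (- (r * A) + c1) * A + (- (r * B) + c2) * B
    + K * ((- (r * A) + c1) ^+ 2 + (- (r * B) + c2) ^+ 2) < 0.
Proof.
move=> r0 rK hc.
set S := _ ^+ 2 + _ ^+ 2.
have S0 : 0 <= S by rewrite addr_ge0 ?sqr_ge0.
have SE : S = r ^+ 2 * (A ^+ 2 + B ^+ 2) - 2 * r * (A * c1 + B * c2) + (c1 ^+ 2 + c2 ^+ 2).
  by rewrite /S; ring.
have h1 : 2 * r * K * S <= S by rewrite ler_piMl.
rewrite -(@pmulr_rlt0 _ (2 * r)); last by rewrite mulr_gt0.
have -> : 2 * r * (- h + (- (r * A) + c1) * A + (- (r * B) + c2) * B + K * S) =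
  - (2 * r * h) - 2 * (r ^+ 2 * (A ^+ 2 + B ^+ 2)) + 2 * r * (A * c1 + B * c2) + 2 * r * K * S.
  by ring.
move: h1 SE hc; move: (2 * r * K * S) => u1.
move: (2 * r * (A * c1 + B * c2)) (2 * r * h) (c1 ^+ 2 + c2 ^+ 2) => u5 u4 u3.
move: (r ^+ 2 * (A ^+ 2 + B ^+ 2)) => u2.
by clear; move: S => S *; lra.
Qed.

Lemma ii_scale_point w v (x y : R) : w + rc x *: v + rc y *: (ii *: v) = w + (rc x + ii * rc y) *: v.
Proof. by rewrite scalerA -addrA -scalerDl [rc y * _]mulrC. Qed.

Lemma rnorm_lt_unit (z : C) : rnorm z ^+ 2 < 1 -> rnorm z < 1.
Proof.
move=> h; rewrite ltNge; apply/negP => z1; move: h; rewrite ltNge => /negP; apply.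
by rewrite exprn_ege1.
Qed.

Lemma poincare0_le (b : C) : rnorm b < 1 ->
  poincare 0 b <= 2^-1 * ln (4 / (1 - rnorm b ^+ 2)).
Proof.
move=> b1; rewrite poincareE.
have -> : rnorm (moebius 0 b) = rnorm b.
  have c0 : cj (0 : C) = 0 by rewrite /cj; exact: conjc0.
  by rewrite /moebius sub0r c0 mul0r subr0 divr1 rnormN.
have b0 := rnorm_ge0 b; move: (rnorm b) b0 b1 => m m0 m1.
apply: ler_wpM2l; first by rewrite invr_ge0.
have m1' : 0 < 1 - m by rewrite subr_gt0.
have m2 : 0 < 1 + m by lra.
have m3 : 0 < 1 - m ^+ 2 by rewrite subr_gt0 expr_lt1.
apply: ln_mono; first by rewrite divr_gt0.
rewrite ler_pdivrMr // mulrAC ler_pdivlMr //.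
have -> : 1 - m ^+ 2 = (1 + m) * (1 - m) by ring.
rewrite mulrA; apply: ler_wpM2r; first exact: ltW.
by nra.
Qed.

Section defining_function.
Variables (D U : set V) (rho : V -> R) (q0 : V).
Hypotheses (oD : open D) (cD : convex_set D) (ldf : local_defining_function D q0 U rho).

Let oU : open U. Proof. by case: ldf. Qed.
Let sm : smooth U rho. Proof. by case: ldf. Qed.
Let DU z : U z -> (D z <-> rho z < 0). Proof. by case: ldf => _ _ _ h _; exact: h. Qed.

(** The Poincare distance from the centre of the disc of [inscribed_disc_lt] to the
    point [w]. *)
Lemma inscribed_disc (v w : V) (d K r A B : R) : D w -> U w ->
  0 < d -> 0 < r -> 2 * r * K <= 1 ->
  (forall x y : R, `|x| <= d -> `|y| <= d -> U (w + rc x *: v + rc y *: (ii *: v)) /\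
     (rho (w + rc x *: v + rc y *: (ii *: v)) <= rho w + x * A + y * B + K * (x ^+ 2 + y ^+ 2))%R) ->
  0 < A ^+ 2 + B ^+ 2 -> r * `|A| <= d / 4 -> r * `|B| <= d / 4 ->
  2 * r * - rho w <= d ^+ 2 / 16 ->
  [/\ D (w - rc (r * A) *: v - rc (r * B) *: (ii *: v)),
     joined D (w - rc (r * A) *: v - rc (r * B) *: (ii *: v)) w &
     kobayashi D (w - rc (r * A) *: v - rc (r * B) *: (ii *: v)) w <=
     2^-1 * (ln (d ^+ 2 / r) - ln (- rho w))].
Proof.
move=> Dw Uw d0 r0 rK H n0 rA rB hh.
have rw := proj1 (DU Uw) Dw; have h0 : 0 < - rho w by rewrite oppr_gt0.
set n := A ^+ 2 + B ^+ 2 in n0.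
pose Q := r ^+ 2 * n + 2 * r * - rho w.
have Q0 : 0 < Q by rewrite addr_gt0 // ?mulr_gt0 // ?exprn_gt0 // mulr_gt0.
pose S := Num.sqrt Q.
have S2 : S ^+ 2 = Q by rewrite sqr_sqrtr // ltW.
have S0 : 0 < S by rewrite sqrtr_gt0.
have Sn : S != 0 by rewrite gt_eqF.
have sq4 (a : R) : r * `|a| <= d / 4 -> r ^+ 2 * a ^+ 2 <= d ^+ 2 / 16.
  move=> ha; have -> : d ^+ 2 / 16 = (d / 4) ^+ 2 by field.
  rewrite -exprMn -(ger0_norm (sqr_ge0 (r * a))) normrX normrM (ger0_norm (ltW r0)).
  rewrite ler_pXn2r // nnegrE; [by rewrite mulr_ge0 // ltW|by rewrite divr_ge0 // ltW].
have Qd : Q <= d ^+ 2 / 4.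
  have := sq4 _ rA; have := sq4 _ rB; have d2 := sqr_ge0 d; rewrite /Q /n mulrDr.
  move: hh; move: (r ^+ 2 * A ^+ 2) (r ^+ 2 * B ^+ 2) (2 * r * _) (d ^+ 2) d2 => *; lra.
have Sd : S <= d / 2.
  rewrite -(@ler_pXn2r _ 2) ?nnegrE ?divr_ge0 ?(ltW d0) ?(ltW S0) //.
  by rewrite S2 (_ : (d / 2) ^+ 2 = d ^+ 2 / 4); [exact: Qd|field].
pose zeta (c : C) : C := rc (- (r * A)) + ii * rc (- (r * B)) + rc S * c.
pose g (c : C) : V := w + zeta c *: v.
have gE (c : C) : g c = w + rc (- (r * A) + S * complex.Re c) *: v
      + rc (- (r * B) + S * complex.Im c) *: (ii *: v).
  rewrite ii_scale_point /g; congr (_ + _ *: _).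
  rewrite /zeta {1}(complex_split c); move: (complex.Re c) (complex.Im c) => a b.
  by rewrite !rcD !rcM; ring.
have gD c : unit_disc c -> D (g c).
  move=> /unit_discE c1; rewrite gE.
  have bd (a k : R) : r * `|a| <= d / 4 -> `|k| <= 1 -> `|- (r * a) + S * k| <= d.
    move=> ha hk; apply: le_trans (ler_normD _ _) _; rewrite normrN !normrM.
    rewrite (ger0_norm (ltW r0)) (ger0_norm (ltW S0)).
    have : S * `|k| <= S by rewrite ler_piMr // ltW.
    by move: ha; move: (r * `|a|) (S * `|k|) => a' b' ? ?; lra.
  have cR : `|complex.Re c| <= 1 by apply: le_trans (Re_le c) _; exact: ltW.
  have cI : `|complex.Im c| <= 1 by apply: le_trans (Im_le c) _; exact: ltW.
  have [Ug hg] := H _ _ (bd _ _ rA cR) (bd _ _ rB cI).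
  apply/(DU Ug); apply: le_lt_trans hg _.
  have := @inscribed_disc_lt r A B K (- rho w) (S * complex.Re c) (S * complex.Im c) r0 rK.
  rewrite opprK; apply.
  rewrite !exprMn -mulrDr -rnorm_sqr S2 -/n -/Q gtr_pMr //.
  by rewrite expr_lt1 // rnorm_ge0.
have dg c : differentiable g c.
  rewrite (_ : g = (fun c => (w + (rc (- (r * A)) + ii * rc (- (r * B))) *: v) + c *: (rc S *: v))).
    exact: differentiable_line.
  by apply/funext => u; rewrite /g /zeta scalerDl addrA scalerA [rc S * u]mulrC.
pose b : C := rc (r * A / S) + ii * rc (r * B / S).
have b2 : rnorm b ^+ 2 = r ^+ 2 * n / Q.
  by rewrite rnorm_sqr /b Re_add Im_add Re_ii Im_ii /= oppr0 addr0 add0r -S2 /n; field.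
have b1 : rnorm b < 1.
  apply: rnorm_lt_unit; rewrite b2 ltr_pdivrMr // mul1r /Q ltrDl.
  by rewrite !mulr_gt0.
have g0 : g 0 = w - rc (r * A) *: v - rc (r * B) *: (ii *: v).
  by rewrite gE /= !mulr0 !addr0 !rcN !scaleNr.
have gb : g b = w.
  have zb : zeta b = 0.
    have e1 : rc S * rc (r * A / S) = rc (r * A) :> C by rewrite -rcM; congr rc; field.
    have e2 : rc S * rc (r * B / S) = rc (r * B) :> C by rewrite -rcM; congr rc; field.
    by rewrite /zeta /b mulrDr e1 mulrCA e2 !rcN; ring.
  by rewrite /g zb scale0r addr0.
have ch : disc_chain D (g 0) w (poincare 0 b + 0).
  apply: (@chain_disc R N D g 0 b (g 0) w w 0) => //.
  - exact: disc0.
  - by apply/unit_discE.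
  exact: disc_chain_nil.
rewrite -g0; split.
- by apply: gD; exact: disc0.
- by exists (poincare 0 b + 0).
apply: le_trans (kobayashi_le ch) _; rewrite addr0.
apply: le_trans (poincare0_le b1) _; apply: ler_wpM2l; first by rewrite invr_ge0.
have dr : 0 < d ^+ 2 / r by rewrite divr_gt0 // exprn_gt0.
rewrite -ln_div ?posrE //; apply: ln_mono.
  by rewrite divr_gt0 // subr_gt0 expr_lt1 // rnorm_ge0.
have -> : 1 - rnorm b ^+ 2 = 2 * r * - rho w / Q.
  by rewrite b2 /Q; have Qn : Q != 0 by [rewrite gt_eqF]; move: Qn; rewrite /Q => Qn; field.
have -> : 4 / (2 * r * - rho w / Q) = 2 * Q / r / - rho w.
  by have rn : r != 0 by [rewrite gt_eqF]; have hn : rho w != 0 by [rewrite lt_eqF]; field; rewrite rn hn gt_eqF.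
apply: ler_wpM2r; first by rewrite invr_ge0 ltW.
apply: ler_wpM2r; first by rewrite invr_ge0 ltW.
have := sqr_ge0 d; move: (d ^+ 2) Qd => d2 *; lra.
Qed.

End defining_function.
End upper_bound.

(** * Separation of points of the closure *)

Section separation.
Context {R : realType} {N : nat}.
Notation C := (Cplx R).
Notation V := (CN R N).
Implicit Types (U D : set V) (rho : V -> R) (z v w q : V).

Lemma pos_close (a b : R) : 0 < b -> `|a - b| < b / 2 -> 0 < a.
Proof. by move=> b0; rewrite ltr_norml => /andP[h _]; lra. Qed.

Lemma rnorm_add3 (a b c : V) (e : R) : rnorm a < e / 3 -> rnorm b < e / 3 ->
  rnorm c < e / 3 -> rnorm (a + (b + c)) < e.
Proof.
move=> ha hb hc; have h1 := rnormD a (b + c); have h2 := rnormD b c.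
move: ha hb hc h1 h2; move: (rnorm a) (rnorm b) (rnorm c) (rnorm (b + c)) (rnorm _) => *; lra.
Qed.

Lemma point_opp (w u v : V) (a b : R) :
  w - rc a *: u - rc b *: v = w + rc (- a) *: u + rc (- b) *: v.
Proof. by rewrite !rcN !scaleNr. Qed.

Lemma point_sub (w q u v : V) (r a b a' b' : R) :
  w + rc (- (r * a)) *: u + rc (- (r * b)) *: v - (q + rc (- (r * a')) *: u + rc (- (r * b')) *: v)
  = (w - q) + (rc (r * (a' - a)) *: u + rc (r * (b' - b)) *: v).
Proof.
rewrite !mulrBr !rcB !rcN; move: (rc _) (rc _) (rc _) (rc _) => k1 k2 k3 k4.
by apply/rowP => i; rewrite !mxE; ring.
Qed.

(** The centres of the inscribed discs converge to the centre [yq] of the disc at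
    [q], a point of [D], near which the distance from [z0] is bounded. *)
Lemma kobayashi_upper D U rho q0 q z0 : open D -> convex_set D ->
  local_defining_function D q0 U rho -> boundary D q -> U q -> D z0 ->
  exists d B : R, 0 < d /\ forall w, D w -> rnorm (w - q) < d ->
    U w /\ kobayashi D z0 w <= B - 2^-1 * ln (- rho w).
Proof.
move=> oD cD ldf bq Uq Dz0; have [oU _ sm DU _] := ldf.
have rq := boundary_defining oD ldf bq Uq.
have [v hv] := transverse_direction ldf Uq.
have [d [K [d0 K0 H]]] := second_order_bound v oU sm Uq.
pose A w := Dreal rho v w; pose B w := Dreal rho (ii *: v) w.
have A0 : 0 < A q := hv.
pose M := `|A q| + `|B q| + 1.
have M0 : 0 < M by rewrite ltr_wpDl // addr_ge0.
pose r := Num.min ((2 * K)^-1) (d / 4 / M).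
have r0 : 0 < r by rewrite lt_min !divr_gt0 // invr_gt0 mulr_gt0.
have rK : 2 * r * K <= 1.
  have h : r <= (2 * K)^-1 by rewrite ge_min lexx.
  have K2 : 0 < 2 * K by rewrite mulr_gt0.
  have := ler_wpM2r (ltW K2) h; rewrite mulVf ?gt_eqF //.
  by rewrite mulrCA mulrA.
have rM a : a <= M -> r * a <= d / 4.
  move=> aM; have h : r <= d / 4 / M by rewrite ge_min lexx orbT.
  apply: (@le_trans _ _ (r * M)); first by rewrite ler_pM2l.
  by rewrite -ler_pdivlMr.
have qq : rnorm (q - q) < d by rewrite subrr rnorm0.
have d4 (a : R) : r * `|a| <= d / 4 -> `|- (r * a)| <= d.
  rewrite normrN normrM (ger0_norm (ltW r0)) => /le_trans; apply; lra.
have AqM : `|A q| <= M by rewrite /M -addrA lerDl addr_ge0.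
have BqM : `|B q| <= M by rewrite /M addrAC lerDr addr_ge0.
pose yq := q + rc (- (r * A q)) *: v + rc (- (r * B q)) *: (ii *: v).
have Dyq : D yq.
  have [Uy hy] := H q _ _ qq (d4 _ (rM _ AqM)) (d4 _ (rM _ BqM)).
  apply/(DU _ Uy); apply: le_lt_trans hy _; rewrite rq -/(A q) -/(B q).
  have n0 : 0 < A q ^+ 2 + B q ^+ 2 by rewrite ltr_wpDr ?sqr_ge0 // exprn_gt0.
  have := @inscribed_disc_lt R r (A q) (B q) K 0 0 0 r0 rK.
  rewrite oppr0 !addr0 !mulr0 !addr0 expr0n /= addr0; apply.
  by rewrite mulr_gt0 // exprn_gt0.
have [e [Bz [e0 Hz]]] := kobayashi_locally_bounded oD cD Dz0 Dyq.
have m0 : 0 < rnorm v + 1 by rewrite ltr_wpDl // rnorm_ge0.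
(* keeps [A w] positive, [A w] and [B w] below [M], and the centre near [yq] *)
pose eta := Num.min (Num.min 1 (A q / 2)) (e / 3 / (r * (rnorm v + 1))).
have eta0 : 0 < eta by rewrite !lt_min ltr01 !divr_gt0 // mulr_gt0.
have [dA dA0 HA] := continuous_real (smooth_continuous (smooth_Dreal v sm) Uq) eta0.
have [dB dB0 HB] := continuous_real (smooth_continuous (smooth_Dreal (ii *: v) sm) Uq) eta0.
have h160 : 0 < d ^+ 2 / 16 / (2 * r) by rewrite !divr_gt0 ?exprn_gt0 // mulr_gt0.
have [dr dr0 Hr] := continuous_real (smooth_continuous sm Uq) h160.
have [dU dU0 HU] := open_ball oU Uq.
exists (Num.min (Num.min (Num.min dA dB) (Num.min dr dU)) (Num.min d (e / 3))).
exists (Bz + 2^-1 * ln (d ^+ 2 / r)); split.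
  by rewrite !lt_min dA0 dB0 dr0 dU0 d0 divr_gt0.
move=> w Dw; rewrite !lt_min => /andP[/andP[/andP[/HA hA /HB hB] /andP[/Hr hr /HU Uw]] /andP[wd we]].
split; first exact: Uw.
rewrite -/(A w) -/(A q) in hA; rewrite -/(B w) -/(B q) in hB.
have rw := proj1 (DU _ Uw) Dw; rewrite rq subr0 (ltr0_norm rw) in hr.
have et1 : eta <= 1 by rewrite !ge_min lexx.
have etA : eta <= A q / 2 by rewrite !ge_min lexx !orbT.
have ete : eta <= e / 3 / (r * (rnorm v + 1)) by rewrite !ge_min lexx !orbT.
have close (a b : R) : `|a - b| < eta -> `|b| + 1 <= M -> `|a| <= M.
  move=> ab; apply: le_trans; rewrite -(subrK b a); apply: le_trans (ler_normD _ _) _.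
  by rewrite addrC lerD2l; exact: le_trans (ltW ab) et1.
have AM : `|A w| <= M by apply: close hA _; rewrite /M lerD2r lerDl.
have BM : `|B w| <= M by apply: close hB _; rewrite /M lerD2r lerDr.
have Aw : 0 < A w.
  exact: pos_close A0 (lt_le_trans hA etA).
have n0 : 0 < A w ^+ 2 + B w ^+ 2 by rewrite ltr_wpDr ?sqr_ge0 // exprn_gt0.
have Hw (x y : R) : `|x| <= d -> `|y| <= d -> U (w + rc x *: v + rc y *: (ii *: v)) /\
     (rho (w + rc x *: v + rc y *: (ii *: v)) <= rho w + x * A w + y * B w + K * (x ^+ 2 + y ^+ 2))%R.
  by move=> hx hy; have h := H w x y wd hx hy; exact: h.
have hh : 2 * r * - rho w <= d ^+ 2 / 16.
  by rewrite mulrC -ler_pdivlMr ?mulr_gt0 // ltW.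
have [Dy jy ky] := inscribed_disc ldf Dw Uw d0 r0 rK Hw n0 (rM _ AM) (rM _ BM) hh.
set y := w - _ - _ in Dy jy ky.
have hy : rnorm (y - yq) < e.
  rewrite /y point_opp point_sub.
  have iv : rnorm (ii *: v) = rnorm v by rewrite rnormZ rnorm_ii mul1r.
  have bd (a b : R) (u : V) : rnorm u = rnorm v -> `|b - a| < eta -> rnorm (rc (r * (a - b)) *: u) < e / 3.
    move=> hu hab; rewrite rnormZ rnorm_rc normrM (ger0_norm (ltW r0)) distrC hu.
    apply: (@le_lt_trans _ _ (`|b - a| * (r * (rnorm v + 1)))).
      rewrite [leLHS](_ : _ = `|b - a| * (r * rnorm v)); last by ring.
      by apply: ler_wpM2l => //; rewrite ler_pM2l // lerDl.
    by rewrite -ltr_pdivlMr ?mulr_gt0 //; exact: lt_le_trans ete.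
  have h1 := bd _ _ v erefl hA; have h2 := bd _ _ (ii *: v) iv hB.
  have h := rnorm_add3 we h1 h2; exact: h.
have [_ jz kz] := Hz y hy.
apply: le_trans (kobayashi_triangle jz jy) _.
by rewrite -addrA; apply: lerD => //; rewrite -mulrBr.
Qed.

(** The terms [1/2 ln (- rho w)] of the lower and the upper bound cancel. *)
Theorem kobayashi_separation D q z0 x : open D -> strongly_convex D ->
  boundary D q -> D z0 -> closure D x -> x != q ->
  exists d B : R, 0 < d /\ forall x' w, D x' -> D w -> rnorm (x' - x) < d ->
    rnorm (w - q) < d -> B <= kobayashi D x' w - kobayashi D z0 w.
Proof.
move=> oD [cD sc] bq Dz0 cx xq; have [U [rho [ldf hess]]] := sc q bq.
have Uq : U q by case: ldf.
have [d1 [B1 [d10 H1]]] := kobayashi_lower oD cD ldf bq Uq hess cx xq.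
have [d2 [B2 [d20 H2]]] := kobayashi_upper oD cD ldf bq Uq Dz0.
exists (Num.min d1 d2), (B1 - B2); split; first by rewrite lt_min d10.
move=> x' w Dx' Dw; rewrite !lt_min => /andP[hx _] /andP[hw1 hw2].
have l1 := H1 x' w Dx' Dw hx hw1; have [_ l2] := H2 w Dw hw2.
move: l1 l2; move: (kobayashi D x' w) (kobayashi D z0 w) (2^-1 * _) => a b c *; lra.
Qed.

Theorem kobayashi_boundary D p z0 : open D -> strongly_convex D ->
  boundary D p -> D z0 -> forall B : R, exists2 d : R, 0 < d &
    forall z, D z -> rnorm (z - p) < d -> B <= kobayashi D z0 z.
Proof.
move=> oD [cD sc] bp Dz0; have [U [rho [ldf hess]]] := sc p bp.
have Up : U p by case: ldf.
exact: (kobayashi_proper oD cD ldf bp Up Dz0).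
Qed.
End separation.

(** * Julia's lemma and K-limits *)

Section julia.
Context {R : realType} {N : nat}.
Notation C := (Cplx R).
Notation V := (CN R N).
Implicit Types (D : set V) (p q z w x : V) (f : V -> V).

Lemma bounded_rnorm D : bounded_set D -> exists M : R, forall v, D v -> rnorm v <= M.
Proof.
move=> [M0 [M0r H]]; exists (complex.Re M0 + 1) => v Dv.
have /complex_realP [k kE] := M0r.
have := H (rc (k + 1)); rewrite kE -/(rc k) rc_lt ltrDl ltr01 => /(_ isT v Dv).
by rewrite /= rnormE rc_le.
Qed.

Lemma closure_compact D : bounded_set D -> compact (closure D).
Proof.
move=> /bounded_rnorm [M HM]; apply: (@complex_bounded_closed_compact R N _ M).
  exact: closed_closure.
move=> v /closure_rnorm cv; apply/ler_addgt0Pr => e e0.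
have [d Dd hd] := cv e e0; have h1 := HM d Dd.
rewrite -(subrK d v); apply: le_trans (rnormD _ _) _; rewrite rnormC addrC; lra.
Qed.

(** The cluster point of the filter generated by the sets [P d]. *)
Lemma compact_accumulation (K : set V) (P : R -> set V) : compact K ->
  (forall d : R, 0 < d -> P d `<=` K) ->
  (forall d d' : R, 0 < d -> d <= d' -> P d `<=` P d') ->
  (forall d : R, 0 < d -> P d !=set0) ->
  exists2 x, K x & forall d : R, 0 < d -> exists2 s, P d s & rnorm (s - x) < d.
Proof.
move=> cK PK mono ne.
pose F := filter_from [set d : R | 0 < d] P.
have FF : Filter F.
  apply: filter_from_filter; first by exists 1; exact: ltr01.
  move=> i j /= i0 j0; exists (Num.min i j); first by rewrite /= lt_min i0.
  have m0 : 0 < Num.min i j by rewrite lt_min i0.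
  by move=> v Pv; split; apply: (mono _ _ m0) Pv; rewrite ge_min lexx ?orbT.
have PF : ProperFilter F by apply: filter_from_proper.
have FK : F K by exists 1; [exact: ltr01|apply: PK; exact: ltr01].
have [x [Kx clx]] := cK F PF FK; exists x => // d d0.
have FPd : F (P d) by exists d.
have nb : nbhs x [set s | rnorm (s - x) < d] by apply/rnbhsP; exists d.
by have [s [Ps hs]] := clx _ _ FPd nb; exists s.
Qed.

(** The point [q] is a limit of values [f w] for [w] tending to [p] along which the
    defining expression of the dilation coefficient stays bounded by [A]. *)
Definition julia_pair D z0 f p q (A : R) : Prop :=
  forall d : R, 0 < d -> exists w, [/\ D w, rnorm (w - p) < d, rnorm (f w - q) < d &
    kobayashi D z0 w - kobayashi D z0 (f w) <= A].

Definition bounded_dilation D z0 f p (A : R) : Prop :=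
  forall d : R, 0 < d -> exists w, [/\ D w, rnorm (w - p) < d &
    kobayashi D z0 w - kobayashi D z0 (f w) <= A].

Lemma dilation_bounded D z0 f p : (dilation D z0 f p < +oo)%E ->
  exists A, bounded_dilation D z0 f p A.
Proof.
move=> dl; apply: contrapT => H.
have {}H A : exists2 d : R, 0 < d & forall w, D w -> rnorm (w - p) < d ->
    A <= kobayashi D z0 w - kobayashi D z0 (f w).
  apply: contrapT => H'; apply: H; exists A => d d0.
  apply: contrapT => H''; apply: H'; exists d => // w Dw hw.
  rewrite leNgt; apply/negP => h; apply: H''; exists w; split => //; exact: ltW.
move: dl; rewrite /dilation limf_einfE.
set S := [set _ | _ in _].
have -> : ereal_sup S = +oo%E.
  apply/eqyP => A A0; have [d d0 Hd] := H A.
  pose B := [set w : V | D w /\ rnorm (w - p) < d].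
  apply: (@le_trans _ _ (ereal_inf ((fun w => (kobayashi D z0 w - kobayashi D z0 (f w))%:E) @` B))).
    apply/le_ereal_inf_tmp => _ [w [Dw hw] <-]; rewrite lee_fin; exact: Hd.
  apply: ereal_sup_ubound; exists B => //.
  by apply/rnbhsP; exists d => // w hw Dw.
by rewrite gt0_muley // ltxx.
Qed.

Lemma bounded_dilation_lt D z0 f p A : bounded_dilation D z0 f p A ->
  (dilation D z0 f p < +oo)%E.
Proof.
move=> H; rewrite /dilation limf_einfE.
set S := [set _ | _ in _].
have h : (ereal_sup S <= A%:E)%E.
  apply: ge_ereal_sup => _ [B /rnbhsP[d d0 HB] <-].
  have [w [Dw hw le]] := H d d0.
  apply: (@le_trans _ _ (kobayashi D z0 w - kobayashi D z0 (f w))%:E); last by rewrite lee_fin.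
  by apply: ereal_inf_lbound; exists w => //; exact: HB.
have : (2%:E * ereal_sup S <= (2 * A)%:E)%E.
  by rewrite EFinM; apply: lee_wpmul2l.
rewrite -lee_expeR => /le_lt_trans; apply; exact: ltry.
Qed.

Section strongly_convex_domain.
Variables (D : set V) (z0 : V).
Hypotheses (oD : open D) (bD : bounded_set D) (sD : strongly_convex D) (Dz0 : D z0).

Let cD : convex_set D. Proof. by case: sD. Qed.
Let jD x y : D x -> D y -> joined D x y. Proof. exact: convex_joined. Qed.

(** An accumulation point of the values lies in the boundary: near a point of [D]
    the distance from [z0] is bounded, but [k z0 (f w) >= k z0 w - A] is
    unbounded. *)
Lemma julia_pair_exists f p A : boundary D p -> self_map D f ->
  bounded_dilation D z0 f p A -> exists2 q, boundary D q & julia_pair D z0 f p q A.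
Proof.
move=> bp fD H.
pose P (d : R) := [set v : V | exists w, [/\ D w, rnorm (w - p) < d,
   kobayashi D z0 w - kobayashi D z0 (f w) <= A & v = f w]].
have [|||q cq Hq] := @compact_accumulation (closure D) P (closure_compact bD).
- by move=> d _ _ [w [Dw _ _ ->]]; apply: subset_closure; exact: fD.
- by move=> d d' _ dd' _ [w [Dw hw hA ->]]; exists w; split => //; exact: lt_le_trans dd'.
- by move=> d d0; have [w [Dw hw hA]] := H d d0; exists (f w), w.
have jq : julia_pair D z0 f p q A.
  by move=> d d0; have [_ [w [Dw hw hA ->]] hq] := Hq d d0; exists w.
exists q; last exact: jq.
split; [exact: cq|move=> iq].
have Dq : D q by exact: interior_subset iq.
have [e [B [e0 HB]]] := kobayashi_locally_bounded oD cD Dz0 Dq.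
have [d d0 Hd] := kobayashi_boundary oD sD bp Dz0 (A + B + 1).
have [|w [Dw hw hf hA]] := jq (Num.min e d); first by rewrite lt_min e0.
move: hw hf; rewrite !lt_min => /andP[_ hw] /andP[hf _].
have h1 := Hd w Dw hw; have [_ _ h2] := HB _ hf.
by move: h1 h2 hA; move: (kobayashi _ _ _) (kobayashi _ _ _) => a b *; lra.
Qed.

(** Take [y = f w] and use that [f] contracts the distance between [z] and [w]. *)
Lemma julia f p q A z (l : R) : self_map D f -> holomorphic_on D f ->
  julia_pair D z0 f p q A -> D z ->
  (fun w => kobayashi D z w - kobayashi D z0 w) @ within D (nbhs p) --> l ->
  forall d : R, 0 < d -> exists y, [/\ D y, rnorm (y - q) < d &
    kobayashi D (f z) y - kobayashi D z0 y <= l + 1 + A].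
Proof.
move=> fD hf jq Dz /cvgrPdist_lt /(_ 1 ltr01) /rnbhsP [e e0 He] d d0.
have [|w [Dw hw hq hA]] := jq (Num.min e d); first by rewrite lt_min e0.
move: hw hq; rewrite !lt_min => /andP[hw _] /andP[_ hq].
have := He w hw Dw; rewrite /= ltr_norml => /andP[h1 _].
have h2 := kobayashi_contraction fD hf (jD Dz Dw).
exists (f w); split => //; first exact: fD.
move: h1 h2 hA.
move: (kobayashi D z w) (kobayashi D z0 w) (kobayashi D z0 (f w)) (kobayashi D (f z) (f w)) => a b c e' *; lra.
Qed.

(** In the K-region [l < ln M - k z0 z], and [k z0] is proper. *)
Lemma K_region_horofunction p M : boundary D p -> forall B : R,
  exists2 d : R, 0 < d & forall z, K_region D z0 p M z -> rnorm (z - p) < d ->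
    exists l : R, (fun w => kobayashi D z w - kobayashi D z0 w) @ within D (nbhs p) --> l
      /\ l < B.
Proof.
move=> bp B; have [d d0 Hd] := kobayashi_boundary oD sD bp Dz0 (ln M - B).
exists d => // z [Dz [l [hl lM]]] hz; exists l; split => //.
by have := Hd z Dz hz; move: lM; move: (kobayashi _ _ _) (ln M) => a b *; lra.
Qed.

(** At an accumulation point [x != q] of the values of [f], the upper bound of [julia]
    tends to minus infinity and contradicts [kobayashi_separation]. *)
Lemma julia_K_limit f p q A : boundary D p -> boundary D q -> self_map D f ->
  holomorphic_on D f -> julia_pair D z0 f p q A -> is_K_limit D z0 f p q.
Proof.
move=> bp bq fD hf jq u up [M [_ uM]]; apply: contrapT => nlim.
have [e e0 He] : exists2 e : R, 0 < e & forall n, exists2 k, (n <= k)%N & e <= rnorm (f (u k) - q).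
  apply: contrapT => H; apply: nlim => B /rnbhsP[e e0 HB].
  apply: contrapT => nB; apply: H; exists e => // n.
  apply: contrapT => H'; apply: nB; exists n => // k /= nk; apply: HB.
  by rewrite ltNge; apply/negP => h; apply: H'; exists k.
have unear (d : R) : 0 < d -> exists n, forall k, (n <= k)%N -> rnorm (u k - p) < d.
  move=> d0; have : nbhs p [set v | rnorm (v - p) < d] by apply/rnbhsP; exists d.
  by move=> /up [n _ Hn]; exists n => k nk; apply: Hn.
pose P (d : R) := [set v | exists k, [/\ rnorm (u k - p) < d, e <= rnorm (f (u k) - q) & v = f (u k)]].
have Du k : D (u k) by case: (uM k).
have [|||x cx Hx] := @compact_accumulation (closure D) P (closure_compact bD).
- by move=> d _ _ [k [_ _ ->]]; apply: subset_closure; exact: fD.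
- move=> d d' _ dd' _ [k [hk hA ->]]; exists k.
  by split; [exact: lt_le_trans hk dd'|exact: hA|].
- move=> d d0; have [n Hn] := unear d d0; have [k nk hk] := He n.
  by exists (f (u k)), k; split; [exact: Hn|exact: hk|].
have xq : x != q.
  apply/eqP => xq; have [_ [k [_ hk ->]]] := Hx e e0.
  by rewrite xq ltNge hk.
have [d [B [d0 HB]]] := kobayashi_separation oD sD bq Dz0 cx xq.
have [d' d'0 Hd'] := K_region_horofunction M bp (B - 1 - A).
have [|_ [k [hk _ ->]] hkx] := Hx (Num.min d d'); first by rewrite lt_min d0.
move: hk hkx; rewrite !lt_min => /andP[_ hk] /andP[hkx _].
have [l [hl lB]] := Hd' _ (uM k) hk.
have [y [Dy hy le]] := julia fD hf jq (Du k) hl d0.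
have := HB _ y (fD _ (Du k)) Dy hkx hy.
by move: le; move: (_ - kobayashi _ _ _) => a *; lra.
Qed.

End strongly_convex_domain.
End julia.

(** * Semigroups *)

Section semigroups.
Context {R : realType} {N : nat}.
Notation C := (Cplx R).
Notation V := (CN R N).
Implicit Types (D : set V) (p q z w x : V) (f : V -> V).

Lemma semigroup_continuous D (phi : R -> V -> V) z (t : R) : semigroup D phi -> D z ->
  0 <= t -> forall e : R, 0 < e -> exists2 d : R, 0 < d & forall s, 0 <= s ->
    `|s - t| < d -> rnorm (phi s z - phi t z) < e.
Proof.
move=> [_ _ _ cont] Dz t0 e e0.
have zD : [set z] `<=` D by move=> _ ->.
have := cont t t0 [set z] (@compact_set1 _ z) zD; rewrite uniform_set1 => h.
have nb : nbhs (phi t z) [set v | rnorm (v - phi t z) < e] by apply/rnbhsP; exists e.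
have [d d0 Hd] := h _ nb; exists d => // s s0 hs.
by apply: (Hd s) => //; rewrite /= distrC.
Qed.

(** Uniqueness of K-limits at [p] amounts to the existence of such a sequence. *)
Definition accessible D z0 p : Prop := exists u : nat -> V,
  u @ \oo --> p /\ exists M : R, 1 < M /\ forall k, K_region D z0 p M (u k).

Lemma K_limit_unique D z0 f p q q' : accessible D z0 p ->
  is_K_limit D z0 f p q -> is_K_limit D z0 f p q' -> q = q'.
Proof.
move=> [u [up uM]] h h'; have c := h u up uM; have c' := h' u up uM.
exact: (cvg_unique (@norm_hausdorff _ V) c c').
Qed.

Lemma K_limE D z0 f p q : accessible D z0 p -> is_K_limit D z0 f p q ->
  K_lim D z0 f p = q.
Proof.
move=> acc h; have hk : is_K_limit D z0 f p (K_lim D z0 f p) := getPex (ex_intro _ q h).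
exact: (K_limit_unique acc hk h).
Qed.

(** Every point is vacuously a K-limit of every map, and [get] selects the same
    one from equal sets. *)
Lemma K_lim_inaccessible D z0 f f' p : ~ accessible D z0 p ->
  K_lim D z0 f p = K_lim D z0 f' p.
Proof.
move=> nacc; rewrite /K_lim; congr get; apply/funext => q; apply/propext.
by split=> _ u up uM; exfalso; apply: nacc; exists u.
Qed.

Lemma too_negative (B X l A K B1 : R) : B <= X -> X <= l + 1 + (A + K) ->
  l < B - 1 - (A + B1) -> K <= B1 -> False.
Proof. by move=> *; lra. Qed.

Section strongly_convex_domain.
Variables (D : set V) (z0 : V) (phi : R -> V -> V).
Hypotheses (oD : open D) (bD : bounded_set D) (sD : strongly_convex D) (Dz0 : D z0).
Hypothesis (sg : semigroup D phi).

Let cD : convex_set D. Proof. by case: sD. Qed.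

(** [k z0 (phi_t w) <= k z0 (phi_(t - r) z0) + k z0 (phi_r w)]. *)
Lemma semigroup_dilation p (A r t : R) : 0 <= r -> r <= t ->
  bounded_dilation D z0 (phi t) p A ->
  bounded_dilation D z0 (phi r) p (A + kobayashi D z0 (phi (t - r) z0)).
Proof.
move=> r0 rt H d d0; have [w [Dw hw hA]] := H d d0; exists w; split=> //.
have [self _ comp _] := sg.
have s0 : 0 <= t - r by rewrite subr_ge0.
have [sD' hol] := self _ s0; have [rD _] := self _ r0.
have e : phi t w = phi (t - r) (phi r w) by rewrite -comp ?subrK.
have j1 : joined D z0 (phi (t - r) z0) by apply: convex_joined => //; exact: sD'.
have j2 : joined D (phi (t - r) z0) (phi (t - r) (phi r w)).
  by apply: convex_joined => //; apply: sD' => //; exact: rD.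
have j3 : joined D z0 (phi r w) by apply: convex_joined => //; exact: rD.
have h1 := kobayashi_triangle j1 j2; have h2 := kobayashi_contraction sD' hol j3.
rewrite -e in h1 h2; move: hA h1 h2.
move: (kobayashi D z0 w) (kobayashi D z0 (phi t w)) (kobayashi D z0 (phi (t - r) z0))
  (kobayashi D z0 (phi r w)) (kobayashi D _ _) => a1 a2 a3 a4 a5 *; lra.
Qed.

(** Suppose that [q r] accumulates at [x != q r0] as [r] tends to [r0].  A point [z]
    of the K-region close to [p] is mapped close to [q r0] by [phi r0], hence by
    [phi r] for [r] near [r0]; Julia's lemma for [phi r] at [q r], a point close to
    [x], then contradicts the separation of [q r0] from [x]. *)
Lemma semigroup_K_limit_continuous p (A t r0 : R) (q : R -> V) : boundary D p ->
  accessible D z0 p -> 0 <= r0 < t ->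
  (forall r, 0 <= r < t -> boundary D (q r) /\
     julia_pair D z0 (phi r) p (q r) (A + kobayashi D z0 (phi (t - r) z0))) ->
  forall e : R, 0 < e -> exists2 d : R, 0 < d & forall r, 0 <= r < t ->
    `|r - r0| < d -> rnorm (q r - q r0) < e.
Proof.
move=> bp [u [up [M [M1 uM]]]] hr0 H e e0; apply: contrapT => nH.
have [self _ _ _] := sg; have /andP[r00 r0t] := hr0.
have {nH}far (d : R) : 0 < d -> exists r, [/\ 0 <= r < t, `|r - r0| < d & e <= rnorm (q r - q r0)].
  move=> d0; apply: contrapT => H'; apply: nH; exists d => // r hr hd.
  by rewrite ltNge; apply/negP => h; apply: H'; exists r.
pose P (d : R) := [set v | exists r, [/\ 0 <= r < t, `|r - r0| < d, e <= rnorm (q r - q r0) & v = q r]].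
have [|||x cx Hx] := @compact_accumulation R N (closure D) P (closure_compact bD).
- by move=> d _ _ [r [hr _ _ ->]]; have [[c _] _] := H r hr; exact: c.
- move=> d d' _ dd' _ [r [hr hd he ->]]; exists r.
  by split; [exact: hr|exact: lt_le_trans hd dd'|exact: he|].
- move=> d d0; have [r [hr hd he]] := far d d0; exists (q r), r.
  by split; [exact: hr|exact: hd|exact: he|].
have bx : boundary D x.
  split; [exact: cx|move=> ix]; have Dx : D x by exact: interior_subset ix.
  have [d d0 Hd] := open_ball oD Dx.
  have [_ [r [hr _ _ ->]] hs] := Hx d d0.
  by have [bq _] := H r hr; have [_ nq] := boundary_open oD bq; apply: nq; exact: Hd.
have qx : q r0 != x.
  apply/eqP => qx; have [_ [r [_ _ he ->]] hs] := Hx e e0.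
  by move: hs; rewrite -qx ltNge he.
have [bq0 jq0] := H r0 hr0.
have [cq0 _] := boundary_open oD bq0.
have [d [B [d0 HB]]] := kobayashi_separation oD sD bx Dz0 cq0 qx.
have [fD0 hf0] := self r0 r00.
have tr0 : 0 <= t - r0 by rewrite subr_ge0 ltW.
(* the constant in Julia's lemma is bounded for [r] near [r0] *)
have Dphi : D (phi (t - r0) z0) by have [h _] := self _ tr0; exact: h.
have [e1 [B1 [e10 HB1]]] := kobayashi_locally_bounded oD cD Dz0 Dphi.
have [d1 d10 Hd1] := semigroup_continuous sg Dz0 tr0 e10.
have klim := julia_K_limit oD bD sD Dz0 bp bq0 fD0 hf0 jq0.
have uq : (phi r0 \o u) @ \oo --> q r0 by have h := klim u up (ex_intro _ M (conj M1 uM)); exact: h.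
have [d2 d20 Hd2] := K_region_horofunction oD sD Dz0 M bp (B - 1 - (A + B1)).
have nb1 : nbhs p [set v | rnorm (v - p) < d2] by apply/rnbhsP; exists d2.
have d02 : 0 < d / 2 by rewrite divr_gt0.
have nb2 : nbhs (q r0) [set v | rnorm (v - q r0) < d / 2] by apply/rnbhsP; exists (d / 2).
have [n1 _ Hn1] := up _ nb1; have [n2 _ Hn2] := uq _ nb2.
pose k := maxn n1 n2.
have h1 : rnorm (u k - p) < d2 by apply: Hn1; exact: leq_maxl.
have h2 : rnorm (phi r0 (u k) - q r0) < d / 2 by apply: Hn2; exact: leq_maxr.
have [Duk _] := uM k.
have [l [hl lB]] := Hd2 _ (uM k) h1.
have [d3 d30 Hd3] := semigroup_continuous sg Duk r00 d02.
have m0 : 0 < Num.min d1 (Num.min d3 (d / 2)) by rewrite !lt_min d10 d30.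
have [_ [r [hr hrr _ ->]]] := Hx _ m0.
move: hrr; rewrite !lt_min => /and3P[hr1 hr3 _] /and3P[_ _ hqx].
have /andP[rr0 rt] := hr.
have [bqr jqr] := H r hr.
have [fD hf] := self r rr0.
have hB1 : kobayashi D z0 (phi (t - r) z0) <= B1.
  have tr : 0 <= t - r by rewrite subr_ge0 ltW.
  have c : `|t - r - (t - r0)| < d1 by rewrite opprB addrC addrA subrK distrC.
  by have [_ _ h] := HB1 _ (Hd1 _ tr c); exact: h.
have [y [Dy hy le]] := julia oD sD fD hf jqr Duk hl d02.
have hx : rnorm (phi r (u k) - q r0) < d.
  have h3 := Hd3 r rr0 hr3; rewrite -(subrK (phi r0 (u k)) (phi r (u k))) -addrA.
  apply: le_lt_trans (rnormD _ _) _.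
  by rewrite (splitr d); apply: ltrD.
have hyx : rnorm (y - x) < d.
  rewrite -(subrK (q r) y) -addrA; apply: le_lt_trans (rnormD _ _) _.
  by rewrite (splitr d); apply: ltrD.
have low := HB _ y (fD _ Duk) Dy hx hyx.
exact: (too_negative low le lB hB1).
Qed.

End strongly_convex_domain.

Theorem semigroup_regular_contact D z0 (phi : R -> V -> V) (t0 : R) p : domain D ->
  bounded_set D -> strongly_convex D -> D z0 -> semigroup D phi ->
  boundary D p -> regular_contact_point D z0 (phi t0) p ->
  (forall t : R, 0 <= t < t0 -> regular_contact_point D z0 (phi t) p) /\
  {within [set r : R | 0 <= r < t0], continuous (fun r : R => K_lim D z0 (phi r) p)}.
Proof.
move=> [oD _ _] bD sD Dz0 sg bp [[_ _ blim] dl].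
have [self _ _ _] := sg.
have [A HA] := dilation_bounded dl.
have Hr r : 0 <= r < t0 -> bounded_dilation D z0 (phi r) p (A + kobayashi D z0 (phi (t0 - r) z0)).
  by move=> /andP[r0 rt]; apply: (semigroup_dilation oD sD Dz0 sg r0 (ltW rt)).
have Hq (r : R) : exists q, 0 <= r < t0 -> boundary D q /\
     julia_pair D z0 (phi r) p q (A + kobayashi D z0 (phi (t0 - r) z0)).
  have [hr|nr] := pselect (0 <= r < t0); last by exists p.
  have /andP[r0 _] := hr; have [fD _] := self r r0.
  by have [q bq jq] := julia_pair_exists oD bD sD Dz0 bp fD (Hr r hr); exists q.
have [q {}Hq] := choice Hq.
have klim r : 0 <= r < t0 -> is_K_limit D z0 (phi r) p (q r).
  move=> hr; have /andP[r0 _] := hr; have [fD hf] := self r r0.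
  by have [bq jq] := Hq r hr; exact: (julia_K_limit oD bD sD Dz0 bp bq fD hf jq).
split.
  move=> r hr; split; last exact: bounded_dilation_lt (Hr r hr).
  split; [exact: bp|by exists (q r); exact: klim|].
  have [acc|nacc] := pselect (accessible D z0 p).
    by rewrite (K_limE acc (klim r hr)); have [bq _] := Hq r hr; exact: bq.
  by rewrite (K_lim_inaccessible (phi r) (phi t0) nacc); exact: blim.
have [acc|nacc] := pselect (accessible D z0 p); last first.
  have -> : (fun r => K_lim D z0 (phi r) p) = cst (K_lim D z0 (phi t0) p).
    by apply/funext => r; exact: K_lim_inaccessible.
  by apply: continuous_subspaceT => r; exact: cst_continuous.
apply/subspace_continuousP => r0 hr0 B /rnbhsP[e e0 HB].
have [d d0 Hd] := semigroup_K_limit_continuous oD bD sD Dz0 sg bp acc hr0 Hq e0.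
exists d => // r hrr hr; apply: HB.
have close : rnorm (q r - q r0) < e by apply: Hd; [exact: hr|rewrite distrC].
by rewrite /from_subspace (K_limE acc (klim r hr)) (K_limE acc (klim r0 hr0)).
Qed.
End semigroups.

Theorem proposition5p1 (R : realType) (N : nat) (N_gt0 : (0 < N)%N)
    (D : set (CN R N)) (D_domain : domain D) (D_bounded : bounded_set D)
    (D_smooth : smooth_boundary D) (D_convex : strongly_convex D)
    (z0 : CN R N) (z0_D : D z0)
    (phi : R -> CN R N -> CN R N) (phi_semigroup : semigroup D phi)
    (t0 : R) (t0_gt0 : 0 < t0) (p : CN R N) (p_boundary : boundary D p)
    (p_contact : regular_contact_point D z0 (phi t0) p) :
  exists T : \bar R, (t0%:E <= T)%E /\
    (forall t : R, 0 <= t -> (t%:E < T)%E ->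
       regular_contact_point D z0 (phi t) p) /\
    {within [set r : R | 0 <= r /\ (r%:E < T)%E],
       continuous (fun r : R => K_lim D z0 (phi r) p)}.
Proof.
have [contact cont] := semigroup_regular_contact D_domain D_bounded D_convex z0_D
  phi_semigroup p_boundary p_contact.
exists t0%:E; split; first exact: lexx.
split; first by move=> t t_ge0; rewrite lte_fin => t_lt; apply: contact; rewrite t_ge0.
rewrite (_ : [set r : R | 0 <= r /\ (r%:E < t0%:E)%E] = [set r : R | 0 <= r < t0]).
  exact: cont.
apply/seteqP; split=> r /=; first by move=> [r0]; rewrite lte_fin => rt; apply/andP.
by move=> /andP[r0 rt]; rewrite lte_fin.
Qed.
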